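(* Let $f$ and $g$ be transcendental entire functions with $f\circ g=g\circ f$. Then $F(f\circ g)\subset F(f)\cap F(g)$.
   Context: For an entire function $h$, $h^n$ denotes the $n$-th iterate; the Fatou set $F(h)$ is the set of $z\in\mathbb{C}$ having a neighborhood on which the family $\{h^n\}_{n\in\mathbb{N}}$ is normal. *)

(* Defs.v *)
From Stdlib Require Import Reals List.
Open Scope R_scope.

Definition Cplx : Type := (R * R)%type.
Definition C0 : Cplx := (0, 0).
Definition Cadd (z w : Cplx) : Cplx := (fst z + fst w, snd z + snd w).
Definition Csub (z w : Cplx) : Cplx := (fst z - fst w, snd z - snd w).
Definition Cmul (z w : Cplx) : Cplx :=
  (fst z * fst w - snd z * snd w, fst z * snd w + snd z * fst w).
Definition Cnorm (z : Cplx) : R := sqrt (fst z * fst z + snd z * snd z).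

Definition ball (c : Cplx) (r : R) (w : Cplx) : Prop := Cnorm (Csub w c) < r.

Definition C_differentiable_at (f : Cplx -> Cplx) (z : Cplx) : Prop :=
  exists l : Cplx, forall eps, 0 < eps -> exists delta, 0 < delta /\
    forall h : Cplx, Cnorm h < delta ->
      Cnorm (Csub (Csub (f (Cadd z h)) (f z)) (Cmul l h)) <= eps * Cnorm h.

Definition entire (f : Cplx -> Cplx) : Prop := forall z, C_differentiable_at f z.

Definition poly_eval (l : list Cplx) (z : Cplx) : Cplx :=
  fold_right (fun a acc => Cadd a (Cmul z acc)) C0 l.

Definition is_polynomial (f : Cplx -> Cplx) : Prop :=
  exists l : list Cplx, forall z, f z = poly_eval l z.

Definition transcendental_entire (f : Cplx -> Cplx) : Prop :=
  entire f /\ ~ is_polynomial f.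

Definition iterate (h : Cplx -> Cplx) (n : nat) : Cplx -> Cplx := Nat.iter n h.

Definition unif_conv_on (U : Cplx -> Prop) (F : nat -> Cplx -> Cplx) (g : Cplx -> Cplx) : Prop :=
  forall eps, 0 < eps -> exists N, forall k, (N <= k)%nat ->
    forall w, U w -> Cnorm (Csub (F k w) (g w)) < eps.

Definition unif_to_infty_on (U : Cplx -> Prop) (F : nat -> Cplx -> Cplx) : Prop :=
  forall M, exists N, forall k, (N <= k)%nat -> forall w, U w -> M < Cnorm (F k w).

Definition loc_unif_conv_on (U : Cplx -> Prop) (F : nat -> Cplx -> Cplx) (g : Cplx -> Cplx) : Prop :=
  forall z, U z -> exists r, 0 < r /\ (forall w, ball z r w -> U w) /\
    unif_conv_on (ball z r) F g.

Definition loc_unif_to_infty_on (U : Cplx -> Prop) (F : nat -> Cplx -> Cplx) : Prop :=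
  forall z, U z -> exists r, 0 < r /\ (forall w, ball z r w -> U w) /\
    unif_to_infty_on (ball z r) F.

Definition iterates_normal_on (h : Cplx -> Cplx) (U : Cplx -> Prop) : Prop :=
  forall s : nat -> nat,
    exists phi : nat -> nat, (forall k, (phi k < phi (S k))%nat) /\
      let F := fun k => iterate h (s (phi k)) in
      ((exists g : Cplx -> Cplx, loc_unif_conv_on U F g) \/ loc_unif_to_infty_on U F).

Definition in_Fatou (h : Cplx -> Cplx) (z : Cplx) : Prop :=
  exists r, 0 < r /\ iterates_normal_on h (ball z r).

(* Main.v *)
(** Put [h = f o g], which commutes with [f] and [g].  The Fatou set of [h] is mapped into itself by [f]:
    on a disc of normality of [h], if [h^(n+1) = g o h^n o f] tends to infinity then so does
    [h^n o f], and otherwise [h^n] omits, near the image under [f], the points where [|g|] is large,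
    so that Montel's theorem applies.  The complement of the Fatou set of [h] has two points, and the
    iterates of [f] omit them on the Fatou set of [h]; Montel's theorem then shows that they are normal there.

    If the complement had at most one point [a], then by growth (the image of a large disc contains
    a circle of twice its radius) every orbit outside [a] would tend to infinity; hence [h] has no
    periodic points outside [a], and Picard's theorem makes [h] affine.

    Everything about two omitted values comes from Ahlfors' method: at a maximum of the pullback of a
    metric of curvature [<= -k] on [C \ {0, 1}], weighted by [r^2 - |z|^2], the Laplacian of its logarithm
    is nonpositive, which bounds the metric.  As the metric is complete at infinity, integrating the
    bound gives Schottky's theorem. *)

From Stdlib Require Import Reals Lra Lia Psatz List ClassicalEpsilon FunctionalExtensionality.
From Coquelicot Require Import Coquelicot.
Require Import Defs.
Open Scope R_scope.

(** * Complex differentiability *)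

(** Being entire means complex differentiability only, yet Ahlfors' method takes the Laplacian of
    log |f'|. Hence the chain from Goursat's theorem to the fact that the derivative is again
    entire. Contour integrals over circles are avoided: in the coordinate [cexp] a circle is a
    vertical segment, so rectangles suffice for Cauchy's formula, and the same coordinate later
    removes the point [a] from the plane in the case [h a = a]. An explicit metric takes the place
    of the modular function; its constants are not optimal. Montel's theorem asks for just two
    omitted values, so two points outside the Fatou set are enough. If at most one point lay
    outside, the rest of the plane would still contain rays and circles along which boundedness of
    iterates spreads, and this is what forces orbits to escape. The omitted values are not always
    fixed: the covering of large circles rescales [h] by [r], so Schottky's bound must be uniform
    over pairs of values of bounded modulus and bounded-below distance. *)

Lemma Cnorm_Cmod (z : C) : Cnorm z = Cmod z.
Proof. unfold Cnorm, Cmod. f_equal. ring. Qed.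

Lemma Cmod_minus_sym (z w : C) : Cmod (z - w) = Cmod (w - z).
Proof. rewrite <- Cmod_opp. f_equal. ring. Qed.

Lemma Cmod_minus_triangle (a b c : C) : Cmod (a - c) <= Cmod (a - b) + Cmod (b - c).
Proof.
  replace (a - c)%C with ((a - b) + (b - c))%C by ring. apply Cmod_triangle.
Qed.

Lemma Cmod_triangle_minus (a b : C) : Cmod (a - b) <= Cmod a + Cmod b.
Proof. unfold Cminus. rewrite <- (Cmod_opp b). apply Cmod_triangle. Qed.

Lemma Cmod_triangle_inv (a b : C) : Cmod a - Cmod b <= Cmod (a - b).
Proof.
  pose proof (Cmod_triangle (a - b) b) as H.
  replace (a - b + b)%C with a in H by ring. lra.
Qed.

Lemma Cmod_le_abs (z : C) : Cmod z <= Rabs (fst z) + Rabs (snd z).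
Proof.
  destruct z as [x y]. simpl.
  replace ((x, y) : C) with (RtoC x + Ci * RtoC y)%C
    by (unfold Cplus, Cmult, Ci, RtoC; simpl; f_equal; ring).
  eapply Rle_trans; [apply Cmod_triangle|].
  rewrite Cmod_mult, Cmod_Ci, !Cmod_R. lra.
Qed.

Lemma fst_le_Cmod (z : C) : Rabs (fst z) <= Cmod z.
Proof. eapply Rle_trans; [|apply Rmax_Cmod]. apply Rmax_l. Qed.

Lemma snd_le_Cmod (z : C) : Rabs (snd z) <= Cmod z.
Proof. eapply Rle_trans; [|apply Rmax_Cmod]. apply Rmax_r. Qed.

Lemma Cmod_sqr (z : C) : Cmod z ^ 2 = fst z ^ 2 + snd z ^ 2.
Proof. apply Cmod2_alt. Qed.

Lemma ball_iff (c : C) (r : R) (w : C) : ball c r w <-> Cmod (w - c) < r.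
Proof. unfold ball. rewrite Cnorm_Cmod. reflexivity. Qed.

Definition cderiv (f : C -> C) (z l : C) : Prop :=
  forall eps, 0 < eps -> exists delta, 0 < delta /\
    forall h : C, Cmod h < delta ->
      Cmod (f (z + h)%C - f z - l * h)%C <= eps * Cmod h.

Lemma differentiable_cderiv (f : C -> C) (z : C) :
  C_differentiable_at f z <-> exists l, cderiv f z l.
Proof.
  split; intros [l Hl]; exists l; intros eps He; destruct (Hl eps He) as [d [Hd H]];
    exists d; (split; [exact Hd|]); intros h Hh; specialize (H h).
  - rewrite !Cnorm_Cmod in H. exact (H Hh).
  - rewrite !Cnorm_Cmod in *. exact (H Hh).
Qed.

(** Choice makes the derivative a total function, so that it can be iterated and integrated; its
    value carries information only where a derivative exists. *)
Definition D (f : C -> C) (z : C) : C := epsilon (inhabits (RtoC 0)) (fun l => cderiv f z l).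

Lemma D_spec (f : C -> C) (z : C) : entire f -> cderiv f z (D f z).
Proof.
  intros Hf. unfold D. apply epsilon_spec, differentiable_cderiv, Hf.
Qed.

Lemma entire_of_cderiv (f f1 : C -> C) : (forall z, cderiv f z (f1 z)) -> entire f.
Proof. intros H z. apply differentiable_cderiv. exists (f1 z). apply H. Qed.

Lemma cderiv_bound (f : C -> C) (z l : C) : cderiv f z l ->
  exists delta, 0 < delta /\ forall h, Cmod h < delta ->
    Cmod (f (z + h)%C - f z)%C <= (Cmod l + 1) * Cmod h.
Proof.
  intros H. destruct (H 1 Rlt_0_1) as [d [Hd Hb]]. exists d; split; [exact Hd|].
  intros h Hh. replace (f (z + h)%C - f z)%C with (f (z + h)%C - f z - l * h + l * h)%C by ring.
  eapply Rle_trans; [apply Cmod_triangle|]. rewrite Cmod_mult. specialize (Hb h Hh). lra.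
Qed.

Definition ccont (f : C -> C) (z : C) : Prop :=
  forall eps, 0 < eps -> exists delta, 0 < delta /\
    forall w : C, Cmod (w - z) < delta -> Cmod (f w - f z)%C < eps.

Lemma cderiv_ccont (f : C -> C) (z l : C) : cderiv f z l -> ccont f z.
Proof.
  intros H eps He. destruct (cderiv_bound f z l H) as [d [Hd Hb]].
  pose proof (Cmod_ge_0 l) as Hl.
  exists (Rmin d (eps / (Cmod l + 1))). split.
  - apply Rmin_pos; [exact Hd|]. apply Rdiv_lt_0_compat; lra.
  - intros w Hw. replace w with (z + (w - z))%C by ring.
    apply Rle_lt_trans with ((Cmod l + 1) * Cmod (w - z)).
    + apply Hb. eapply Rlt_le_trans; [exact Hw|apply Rmin_l].
    + assert (Hw2 : Cmod (w - z) < eps / (Cmod l + 1))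
        by (eapply Rlt_le_trans; [exact Hw|apply Rmin_r]).
      apply Rmult_lt_compat_l with (r := Cmod l + 1) in Hw2; [|lra].
      replace ((Cmod l + 1) * (eps / (Cmod l + 1))) with eps in Hw2 by (field; lra).
      exact Hw2.
Qed.

Lemma entire_ccont (f : C -> C) (z : C) : entire f -> ccont f z.
Proof. intros Hf. eapply cderiv_ccont, D_spec, Hf. Qed.

Lemma cderiv_unique (f : C -> C) (z l m : C) : cderiv f z l -> cderiv f z m -> l = m.
Proof.
  intros Hl Hm. apply NNPP. intros Hne.
  assert (Hp : 0 < Cmod (l - m)).
  { apply Cmod_gt_0. intros E. apply Hne. replace l with (l - m + m)%C by ring.
    rewrite E. ring. }
  destruct (Hl (Cmod (l - m) / 4)) as [d1 [Hd1 H1]]; [lra|].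
  destruct (Hm (Cmod (l - m) / 4)) as [d2 [Hd2 H2]]; [lra|].
  set (t := Rmin d1 d2 / 2).
  assert (Ht : 0 < Rmin d1 d2) by (apply Rmin_pos; assumption).
  pose proof (Rmin_l d1 d2). pose proof (Rmin_r d1 d2).
  assert (Hc : Cmod (RtoC t) = t) by (rewrite Cmod_R; apply Rabs_pos_eq; unfold t; lra).
  specialize (H1 t). specialize (H2 t). rewrite Hc in H1, H2.
  specialize (H1 ltac:(unfold t; lra)). specialize (H2 ltac:(unfold t; lra)).
  assert (E : ((l - m) * t)%C =
    ((f (z + t) - f z - m * t) - (f (z + t) - f z - l * t))%C) by ring.
  assert (Hx : Cmod (l - m) * t <= Cmod (l - m) / 4 * t + Cmod (l - m) / 4 * t).
  { rewrite <- Hc at 1. rewrite <- Cmod_mult, E.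
    eapply Rle_trans; [apply Cmod_triangle_minus|]. lra. }
  assert (0 < t) by (unfold t; lra). nra.
Qed.

Lemma D_eq (f : C -> C) (z l : C) : cderiv f z l -> D f z = l.
Proof.
  intros H. apply cderiv_unique with f z; [|exact H].
  unfold D. apply epsilon_spec. exists l; exact H.
Qed.

Lemma cderiv_const (c z : C) : cderiv (fun _ => c) z 0.
Proof.
  intros eps He. exists 1. split; [lra|]. intros h _.
  replace (c - c - 0 * h)%C with (RtoC 0) by ring. rewrite Cmod_0.
  apply Rmult_le_pos; [lra|apply Cmod_ge_0].
Qed.

Lemma cderiv_id (z : C) : cderiv (fun w => w) z 1.
Proof.
  intros eps He. exists 1. split; [lra|]. intros h _.
  replace (z + h - z - 1 * h)%C with (RtoC 0) by ring. rewrite Cmod_0.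
  apply Rmult_le_pos; [lra|apply Cmod_ge_0].
Qed.

Lemma cderiv_plus (f g : C -> C) (z l m : C) :
  cderiv f z l -> cderiv g z m -> cderiv (fun w => f w + g w)%C z (l + m).
Proof.
  intros Hf Hg eps He.
  destruct (Hf (eps / 2)) as [d1 [Hd1 H1]]; [lra|].
  destruct (Hg (eps / 2)) as [d2 [Hd2 H2]]; [lra|].
  exists (Rmin d1 d2). split; [apply Rmin_pos; assumption|]. intros h Hh.
  specialize (H1 h (Rlt_le_trans _ _ _ Hh (Rmin_l _ _))).
  specialize (H2 h (Rlt_le_trans _ _ _ Hh (Rmin_r _ _))).
  replace (f (z + h)%C + g (z + h)%C - (f z + g z) - (l + m) * h)%C
    with ((f (z + h)%C - f z - l * h) + (g (z + h)%C - g z - m * h))%C by ring.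
  eapply Rle_trans; [apply Cmod_triangle|]. lra.
Qed.

Lemma cderiv_mult (f g : C -> C) (z l m : C) :
  cderiv f z l -> cderiv g z m -> cderiv (fun w => f w * g w)%C z (l * g z + f z * m).
Proof.
  intros Hf Hg eps He.
  pose proof (Cmod_ge_0 (f z)) as Hfz. pose proof (Cmod_ge_0 (g z)) as Hgz.
  pose proof (Cmod_ge_0 l) as Hl. pose proof (Cmod_ge_0 m) as Hm.
  destruct (Hf (eps / (3 * (Cmod (g z) + 1)))) as [d1 [Hd1 H1]];
    [apply Rdiv_lt_0_compat; lra|].
  destruct (Hg (eps / (3 * (Cmod (f z) + 1)))) as [d2 [Hd2 H2]];
    [apply Rdiv_lt_0_compat; lra|].
  destruct (cderiv_bound f z l Hf) as [d3 [Hd3 H3]].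
  destruct (cderiv_bound g z m Hg) as [d4 [Hd4 H4]].
  set (d5 := eps / (3 * ((Cmod l + 1) * (Cmod m + 1)))).
  assert (Hlm : 0 < (Cmod l + 1) * (Cmod m + 1)) by (apply Rmult_lt_0_compat; lra).
  assert (Hd5 : 0 < d5) by (apply Rdiv_lt_0_compat; lra).
  exists (Rmin (Rmin d1 d2) (Rmin (Rmin d3 d4) d5)).
  split; [repeat apply Rmin_pos; assumption|]. intros h Hh.
  assert (Hh1 : Cmod h < d1 /\ Cmod h < d2 /\ Cmod h < d3 /\ Cmod h < d4 /\ Cmod h < d5).
  { repeat split; eapply Rlt_le_trans; try exact Hh.
    - eapply Rle_trans; [apply Rmin_l|apply Rmin_l].
    - eapply Rle_trans; [apply Rmin_l|apply Rmin_r].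
    - eapply Rle_trans; [apply Rmin_r|]. eapply Rle_trans; [apply Rmin_l|apply Rmin_l].
    - eapply Rle_trans; [apply Rmin_r|]. eapply Rle_trans; [apply Rmin_l|apply Rmin_r].
    - eapply Rle_trans; [apply Rmin_r|]. apply Rmin_r. }
  destruct Hh1 as [Hh1 [Hh2 [Hh3 [Hh4 Hh5]]]].
  specialize (H1 h Hh1). specialize (H2 h Hh2). specialize (H3 h Hh3). specialize (H4 h Hh4).
  replace (f (z + h)%C * g (z + h)%C - f z * g z - (l * g z + f z * m) * h)%C
    with ((f (z + h)%C - f z - l * h) * g z + f z * (g (z + h)%C - g z - m * h)
          + (f (z + h)%C - f z) * (g (z + h)%C - g z))%C by ring.
  eapply Rle_trans; [apply Cmod_triangle|].
  eapply Rle_trans; [apply Rplus_le_compat_r, Cmod_triangle|].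
  rewrite !Cmod_mult. pose proof (Cmod_ge_0 h) as Hhp.
  assert (B1 : Cmod (f (z + h)%C - f z - l * h) * Cmod (g z) <= eps / 3 * Cmod h).
  { apply Rle_trans with (eps / (3 * (Cmod (g z) + 1)) * Cmod h * (Cmod (g z) + 1)).
    - apply Rmult_le_compat; try apply Cmod_ge_0; lra.
    - right. field. lra. }
  assert (B2 : Cmod (f z) * Cmod (g (z + h)%C - g z - m * h) <= eps / 3 * Cmod h).
  { apply Rle_trans with ((Cmod (f z) + 1) * (eps / (3 * (Cmod (f z) + 1)) * Cmod h)).
    - apply Rmult_le_compat; try apply Cmod_ge_0; lra.
    - right. field. lra. }
  assert (B3 : Cmod (f (z + h)%C - f z) * Cmod (g (z + h)%C - g z) <= eps / 3 * Cmod h).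
  { apply Rle_trans with (((Cmod l + 1) * Cmod h) * ((Cmod m + 1) * d5)).
    - apply Rmult_le_compat; try apply Cmod_ge_0; try lra.
      eapply Rle_trans; [exact H4|]. apply Rmult_le_compat_l; lra.
    - right. unfold d5. field. split; lra. }
  lra.
Qed.

Lemma cderiv_scal (c : C) (f : C -> C) (z l : C) :
  cderiv f z l -> cderiv (fun w => c * f w)%C z (c * l).
Proof.
  intros H. replace (c * l)%C with (0 * f z + c * l)%C by ring.
  apply (cderiv_mult (fun _ => c) f); [apply cderiv_const|exact H].
Qed.

Lemma cderiv_minus (f g : C -> C) (z l m : C) :
  cderiv f z l -> cderiv g z m -> cderiv (fun w => f w - g w)%C z (l - m).
Proof.
  intros Hf Hg.
  replace (fun w => f w - g w)%C with (fun w => f w + (- (1)) * g w)%C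
    by (apply functional_extensionality; intros; ring).
  replace (l - m)%C with (l + (- (1)) * m)%C by ring.
  apply cderiv_plus; [exact Hf|]. apply cderiv_scal, Hg.
Qed.

Lemma cderiv_comp (f g : C -> C) (z l m : C) :
  cderiv g z m -> cderiv f (g z) l -> cderiv (fun w => f (g w)) z (l * m).
Proof.
  intros Hg Hf eps He.
  pose proof (Cmod_ge_0 l) as Hl. pose proof (Cmod_ge_0 m) as Hm.
  destruct (Hf (eps / (2 * (Cmod m + 1)))) as [d1 [Hd1 H1]];
    [apply Rdiv_lt_0_compat; lra|].
  destruct (Hg (eps / (2 * (Cmod l + 1)))) as [d2 [Hd2 H2]];
    [apply Rdiv_lt_0_compat; lra|].
  destruct (cderiv_bound g z m Hg) as [d3 [Hd3 H3]].
  set (d4 := d1 / (Cmod m + 1)).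
  assert (Hd4 : 0 < d4) by (apply Rdiv_lt_0_compat; lra).
  exists (Rmin d2 (Rmin d3 d4)). split; [repeat apply Rmin_pos; assumption|]. intros h Hh.
  assert (Hh2 : Cmod h < d2 /\ Cmod h < d3 /\ Cmod h < d4).
  { repeat split; eapply Rlt_le_trans; try exact Hh.
    - apply Rmin_l.
    - eapply Rle_trans; [apply Rmin_r|apply Rmin_l].
    - eapply Rle_trans; [apply Rmin_r|apply Rmin_r]. }
  destruct Hh2 as [Hh2 [Hh3 Hh4]].
  specialize (H2 h Hh2). specialize (H3 h Hh3).
  set (k := (g (z + h)%C - g z)%C) in *.
  assert (Hk : Cmod k < d1).
  { eapply Rle_lt_trans; [exact H3|].
    replace d1 with ((Cmod m + 1) * d4) by (unfold d4; field; lra).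
    apply Rmult_lt_compat_l; lra. }
  specialize (H1 k Hk).
  replace (g (z + h)%C) with (g z + k)%C by (unfold k; ring).
  replace (f (g z + k)%C - f (g z) - l * m * h)%C
    with ((f (g z + k)%C - f (g z) - l * k) + l * (k - m * h))%C by ring.
  eapply Rle_trans; [apply Cmod_triangle|]. rewrite Cmod_mult.
  assert (B1 : Cmod (f (g z + k)%C - f (g z) - l * k) <= eps / 2 * Cmod h).
  { eapply Rle_trans; [exact H1|].
    apply Rle_trans with (eps / (2 * (Cmod m + 1)) * ((Cmod m + 1) * Cmod h)).
    - apply Rmult_le_compat_l; [|exact H3].
      left; apply Rdiv_lt_0_compat; lra.
    - right. field. lra. }
  assert (B2 : Cmod l * Cmod (k - m * h) <= eps / 2 * Cmod h).
  { apply Rle_trans with ((Cmod l + 1) * (eps / (2 * (Cmod l + 1)) * Cmod h)).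
    - apply Rmult_le_compat; try apply Cmod_ge_0; lra.
    - right. field. lra. }
  lra.
Qed.

Lemma cderiv_inv (z : C) : z <> 0%C -> cderiv (fun w => / w)%C z (- (/ (z * z)))%C.
Proof.
  intros Hz eps He.
  assert (Hp : 0 < Cmod z) by (apply Cmod_gt_0, Hz).
  (* The first bound keeps |z + h| at least |z|/2; the second is then what |h|^2 / (|z|^2 |z + h|)
     <= eps |h| asks for. *)
  exists (Rmin (Cmod z / 2) (eps * Cmod z ^ 3 / 2)). split.
  { apply Rmin_pos; [lra|]. apply Rdiv_lt_0_compat; [|lra].
    apply Rmult_lt_0_compat; [lra|]. apply pow_lt, Hp. }
  intros h Hh.
  assert (Hh1 : Cmod h < Cmod z / 2) by (eapply Rlt_le_trans; [exact Hh|apply Rmin_l]).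
  assert (Hh2 : Cmod h < eps * Cmod z ^ 3 / 2) by (eapply Rlt_le_trans; [exact Hh|apply Rmin_r]).
  assert (Hzh : Cmod z / 2 <= Cmod (z + h)).
  { pose proof (Cmod_triangle_inv z (- h)%C) as H. rewrite Cmod_opp in H.
    replace (z - - h)%C with (z + h)%C in H by ring. lra. }
  assert (Hzh0 : (z + h)%C <> 0%C) by (apply Cmod_gt_0; lra).
  assert (Hzz : (z * z * (z + h))%C <> 0%C) by (repeat apply Cmult_neq_0; assumption).
  replace (/ (z + h) - / z - - / (z * z) * h)%C with (h * h / (z * z * (z + h)))%C
    by (field; auto).
  rewrite Cmod_div by assumption. rewrite !Cmod_mult.
  apply Rle_trans with (Cmod h * (eps * Cmod z ^ 3 / 2) / (Cmod z * Cmod z * (Cmod z / 2))).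
  - unfold Rdiv at 1 3. pose proof (Cmod_ge_0 h). apply Rmult_le_compat.
    + nra.
    + left. apply Rinv_0_lt_compat. repeat apply Rmult_lt_0_compat; lra.
    + apply Rmult_le_compat_l; lra.
    + apply Rinv_le_contravar; [repeat apply Rmult_lt_0_compat; lra|].
      apply Rmult_le_compat_l; [nra|exact Hzh].
  - right. field. lra.
Qed.

Lemma entire_const (c : C) : entire (fun _ => c).
Proof. eapply entire_of_cderiv. intros; apply cderiv_const. Qed.

Lemma entire_id : entire (fun w => w).
Proof. eapply entire_of_cderiv. intros; apply cderiv_id. Qed.

Lemma entire_plus (f g : C -> C) : entire f -> entire g -> entire (fun w => f w + g w)%C.
Proof.
  intros Hf Hg. eapply entire_of_cderiv. intros. apply cderiv_plus; apply D_spec; assumption.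
Qed.

Lemma entire_minus (f g : C -> C) : entire f -> entire g -> entire (fun w => f w - g w)%C.
Proof.
  intros Hf Hg. eapply entire_of_cderiv. intros. apply cderiv_minus; apply D_spec; assumption.
Qed.

Lemma entire_mult (f g : C -> C) : entire f -> entire g -> entire (fun w => f w * g w)%C.
Proof.
  intros Hf Hg.
  eapply (entire_of_cderiv _ (fun z => D f z * g z + f z * D g z)%C).
  intros. apply cderiv_mult; apply D_spec; assumption.
Qed.

Lemma entire_comp (f g : C -> C) : entire f -> entire g -> entire (fun w => f (g w)).
Proof.
  intros Hf Hg.
  eapply (entire_of_cderiv _ (fun z => D f (g z) * D g z)%C).
  intros. apply cderiv_comp; apply D_spec; assumption.
Qed.

Lemma entire_inv (f : C -> C) : entire f -> (forall z, f z <> 0%C) -> entire (fun w => / f w)%C.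
Proof.
  intros Hf H0.
  eapply (entire_of_cderiv _ (fun z => - (/ (f z * f z)) * D f z)%C).
  intros z. apply (cderiv_comp Cinv f); [apply D_spec, Hf|apply cderiv_inv, H0].
Qed.

Lemma iterate_S_comm (h : C -> C) (n : nat) (z : C) : iterate h (S n) z = iterate h n (h z).
Proof. induction n; simpl in *; [reflexivity|]. now rewrite <- IHn. Qed.

Lemma entire_iterate (h : C -> C) (n : nat) : entire h -> entire (iterate h n).
Proof.
  intros Hh. induction n; simpl.
  - exact entire_id.
  - apply (entire_comp h (iterate h n)); assumption.
Qed.

(** * The exponential function *)

Definition cexp (z : C) : C := (exp (fst z) * cos (snd z), exp (fst z) * sin (snd z)).

Lemma cexp_plus (z w : C) : cexp (z + w) = (cexp z * cexp w)%C.
Proof.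
  unfold cexp, Cmult, Cplus. simpl. rewrite exp_plus, cos_plus, sin_plus.
  f_equal; ring.
Qed.

Lemma cexp_0 : cexp 0 = 1%C.
Proof. unfold cexp, RtoC. simpl. rewrite exp_0, cos_0, sin_0. f_equal; ring. Qed.

Lemma Cmod_cexp (z : C) : Cmod (cexp z) = exp (fst z).
Proof.
  unfold Cmod, cexp. simpl fst. simpl snd.
  replace ((exp (fst z) * cos (snd z)) ^ 2 + (exp (fst z) * sin (snd z)) ^ 2)
    with (exp (fst z) ^ 2 * (Rsqr (sin (snd z)) + Rsqr (cos (snd z)))) by (unfold Rsqr; ring).
  rewrite sin2_cos2, Rmult_1_r. apply sqrt_pow2. left; apply exp_pos.
Qed.

Lemma cexp_neq_0 (z : C) : cexp z <> 0%C.
Proof. apply Cmod_gt_0. rewrite Cmod_cexp. apply exp_pos. Qed.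

Lemma derivable_small (f : R -> R) (l eps : R) : derivable_pt_lim f 0 l -> 0 < eps ->
  exists d, 0 < d /\ forall a, Rabs a < d -> Rabs (f a - f 0 - l * a) <= eps * Rabs a.
Proof.
  intros H He. destruct (H eps He) as [d Hd]. exists d. split; [apply cond_pos|].
  intros a Ha. destruct (Req_dec a 0) as [->|Ha0].
  - replace (f 0 - f 0 - l * 0) with 0 by ring. rewrite Rabs_R0. lra.
  - specialize (Hd a Ha0 Ha). rewrite Rplus_0_l in Hd.
    replace (f a - f 0 - l * a) with (((f a - f 0) / a - l) * a) by (field; exact Ha0).
    rewrite Rabs_mult. apply Rmult_le_compat_r; [apply Rabs_pos|]. lra.
Qed.

(** The error splits into products of the real remainders of exp, cos and sin at 0; the functional
    equation will carry the result to every other point. *)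
Lemma cderiv_cexp_0 : cderiv cexp 0 1.
Proof.
  intros eps He.
  (* The two components will have errors at most 4 e N and 5 e N, so eps / 12 leaves room; e <= 1
     bounds exp near 0. *)
  set (e := Rmin 1 (eps / 12)).
  assert (He0 : 0 < e) by (apply Rmin_pos; lra).
  assert (He1 : e <= 1) by apply Rmin_l.
  assert (He2 : e <= eps / 12) by apply Rmin_r.
  clearbody e.
  destruct (derivable_small exp 1 e) as [d1 [Hd1 H1]]; [|exact He0|].
  { pose proof (derivable_pt_lim_exp 0) as H. rewrite exp_0 in H. exact H. }
  destruct (derivable_small cos 0 e) as [d2 [Hd2 H2]]; [|exact He0|].
  { pose proof (derivable_pt_lim_cos 0) as H. rewrite sin_0, Ropp_0 in H. exact H. }
  destruct (derivable_small sin 1 e) as [d3 [Hd3 H3]]; [|exact He0|].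
  { pose proof (derivable_pt_lim_sin 0) as H. rewrite cos_0 in H. exact H. }
  exists (Rmin (Rmin d1 d2) (Rmin d3 e)). split; [repeat apply Rmin_pos; assumption|].
  intros [a b] Hh.
  assert (Hm : Cmod (a, b) < d1 /\ Cmod (a, b) < d2 /\ Cmod (a, b) < d3 /\ Cmod (a, b) < e).
  { repeat split; eapply Rlt_le_trans; try exact Hh.
    - eapply Rle_trans; [apply Rmin_l|apply Rmin_l].
    - eapply Rle_trans; [apply Rmin_l|apply Rmin_r].
    - eapply Rle_trans; [apply Rmin_r|apply Rmin_l].
    - eapply Rle_trans; [apply Rmin_r|apply Rmin_r]. }
  destruct Hm as [Hm1 [Hm2 [Hm3 Hm4]]].
  pose proof (fst_le_Cmod (a, b)) as Ha. pose proof (snd_le_Cmod (a, b)) as Hb.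
  simpl in Ha, Hb. set (N := Cmod (a, b)) in *.
  specialize (H1 a ltac:(lra)). specialize (H2 b ltac:(lra)). specialize (H3 b ltac:(lra)).
  rewrite exp_0 in H1. rewrite cos_0 in H2. rewrite sin_0 in H3.
  pose proof (Rabs_pos a). pose proof (Rabs_pos b).
  assert (HE : Rabs (exp a - 1) <= 2 * Rabs a).
  { replace (exp a - 1) with ((exp a - 1 - 1 * a) + a) by ring.
    eapply Rle_trans; [apply Rabs_triang|]. nra. }
  assert (HE2 : Rabs (exp a) <= 3).
  { replace (exp a) with ((exp a - 1) + 1) by ring.
    eapply Rle_trans; [apply Rabs_triang|]. rewrite Rabs_R1. lra. }
  rewrite cexp_0. eapply Rle_trans; [apply Cmod_le_abs|].
  unfold cexp, Cminus, Cplus, Copp, Cmult, RtoC. simpl.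
  assert (B1 : Rabs (exp (0 + a) * cos (0 + b) + - (1) + - (1 * a - 0 * b)) <= e * N + 3 * (e * N)).
  { rewrite !Rplus_0_l.
    replace (exp a * cos b + - (1) + - (1 * a - 0 * b))
      with ((exp a - 1 - 1 * a) + exp a * (cos b - 1 - 0 * b)) by ring.
    eapply Rle_trans; [apply Rabs_triang|]. rewrite Rabs_mult.
    apply Rplus_le_compat; [nra|]. apply Rmult_le_compat; try apply Rabs_pos; nra. }
  assert (B2 : Rabs (exp (0 + a) * sin (0 + b) + - 0 + - (1 * b + 0 * a)) <= 3 * (e * N) + 2 * (e * N)).
  { rewrite !Rplus_0_l.
    replace (exp a * sin b + - 0 + - (1 * b + 0 * a))
      with (exp a * (sin b - 0 - 1 * b) + (exp a - 1) * b) by ring.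
    eapply Rle_trans; [apply Rabs_triang|]. rewrite !Rabs_mult.
    apply Rplus_le_compat; [apply Rmult_le_compat; try apply Rabs_pos; nra|].
    apply Rle_trans with (2 * e * N); [|lra].
    apply Rmult_le_compat; try apply Rabs_pos; lra. }
  assert (0 <= N) by apply Cmod_ge_0. nra.
Qed.

Lemma cderiv_cexp (z : C) : cderiv cexp z (cexp z).
Proof.
  intros eps He.
  pose proof (exp_pos (fst z)) as Hp.
  destruct (cderiv_cexp_0 (eps / exp (fst z))) as [d [Hd H]]; [apply Rdiv_lt_0_compat; lra|].
  exists d; split; [exact Hd|]. intros h Hh. specialize (H h Hh).
  rewrite Cplus_0_l, cexp_0 in H. rewrite cexp_plus.
  replace (cexp z * cexp h - cexp z - cexp z * h)%C
    with (cexp z * (cexp h - 1 - 1 * h))%C by ring.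
  rewrite Cmod_mult, Cmod_cexp.
  apply Rle_trans with (exp (fst z) * (eps / exp (fst z) * Cmod h)).
  - apply Rmult_le_compat_l; lra.
  - right. field. lra.
Qed.

Lemma entire_cexp : entire cexp.
Proof. exact (entire_of_cderiv _ _ cderiv_cexp). Qed.

Lemma cexp_opp (z : C) : (cexp z * cexp (- z) = 1)%C.
Proof. rewrite <- cexp_plus, <- cexp_0. f_equal. ring. Qed.

(** The argument is the arc cosine of x / r, with the sign of the imaginary part. Its bound by pi is
    what later lets two half circles cover a full one. *)
Lemma polar (z : C) : z <> 0%C -> exists zeta, Rabs (snd zeta) <= PI /\ cexp zeta = z.
Proof.
  intros Hz. assert (Hp : 0 < Cmod z) by (apply Cmod_gt_0, Hz).
  set (r := Cmod z) in *.
  assert (Hs : fst z ^ 2 + snd z ^ 2 = r ^ 2) by (symmetry; apply Cmod_sqr).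
  assert (Hx : -1 <= fst z / r <= 1).
  { pose proof (fst_le_Cmod z) as H. fold r in H. apply Rabs_le_between in H.
    split; [apply Rle_div_r|apply Rle_div_l]; lra. }
  assert (Hsin : sin (acos (fst z / r)) = Rabs (snd z) / r).
  { rewrite sin_acos by exact Hx.
    replace (1 - (fst z / r)²) with ((Rabs (snd z) / r) ^ 2).
    - apply sqrt_pow2. apply Rle_div_r; [lra|]. rewrite Rmult_0_l. apply Rabs_pos.
    - unfold Rsqr. unfold Rdiv. rewrite Rpow_mult_distr, pow2_abs.
      replace (snd z ^ 2) with (r ^ 2 - fst z ^ 2) by lra. field. lra. }
  pose proof (acos_bound (fst z / r)) as Hac.
  destruct (Rle_dec 0 (snd z)) as [Hy|Hy].
  - exists (ln r, acos (fst z / r)). split; [simpl; rewrite Rabs_pos_eq; lra|]. unfold cexp. simpl.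
    rewrite exp_ln, cos_acos, Hsin, Rabs_pos_eq by (assumption || lra).
    destruct z; simpl. f_equal; field; lra.
  - exists (ln r, - acos (fst z / r)). split; [simpl; rewrite Rabs_Ropp, Rabs_pos_eq; lra|]. unfold cexp. simpl.
    rewrite exp_ln, cos_neg, sin_neg, cos_acos, Hsin, Rabs_left by (assumption || lra).
    destruct z; simpl. f_equal; field; lra.
Qed.

(** * Sequential compactness *)

Lemma choice (A B : Type) (P : A -> B -> Prop) :
  (forall x, exists y, P x y) -> exists f : A -> B, forall x, P x (f x).
Proof.
  intros H. exists (fun x => proj1_sig (constructive_indefinite_description _ (H x))).
  intros x. apply proj2_sig.
Qed.

Definition incr (phi : nat -> nat) : Prop := forall k, (phi k < phi (S k))%nat.

Lemma incr_ge (phi : nat -> nat) (k : nat) : incr phi -> (k <= phi k)%nat.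
Proof. intros H. induction k; [lia|]. specialize (H k). lia. Qed.

Lemma incr_le (phi : nat -> nat) (j k : nat) : incr phi -> (j <= k)%nat -> (phi j <= phi k)%nat.
Proof. intros H Hjk. induction Hjk; [lia|]. specialize (H m). lia. Qed.

Lemma incr_lt (phi : nat -> nat) (j k : nat) : incr phi -> (j < k)%nat -> (phi j < phi k)%nat.
Proof. intros H Hjk. pose proof (incr_le phi (S j) k H Hjk). specialize (H j). lia. Qed.

Lemma incr_comp (phi psi : nat -> nat) : incr phi -> incr psi -> incr (fun k => phi (psi k)).
Proof. intros H1 H2 k. apply incr_lt; [exact H1|apply H2]. Qed.

(** Each index is selected beyond the previous one, by applying the hypothesis with a lower bound
    that exceeds it. *)
Lemma extract (P : nat -> nat -> Prop) :
  (forall m N, exists k, (N <= k)%nat /\ P m k) ->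
  exists phi, incr phi /\ forall m, P m (phi m).
Proof.
  intros H.
  assert (H' : forall x : nat * nat, exists k, (snd x <= k)%nat /\ P (fst x) k)
    by (intros [m N]; apply H).
  apply choice in H'. destruct H' as [sel Hsel].
  exists (fix phi m := match m with O => sel (O, O) | S m' => sel (S m', S (phi m')) end).
  split.
  - intros k. simpl. match goal with |- (?a < sel (?b, ?c))%nat => destruct (Hsel (b, c)) as [Hs _] end.
    simpl in Hs. lia.
  - intros [|m]; simpl;
      match goal with |- P _ (sel ?x) => destruct (Hsel x) as [_ Hs]; exact Hs end.
Qed.

Definition ccv (z : nat -> C) (l : C) : Prop :=
  forall eps, 0 < eps -> exists N, forall n, (N <= n)%nat -> Cmod (z n - l) < eps.

Lemma bolzano_weierstrass_R (u : nat -> R) (M : R) : (forall n, Rabs (u n) <= M) ->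
  exists phi l, incr phi /\ Un_cv (fun k => u (phi k)) l.
Proof.
  intros H. destruct (Bolzano_Weierstrass u (fun x => - M <= x <= M)) as [l Hl].
  { apply compact_P3. }
  { intros n. apply Rabs_le_between, H. }
  destruct (extract (fun m k => Rabs (u k - l) < / (INR m + 1))) as [phi [Hp Hphi]].
  { intros m N. assert (Hm : 0 < / (INR m + 1)).
    { apply Rinv_0_lt_compat. pose proof (pos_INR m). lra. }
    destruct (Hl (disc l (mkposreal _ Hm)) N) as [p [Hp1 Hp2]].
    - exists (mkposreal _ Hm). intros x Hx. exact Hx.
    - exists p. split; [exact Hp1|]. exact Hp2. }
  exists phi, l. split; [exact Hp|]. intros eps He.
  destruct (archimed_cor1 eps He) as [N [HN1 HN2]]. exists N. intros n Hn.
  unfold Rdist. eapply Rlt_trans; [apply Hphi|]. eapply Rle_lt_trans; [|exact HN1].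
  apply Rinv_le_contravar; [apply lt_0_INR; exact HN2|].
  apply le_INR in Hn. lra.
Qed.

Lemma bolzano_weierstrass_C (z : nat -> C) (M : R) : (forall n, Cmod (z n) <= M) ->
  exists phi l, incr phi /\ ccv (fun k => z (phi k)) l.
Proof.
  intros H.
  destruct (bolzano_weierstrass_R (fun n => fst (z n)) M) as [phi [x [Hphi Hx]]].
  { intros n. eapply Rle_trans; [apply fst_le_Cmod|apply H]. }
  destruct (bolzano_weierstrass_R (fun n => snd (z (phi n))) M) as [psi [y [Hpsi Hy]]].
  { intros n. eapply Rle_trans; [apply snd_le_Cmod|apply H]. }
  exists (fun k => phi (psi k)), (x, y). split; [apply incr_comp; assumption|].
  intros eps He.
  destruct (Hx (eps / 2)) as [N1 H1]; [lra|]. destruct (Hy (eps / 2)) as [N2 H2]; [lra|].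
  exists (N1 + N2)%nat. intros n Hn.
  eapply Rle_lt_trans; [apply Cmod_le_abs|]. simpl.
  specialize (H2 n ltac:(lia)). specialize (H1 (psi n)).
  pose proof (incr_ge psi n Hpsi). specialize (H1 ltac:(lia)).
  unfold Rdist, Rminus in *. lra.
Qed.

Lemma ccv_Cmod_le (z : nat -> C) (l c : C) (r : R) :
  ccv z l -> (forall n, Cmod (z n - c) <= r) -> Cmod (l - c) <= r.
Proof.
  intros Hl Hb. apply Rnot_lt_le. intros Hlt.
  destruct (Hl (Cmod (l - c) - r)) as [N HN]; [lra|].
  specialize (HN N (Nat.le_refl N)). specialize (Hb N).
  pose proof (Cmod_minus_triangle l (z N) c) as Ht. rewrite (Cmod_minus_sym l (z N)) in Ht. lra.
Qed.

Lemma closed_disc_seq_compact (c : C) (r : R) (w : nat -> C) :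
  (forall n, Cmod (w n - c) <= r) ->
  exists phi l, incr phi /\ ccv (fun k => w (phi k)) l /\ Cmod (l - c) <= r.
Proof.
  intros H. destruct (bolzano_weierstrass_C w (r + Cmod c)) as [phi [l [Hp Hl]]].
  { intros n. replace (w n) with ((w n - c) + c)%C by ring.
    eapply Rle_trans; [apply Cmod_triangle|]. specialize (H n). lra. }
  exists phi, l. split; [exact Hp|]. split; [exact Hl|].
  apply ccv_Cmod_le with (fun k => w (phi k)); [exact Hl|]. intros; apply H.
Qed.

(** A form of Heine-Borel for properties that hold eventually: failures at arbitrarily late indices
    would accumulate at a point of the closed disc, against the local hypothesis there. *)
Lemma closed_disc_eventually (c : C) (r : R) (P : nat -> C -> Prop) :
  (forall z, Cmod (z - c) <= r -> exists d N, 0 < d /\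
     forall k w, (N <= k)%nat -> Cmod (w - z) < d -> Cmod (w - c) <= r -> P k w) ->
  exists N, forall k w, (N <= k)%nat -> Cmod (w - c) <= r -> P k w.
Proof.
  intros H. apply NNPP. intros Hn.
  assert (Hs : forall N, exists x : nat * C,
    (N <= fst x)%nat /\ Cmod (snd x - c) <= r /\ ~ P (fst x) (snd x)).
  { intros N. apply NNPP. intros HN. apply Hn. exists N. intros k w Hk Hw.
    apply NNPP. intros HP. apply HN. exists (k, w). auto. }
  apply choice in Hs. destruct Hs as [x Hx].
  destruct (closed_disc_seq_compact c r (fun n => snd (x n))) as [phi [l [Hp [Hl Hlc]]]].
  { intros n. apply Hx. }
  destruct (H l Hlc) as [d [N [Hd HN]]]. destruct (Hl d Hd) as [N' HN'].
  destruct (Hx (phi (N + N')%nat)) as [H1 [H2 H3]]. apply H3. apply HN; [|apply HN'; lia|exact H2].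
  pose proof (incr_ge phi (N + N') Hp). lia.
Qed.

Definition usc_on (K : C -> Prop) (u : C -> R) : Prop :=
  forall z, K z -> forall eps, 0 < eps -> exists d, 0 < d /\
    forall w, K w -> Cmod (w - z) < d -> u w < u z + eps.

(** Every sequence in the disc has a subsequence whose values end up below [u l + eps] for a limit
    point [l]. Applied to a sequence of unbounded values this gives boundedness, applied to a
    maximising sequence it gives attainment. *)
Lemma usc_attains_max (c : C) (r : R) (u : C -> R) : 0 <= r ->
  usc_on (fun w => Cmod (w - c) <= r) u ->
  exists z0, Cmod (z0 - c) <= r /\ forall w, Cmod (w - c) <= r -> u w <= u z0.
Proof.
  intros Hr Hu. set (K := fun w => Cmod (w - c) <= r) in *.
  assert (Kc : K c).
  { unfold K. replace (c - c)%C with (RtoC 0) by ring. rewrite Cmod_0. exact Hr. }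
  assert (Hlim : forall (w : nat -> C), (forall n, K (w n)) -> exists phi l, incr phi /\ K l /\
     forall eps, 0 < eps -> exists N, forall n, (N <= n)%nat -> u (w (phi n)) < u l + eps).
  { intros w Hw. destruct (closed_disc_seq_compact c r w Hw) as [phi [l [Hp [Hl Hlc]]]].
    exists phi, l. split; [exact Hp|]. split; [exact Hlc|]. intros eps He.
    destruct (Hu l Hlc eps He) as [d [Hd Hw2]]. destruct (Hl d Hd) as [N HN].
    exists N. intros n Hn. apply Hw2; [apply Hw|]. apply HN, Hn. }
  set (E := fun y => exists w, K w /\ y = u w).
  assert (Hb : bound E).
  { apply NNPP. intros Hnb.
    assert (Hs : forall n : nat, exists w, K w /\ INR n < u w).
    { intros n. apply NNPP. intros Hn. apply Hnb. exists (INR n). intros y [w [Hw ->]].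
      apply Rnot_lt_le. intros Hlt. apply Hn. exists w. auto. }
    apply choice in Hs. destruct Hs as [w Hw].
    destruct (Hlim w) as [phi [l [Hp [Kl Hl]]]]; [intros; apply Hw|].
    destruct (Hl 1 Rlt_0_1) as [N HN]. destruct (INR_unbounded (u l + 1)) as [n Hn].
    specialize (HN (N + n)%nat ltac:(lia)). destruct (Hw (phi (N + n)%nat)) as [_ H2].
    pose proof (incr_ge phi (N + n) Hp) as H3.
    assert (H4 : INR n <= INR (phi (N + n)%nat)) by (apply le_INR; lia). lra. }
  destruct (completeness E Hb) as [m [Hm1 Hm2]]; [exists (u c), c; auto|].
  assert (Hs : forall n : nat, exists w, K w /\ m - / (INR n + 1) < u w).
  { intros n. apply NNPP. intros Hn.
    assert (Hpos : 0 < / (INR n + 1)) by (apply Rinv_0_lt_compat; pose proof (pos_INR n); lra).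
    assert (m <= m - / (INR n + 1)); [|lra]. apply Hm2. intros y [w [Hw ->]].
    apply Rnot_lt_le. intros Hlt. apply Hn. exists w. auto. }
  apply choice in Hs. destruct Hs as [w Hw].
  destruct (Hlim w) as [phi [l [Hp [Kl Hl]]]]; [intros; apply Hw|].
  exists l. split; [exact Kl|]. intros v Hv.
  apply Rle_trans with m; [apply Hm1; exists v; auto|].
  apply Rnot_lt_le. intros Hlt.
  destruct (Hl ((m - u l) / 2)) as [N HN]; [lra|].
  destruct (archimed_cor1 ((m - u l) / 2)) as [n [Hn1 Hn2]]; [lra|].
  specialize (HN (N + n)%nat ltac:(lia)). destruct (Hw (phi (N + n)%nat)) as [_ H2].
  pose proof (incr_ge phi (N + n) Hp) as H3.
  assert (H4 : INR n <= INR (phi (N + n)%nat)) by (apply le_INR; lia).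
  assert (H5 : / (INR (phi (N + n)%nat) + 1) <= / INR n).
  { apply Rinv_le_contravar; [apply lt_0_INR; exact Hn2|lra]. }
  lra.
Qed.

Lemma entire_bounded_on_disc (f : C -> C) (c : C) (r : R) : entire f ->
  exists M, 0 < M /\ forall w, Cmod (w - c) <= r -> Cmod (f w) <= M.
Proof.
  intros Hf.
  (* The index serves as the bound: |f| <= [INR k + 1] holds eventually near each point, and
     uniformity in [k] is boundedness. *)
  destruct (closed_disc_eventually c r (fun k w => Cmod (f w) <= INR k + 1)) as [N HN].
  { intros z Hz. destruct (entire_ccont f z Hf 1 Rlt_0_1) as [d [Hd H]].
    destruct (INR_unbounded (Cmod (f z))) as [N HN]. exists d, N. split; [exact Hd|].
    intros k w Hk Hw _. specialize (H w Hw). pose proof (Cmod_triangle_inv (f w) (f z)).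
    apply le_INR in Hk. lra. }
  exists (INR N + 1). split; [pose proof (pos_INR N); lra|]. intros w Hw. apply HN; [lia|exact Hw].
Qed.

(** Without a finite net, points could be chosen greedily at mutual distance at least [d], which no
    convergent subsequence allows. *)
Lemma disc_net (c : C) (r d : R) : 0 < d ->
  exists l : list C, (forall p, In p l -> Cmod (p - c) < r) /\
    forall w, Cmod (w - c) < r -> exists p, In p l /\ Cmod (w - p) < d.
Proof.
  intros Hd. apply NNPP. intros Hn.
  assert (Hs : forall l : list C, exists w, (forall p, In p l -> Cmod (p - c) < r) ->
     Cmod (w - c) < r /\ forall p, In p l -> d <= Cmod (w - p)).
  { intros l. apply NNPP. intros Hl. apply Hn. exists l.
    assert (Hlb : forall p, In p l -> Cmod (p - c) < r).
    { apply NNPP. intros Hb. apply Hl. exists c. intros; contradiction. }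
    split; [exact Hlb|]. intros w Hw. apply NNPP. intros Hp. apply Hl. exists w. intros _.
    split; [exact Hw|]. intros p Hin. apply Rnot_lt_le. intros Hlt. apply Hp. exists p; auto. }
  apply choice in Hs. destruct Hs as [next Hnext].
  set (L := fix L n := match n with O => nil | S n' => next (L n') :: L n' end).
  assert (HL : forall n p, In p (L n) -> Cmod (p - c) < r).
  { induction n; simpl; [contradiction|]. intros p [<-|Hp]; [|apply IHn, Hp].
    apply Hnext, IHn. }
  assert (Hin : forall i n, (i < n)%nat -> In (next (L i)) (L n)).
  { intros i n Hi. induction Hi; simpl; [left; reflexivity|right; assumption]. }
  destruct (closed_disc_seq_compact c r (fun n => next (L n))) as [phi [l [Hp [Hl _]]]].
  { intros n. left. apply (Hnext (L n)), HL. }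
  destruct (Hl (d / 2)) as [N HN]; [lra|].
  pose proof (HN N (Nat.le_refl N)) as H1. pose proof (HN (S N) ltac:(lia)) as H2.
  pose proof (proj2 (Hnext (L (phi (S N))) (HL _)) (next (L (phi N)))
    (Hin _ _ (Hp N))) as H3.
  pose proof (Cmod_minus_triangle (next (L (phi (S N)))) l (next (L (phi N)))) as H4.
  rewrite (Cmod_minus_sym l) in H4. lra.
Qed.

(** The second hypothesis says that [P m] ignores finitely many terms and survives thinning: from
    [m] on, each term of [phi] occurs in [psi] at the same or a later index. The diagonal has this
    relation to every stage. *)
Lemma diagonal_subsequence (P : nat -> (nat -> nat) -> Prop) :
  (forall m psi, incr psi -> exists theta, incr theta /\ P m (fun k => psi (theta k))) ->
  (forall m psi phi, P m psi ->
     (forall k, (m <= k)%nat -> exists j, (k <= j)%nat /\ phi k = psi j) -> P m phi) ->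
  exists phi, incr phi /\ forall m, P m phi.
Proof.
  intros H1 H2.
  assert (Hs : forall x : nat * (nat -> nat), exists theta,
    incr (snd x) -> incr theta /\ P (fst x) (fun k => snd x (theta k))).
  { intros [m psi]. simpl. destruct (classic (incr psi)) as [Hi|Hi].
    - destruct (H1 m psi Hi) as [theta Ht]. exists theta. auto.
    - exists (fun k => k). intros; contradiction. }
  apply choice in Hs. destruct Hs as [th Hth].
  set (psi := fix psi m := match m with
    | O => fun k => th (O, fun k => k) k
    | S m' => fun k => psi m' (th (S m', psi m') k) end).
  assert (Hid : incr (fun k => k)) by (intros k; lia).
  assert (Hinc : forall m, incr (psi m)).
  { induction m; simpl.
    - apply (Hth (O, fun k => k)), Hid.
    - apply (incr_comp (psi m)); [exact IHm|]. apply (Hth (S m, psi m)), IHm. }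
  assert (HP : forall m, P m (psi m)).
  { intros [|m]; simpl.
    - apply (Hth (O, fun k => k)), Hid.
    - apply (Hth (S m, psi m)), Hinc. }
  assert (Hsub : forall m n k, (m <= n)%nat -> exists j, (k <= j)%nat /\ psi n k = psi m j).
  { intros m n k Hmn. revert k. induction Hmn; intros k; [exists k; auto|].
    destruct (IHHmn (th (S m0, psi m0) k)) as [j [Hj1 Hj2]]. exists j. split; [|exact Hj2].
    pose proof (incr_ge _ k (proj1 (Hth (S m0, psi m0) (Hinc m0)))). lia. }
  exists (fun k => psi k k). split.
  - intros k. destruct (Hsub k (S k) (S k) ltac:(lia)) as [j [Hj1 Hj2]]. rewrite Hj2.
    apply incr_lt; [apply Hinc|lia].
  - intros m. apply H2 with (psi m); [apply HP|]. intros k Hk. apply Hsub, Hk.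
Qed.

(** * Uniformly Cauchy sequences and the Arzela-Ascoli theorem *)

Definition unif_cauchy_on (U : C -> Prop) (F : nat -> C -> C) : Prop :=
  forall eps, 0 < eps -> exists N, forall j k, (N <= j)%nat -> (N <= k)%nat ->
    forall w, U w -> Cmod (F j w - F k w) < eps.

Lemma unif_cauchy_limit (U : C -> Prop) (F : nat -> C -> C) :
  unif_cauchy_on U F -> exists G, unif_conv_on U F G.
Proof.
  intros H.
  assert (Hl : forall w, exists l, U w -> ccv (fun k => F k w) l).
  { intros w. destruct (classic (U w)) as [Hw|Hw]; [|exists C0; intros; contradiction].
    destruct (Rcomplete.R_complete (fun k => fst (F k w))) as [x Hx].
    { intros eps He. destruct (H eps He) as [N HN]. exists N. intros n m Hn Hm.
      unfold Rdist. pose proof (fst_le_Cmod (F n w - F m w)%C) as Hf. simpl in Hf.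
      eapply Rle_lt_trans; [exact Hf|]. apply HN; assumption. }
    destruct (Rcomplete.R_complete (fun k => snd (F k w))) as [y Hy].
    { intros eps He. destruct (H eps He) as [N HN]. exists N. intros n m Hn Hm.
      unfold Rdist. pose proof (snd_le_Cmod (F n w - F m w)%C) as Hf. simpl in Hf.
      eapply Rle_lt_trans; [exact Hf|]. apply HN; assumption. }
    exists (x, y). intros _ eps He.
    destruct (Hx (eps / 2)) as [N1 H1]; [lra|]. destruct (Hy (eps / 2)) as [N2 H2]; [lra|].
    exists (N1 + N2)%nat. intros n Hn. eapply Rle_lt_trans; [apply Cmod_le_abs|]. simpl.
    specialize (H1 n ltac:(lia)). specialize (H2 n ltac:(lia)). unfold Rdist, Rminus in *. lra. }
  apply choice in Hl. destruct Hl as [G HG]. exists G. intros eps He.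
  destruct (H (eps / 2)) as [N HN]; [lra|]. exists N. intros k Hk w Hw. rewrite Cnorm_Cmod.
  destruct (HG w Hw (eps / 2)) as [N' HN']; [lra|].
  specialize (HN' (N + N')%nat ltac:(lia)). specialize (HN k (N + N')%nat Hk ltac:(lia) w Hw).
  pose proof (Cmod_minus_triangle (F k w) (F (N + N')%nat w) (G w)).
  change (Cmod (F k w - G w) < eps). lra.
Qed.

Lemma unif_conv_cauchy (U : C -> Prop) (F : nat -> C -> C) (G : C -> C) :
  unif_conv_on U F G -> unif_cauchy_on U F.
Proof.
  intros H eps He. destruct (H (eps / 2)) as [N HN]; [lra|]. exists N. intros j k Hj Hk w Hw.
  pose proof (HN j Hj w Hw) as H1. pose proof (HN k Hk w Hw) as H2. rewrite Cnorm_Cmod in H1, H2.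
  change (Cmod (F j w - G w) < eps / 2) in H1. change (Cmod (F k w - G w) < eps / 2) in H2.
  pose proof (Cmod_minus_triangle (F j w) (G w) (F k w)) as H3.
  rewrite (Cmod_minus_sym (G w)) in H3. lra.
Qed.

Lemma pointwise_subsequence (F : nat -> C -> C) (M : R) (l : list C) :
  (forall k p, In p l -> Cmod (F k p) <= M) -> forall psi, incr psi ->
  exists theta, incr theta /\ forall eps, 0 < eps -> exists N, forall j k, (N <= j)%nat -> (N <= k)%nat ->
    forall p, In p l -> Cmod (F (psi (theta j)) p - F (psi (theta k)) p) < eps.
Proof.
  induction l as [|p l IH]; intros Hb psi Hpsi.
  - exists (fun k => k). split; [intros k; lia|]. intros eps He. exists O. intros j k _ _ p [].
  - destruct (IH (fun k p Hp => Hb k p (or_intror Hp)) psi Hpsi) as [theta [Ht H]].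
    destruct (bolzano_weierstrass_C (fun k => F (psi (theta k)) p) M) as [eta [a [He Ha]]].
    { intros n. apply Hb. left; reflexivity. }
    exists (fun k => theta (eta k)). split; [apply incr_comp; assumption|]. intros eps Heps.
    destruct (H eps Heps) as [N1 HN1]. destruct (Ha (eps / 2)) as [N2 HN2]; [lra|].
    exists (N1 + N2)%nat. intros j k Hj Hk q [<-|Hq].
    + pose proof (HN2 j ltac:(lia)) as H1. pose proof (HN2 k ltac:(lia)) as H2. simpl in H1, H2.
      pose proof (Cmod_minus_triangle (F (psi (theta (eta j))) p) a (F (psi (theta (eta k))) p)) as H3.
      rewrite (Cmod_minus_sym a) in H3. lra.
    + pose proof (incr_ge eta j He). pose proof (incr_ge eta k He).
      apply HN1; [lia|lia|exact Hq].
Qed.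

(** The diagonal argument runs over the accuracies 1/(m+1) instead of a dense set: at each accuracy
    a finite net together with the Lipschitz constant reduces the disc to finitely many points. *)
Lemma arzela_ascoli (F : nat -> C -> C) (c : C) (r M L : R) : 0 <= L ->
  (forall k w, Cmod (w - c) < r -> Cmod (F k w) <= M) ->
  (forall k v w, Cmod (v - c) < r -> Cmod (w - c) < r -> Cmod (F k v - F k w) <= L * Cmod (v - w)) ->
  exists phi, incr phi /\ unif_cauchy_on (ball c r) (fun k => F (phi k)).
Proof.
  intros HL HM HF.
  destruct (diagonal_subsequence (fun m psi => exists N, forall j k, (N <= j)%nat -> (N <= k)%nat ->
    forall w, Cmod (w - c) < r -> Cmod (F (psi j) w - F (psi k) w) < / (INR m + 1)))
    as [phi [Hp H]].
  - intros m psi Hpsi. set (eps := / (INR m + 1)).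
    assert (He : 0 < eps) by (apply Rinv_0_lt_compat; pose proof (pos_INR m); lra).
    assert (Hd : 0 < eps / (3 * (L + 1))) by (apply Rdiv_lt_0_compat; lra).
    destruct (disc_net c r _ Hd) as [l [Hl1 Hl2]].
    destruct (pointwise_subsequence F M l) with (psi := psi) as [theta [Ht H]];
      [intros k p Hp; apply HM, Hl1, Hp|exact Hpsi|].
    exists theta. split; [exact Ht|]. destruct (H (eps / 3)) as [N HN]; [lra|].
    exists N. intros j k Hj Hk w Hw. destruct (Hl2 w Hw) as [p [Hp Hwp]].
    specialize (HN j k Hj Hk p Hp).
    pose proof (HF (psi (theta j)) w p Hw (Hl1 p Hp)) as B1.
    pose proof (HF (psi (theta k)) p w (Hl1 p Hp) Hw) as B2.
    rewrite (Cmod_minus_sym p w) in B2.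
    assert (B3 : L * Cmod (w - p) <= eps / 3 ).
    { apply Rle_trans with ((L + 1) * (eps / (3 * (L + 1)))).
      - apply Rmult_le_compat; try lra. apply Cmod_ge_0.
      - right. field. lra. }
    pose proof (Cmod_minus_triangle (F (psi (theta j)) w) (F (psi (theta j)) p) (F (psi (theta k)) w)).
    pose proof (Cmod_minus_triangle (F (psi (theta j)) p) (F (psi (theta k)) p) (F (psi (theta k)) w)).
    lra.
  - intros m psi phi [N HN] Hphi. exists (N + m)%nat. intros j k Hj Hk w Hw.
    destruct (Hphi j ltac:(lia)) as [j' [Hj1 ->]]. destruct (Hphi k ltac:(lia)) as [k' [Hk1 ->]].
    apply HN; [lia|lia|exact Hw].
  - exists phi. split; [exact Hp|]. intros eps He.
    destruct (archimed_cor1 eps He) as [m [Hm1 Hm2]]. destruct (H m) as [N HN].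
    exists N. intros j k Hj Hk w Hw. apply ball_iff in Hw.
    eapply Rlt_trans; [apply HN; assumption|]. eapply Rle_lt_trans; [|exact Hm1].
    apply Rinv_le_contravar; [apply lt_0_INR; exact Hm2|lra].
Qed.

(** * Goursat's theorem and the Cauchy formula for the derivative *)

Definition rcont (f : R -> C) : Prop :=
  forall t eps, 0 < eps -> exists d, 0 < d /\
    forall s, Rabs (s - t) < d -> Cmod (f s - f t) < eps.

Lemma rcont_fst (f : R -> C) (t : R) : rcont f -> continuous (fun s => fst (f s)) t.
Proof.
  intros H. apply continuity_pt_filterlim. intros eps He.
  destruct (H t eps He) as [d [Hd Hs]]. exists d. split; [exact Hd|]. intros s [_ Hst].
  simpl. unfold Rdist. pose proof (fst_le_Cmod (f s - f t)%C) as Hf. simpl in Hf.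
  eapply Rle_lt_trans; [exact Hf|]. apply Hs, Hst.
Qed.

Lemma rcont_snd (f : R -> C) (t : R) : rcont f -> continuous (fun s => snd (f s)) t.
Proof.
  intros H. apply continuity_pt_filterlim. intros eps He.
  destruct (H t eps He) as [d [Hd Hs]]. exists d. split; [exact Hd|]. intros s [_ Hst].
  simpl. unfold Rdist. pose proof (snd_le_Cmod (f s - f t)%C) as Hf. simpl in Hf.
  eapply Rle_lt_trans; [exact Hf|]. apply Hs, Hst.
Qed.

Lemma rcont_comp (k : C -> C) (p : R -> C) : (forall z, ccont k z) -> rcont p -> rcont (fun t => k (p t)).
Proof.
  intros Hk Hp t eps He. destruct (Hk (p t) eps He) as [d [Hd H]].
  destruct (Hp t d Hd) as [e [He' H']]. exists e. split; [exact He'|]. intros s Hs.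
  apply H, H', Hs.
Qed.

Lemma rcont_line (p v : C) : rcont (fun t => p + RtoC t * v)%C.
Proof.
  intros t eps He. pose proof (Cmod_ge_0 v). exists (eps / (Cmod v + 1)).
  split; [apply Rdiv_lt_0_compat; lra|]. intros s Hs.
  replace (p + RtoC s * v - (p + RtoC t * v))%C with (RtoC (s - t) * v)%C
    by (rewrite RtoC_minus; ring).
  rewrite Cmod_mult, Cmod_R.
  apply Rmult_lt_compat_r with (r := Cmod v + 1) in Hs; [|lra].
  replace (eps / (Cmod v + 1) * (Cmod v + 1)) with eps in Hs by (field; lra).
  pose proof (Rabs_pos (s - t)). nra.
Qed.

Definition hline (y t : R) : C := (t, y).
Definition vline (x t : R) : C := (x, t).

Lemma rcont_hline (y : R) : rcont (hline y).
Proof.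
  replace (hline y) with (fun t => (0, y) + RtoC t * RtoC 1)%C; [apply rcont_line|].
  apply functional_extensionality; intros t. unfold hline, Cplus, Cmult, RtoC; simpl.
  f_equal; ring.
Qed.

Lemma rcont_vline (x : R) : rcont (vline x).
Proof.
  replace (vline x) with (fun t => (x, 0) + RtoC t * Ci)%C; [apply rcont_line|].
  apply functional_extensionality; intros t. unfold vline, Cplus, Cmult, RtoC, Ci; simpl.
  f_equal; ring.
Qed.

Definition CI (f : R -> C) (a b : R) : C :=
  (RInt (fun t => fst (f t)) a b, RInt (fun t => snd (f t)) a b).

Lemma ex_RInt_fst (f : R -> C) (a b : R) : rcont f -> ex_RInt (fun t => fst (f t)) a b.
Proof. intros H. apply (ex_RInt_continuous (V := R_CompleteNormedModule)). intros; apply rcont_fst, H. Qed.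

Lemma ex_RInt_snd (f : R -> C) (a b : R) : rcont f -> ex_RInt (fun t => snd (f t)) a b.
Proof. intros H. apply (ex_RInt_continuous (V := R_CompleteNormedModule)). intros; apply rcont_snd, H. Qed.

Lemma CI_plus (f g : R -> C) (a b : R) : rcont f -> rcont g ->
  CI (fun t => f t + g t)%C a b = (CI f a b + CI g a b)%C.
Proof.
  intros Hf Hg. unfold CI, Cplus. simpl. f_equal.
  - apply (RInt_plus (V := R_CompleteNormedModule)); apply ex_RInt_fst; assumption.
  - apply (RInt_plus (V := R_CompleteNormedModule)); apply ex_RInt_snd; assumption.
Qed.

Lemma CI_scal (c : C) (f : R -> C) (a b : R) : rcont f ->
  CI (fun t => c * f t)%C a b = (c * CI f a b)%C.
Proof.
  intros Hf. unfold CI, Cmult. simpl.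
  pose proof (ex_RInt_fst f a b Hf) as H1. pose proof (ex_RInt_snd f a b Hf) as H2.
  assert (S1 : forall l, ex_RInt (fun t => l * fst (f t)) a b)
    by (intros l; apply (ex_RInt_scal (V := R_CompleteNormedModule)); assumption).
  assert (S2 : forall l, ex_RInt (fun t => l * snd (f t)) a b)
    by (intros l; apply (ex_RInt_scal (V := R_CompleteNormedModule)); assumption).
  f_equal.
  - transitivity (RInt (fun t => fst c * fst (f t)) a b - RInt (fun t => snd c * snd (f t)) a b).
    + apply (RInt_minus (V := R_CompleteNormedModule)); auto.
    + f_equal; apply (RInt_scal (V := R_CompleteNormedModule)); assumption.
  - transitivity (RInt (fun t => fst c * snd (f t)) a b + RInt (fun t => snd c * fst (f t)) a b).
    + apply (RInt_plus (V := R_CompleteNormedModule)); auto.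
    + f_equal; apply (RInt_scal (V := R_CompleteNormedModule)); assumption.
Qed.

Lemma rcont_plus (f g : R -> C) : rcont f -> rcont g -> rcont (fun t => f t + g t)%C.
Proof.
  intros Hf Hg t eps He. destruct (Hf t (eps / 2)) as [d1 [Hd1 H1]]; [lra|].
  destruct (Hg t (eps / 2)) as [d2 [Hd2 H2]]; [lra|].
  exists (Rmin d1 d2). split; [apply Rmin_pos; assumption|]. intros s Hs.
  specialize (H1 s (Rlt_le_trans _ _ _ Hs (Rmin_l _ _))).
  specialize (H2 s (Rlt_le_trans _ _ _ Hs (Rmin_r _ _))).
  replace (f s + g s - (f t + g t))%C with ((f s - f t) + (g s - g t))%C by ring.
  eapply Rle_lt_trans; [apply Cmod_triangle|]. lra.
Qed.

Lemma rcont_scal (c : C) (f : R -> C) : rcont f -> rcont (fun t => c * f t)%C.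
Proof.
  intros Hf t eps He. pose proof (Cmod_ge_0 c).
  destruct (Hf t (eps / (Cmod c + 1))) as [d [Hd H1]]; [apply Rdiv_lt_0_compat; lra|].
  exists d. split; [exact Hd|]. intros s Hs. specialize (H1 s Hs).
  replace (c * f s - c * f t)%C with (c * (f s - f t))%C by ring. rewrite Cmod_mult.
  apply Rmult_lt_compat_l with (r := Cmod c + 1) in H1; [|lra].
  replace ((Cmod c + 1) * (eps / (Cmod c + 1))) with eps in H1 by (field; lra).
  pose proof (Cmod_ge_0 (f s - f t)). nra.
Qed.

Lemma CI_minus (f g : R -> C) (a b : R) : rcont f -> rcont g ->
  CI (fun t => f t - g t)%C a b = (CI f a b - CI g a b)%C.
Proof.
  intros Hf Hg.
  replace (fun t => f t - g t)%C with (fun t => f t + (- (1)) * g t)%C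
    by (apply functional_extensionality; intros; ring).
  rewrite CI_plus, CI_scal; [ring|exact Hg|exact Hf|apply rcont_scal, Hg].
Qed.

Lemma CI_Chasles (f : R -> C) (a b c : R) : rcont f -> (CI f a c = CI f a b + CI f b c)%C.
Proof.
  intros Hf. unfold CI, Cplus. simpl. symmetry. f_equal.
  - apply (RInt_Chasles (V := R_CompleteNormedModule)); apply ex_RInt_fst; assumption.
  - apply (RInt_Chasles (V := R_CompleteNormedModule)); apply ex_RInt_snd; assumption.
Qed.

(** The components are bounded separately, hence the factor 2; it reappears in Cauchy's estimates
    below. *)
Lemma CI_bound (f : R -> C) (a b M : R) : a <= b -> rcont f ->
  (forall t, a <= t <= b -> Cmod (f t) <= M) -> Cmod (CI f a b) <= 2 * (b - a) * M.
Proof.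
  intros Hab Hf HM. eapply Rle_trans; [apply Cmod_le_abs|]. simpl.
  assert (H1 : Rabs (RInt (fun t => fst (f t)) a b) <= (b - a) * M).
  { apply abs_RInt_le_const; [exact Hab|apply ex_RInt_fst, Hf|].
    intros t Ht. eapply Rle_trans; [apply fst_le_Cmod|apply HM, Ht]. }
  assert (H2 : Rabs (RInt (fun t => snd (f t)) a b) <= (b - a) * M).
  { apply abs_RInt_le_const; [exact Hab|apply ex_RInt_snd, Hf|].
    intros t Ht. eapply Rle_trans; [apply snd_le_Cmod|apply HM, Ht]. }
  lra.
Qed.

Lemma RInt_affine (u v a b : R) : RInt (fun t => u + t * v) a b = (b - a) * u + (b * b - a * a) / 2 * v.
Proof.
  apply is_RInt_unique.
  replace ((b - a) * u + (b * b - a * a) / 2 * v)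
    with (minus (b * u + b * b / 2 * v) (a * u + a * a / 2 * v))
    by (unfold minus, plus, opp; simpl; field).
  apply (is_RInt_derive (V := R_CompleteNormedModule) (fun t => t * u + t * t / 2 * v)).
  - intros x _. auto_derive; [exact I|field].
  - intros x _. apply (ex_derive_continuous (fun t => u + t * v)). auto_derive. exact I.
Qed.

Lemma CI_affine (u v : C) (a b : R) :
  CI (fun t => u + RtoC t * v)%C a b = (RtoC (b - a) * u + RtoC ((b * b - a * a) / 2) * v)%C.
Proof.
  unfold CI, Cplus, Cmult, RtoC. simpl. f_equal.
  - replace (fun t => fst u + (t * fst v - 0 * snd v)) with (fun t => fst u + t * fst v)
      by (apply functional_extensionality; intros; ring).
    rewrite RInt_affine. match goal with |- ?a = ?b => change (@eq R a b) end. ring.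
  - replace (fun t => snd u + (t * snd v + 0 * fst v)) with (fun t => snd u + t * snd v)
      by (apply functional_extensionality; intros; ring).
    rewrite RInt_affine. match goal with |- ?a = ?b => change (@eq R a b) end. ring.
Qed.

(** The counterclockwise integral of k dz over the boundary of [x, x+w] x [y, y+h], with dz = i dt
    on the vertical sides. *)
Definition rect_int (k : C -> C) (x y w h : R) : C :=
  (CI (fun t => k (hline y t)) x (x + w) - CI (fun t => k (hline (y + h) t)) x (x + w)
   + Ci * (CI (fun t => k (vline (x + w) t)) y (y + h) - CI (fun t => k (vline x t)) y (y + h)))%C.

Lemma rcont_h (k : C -> C) (y : R) : (forall z, ccont k z) -> rcont (fun t => k (hline y t)).
Proof. intros H. apply (rcont_comp k (hline y)); [exact H|apply rcont_hline]. Qed.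

Lemma rcont_v (k : C -> C) (x : R) : (forall z, ccont k z) -> rcont (fun t => k (vline x t)).
Proof. intros H. apply (rcont_comp k (vline x)); [exact H|apply rcont_vline]. Qed.

Lemma rect_int_split (k : C -> C) (x y w h : R) : (forall z, ccont k z) ->
  rect_int k x y (w + w) (h + h) =
    (rect_int k x y w h + rect_int k (x + w) y w h
     + (rect_int k x (y + h) w h + rect_int k (x + w) (y + h) w h))%C.
Proof.
  intros Hk. unfold rect_int. rewrite <- !Rplus_assoc.
  rewrite (CI_Chasles (fun t => k (hline y t)) x (x + w) (x + w + w)) by (apply rcont_h, Hk).
  rewrite (CI_Chasles (fun t => k (hline (y + h + h) t)) x (x + w) (x + w + w)) by (apply rcont_h, Hk).
  rewrite (CI_Chasles (fun t => k (vline x t)) y (y + h) (y + h + h)) by (apply rcont_v, Hk).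
  rewrite (CI_Chasles (fun t => k (vline (x + w + w) t)) y (y + h) (y + h + h)) by (apply rcont_v, Hk).
  ring.
Qed.

Lemma rect_int_plus (k l : C -> C) (x y w h : R) : (forall z, ccont k z) -> (forall z, ccont l z) ->
  rect_int (fun z => k z + l z)%C x y w h = (rect_int k x y w h + rect_int l x y w h)%C.
Proof.
  intros Hk Hl. unfold rect_int.
  rewrite (CI_plus (fun t => k (hline y t)) (fun t => l (hline y t))) by (apply rcont_h; assumption).
  rewrite (CI_plus (fun t => k (hline (y + h) t)) (fun t => l (hline (y + h) t))) by (apply rcont_h; assumption).
  rewrite (CI_plus (fun t => k (vline x t)) (fun t => l (vline x t))) by (apply rcont_v; assumption).
  rewrite (CI_plus (fun t => k (vline (x + w) t)) (fun t => l (vline (x + w) t))) by (apply rcont_v; assumption).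
  ring.
Qed.

Lemma rect_int_affine (u v : C) (x y w h : R) : rect_int (fun z => u + v * z)%C x y w h = 0%C.
Proof.
  assert (Hh : forall s a b, CI (fun t => u + v * hline s t)%C a b
     = CI (fun t => (u + v * (0, s)) + RtoC t * v)%C a b).
  { intros s a b. f_equal. apply functional_extensionality. intros t.
    unfold hline, Cplus, Cmult, RtoC; simpl; f_equal; ring. }
  assert (Hv : forall s a b, CI (fun t => u + v * vline s t)%C a b
     = CI (fun t => (u + v * RtoC s) + RtoC t * (Ci * v))%C a b).
  { intros s a b. f_equal. apply functional_extensionality. intros t.
    unfold vline, Cplus, Cmult, Ci, RtoC; simpl; f_equal; ring. }
  unfold rect_int. rewrite !Hh, !Hv, !CI_affine.
  unfold Cminus, Copp, Cplus, Cmult, Ci, RtoC; simpl; f_equal; field.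
Qed.

Lemma rect_int_bound (k : C -> C) (x y w h M : R) : 0 <= w -> 0 <= h -> (forall z, ccont k z) ->
  (forall z : C, x <= fst z <= x + w -> y <= snd z <= y + h -> Cmod (k z) <= M) ->
  Cmod (rect_int k x y w h) <= 4 * (w + h) * M.
Proof.
  intros Hw Hh Hk HM. unfold rect_int.
  assert (B1 : forall s, y <= s <= y + h -> Cmod (CI (fun t => k (hline s t)) x (x + w)) <= 2 * w * M).
  { intros s Hs. replace (2 * w * M) with (2 * (x + w - x) * M) by ring.
    apply CI_bound; [lra|apply rcont_h, Hk|]. intros t Ht. apply HM; simpl; lra. }
  assert (B2 : forall s, x <= s <= x + w -> Cmod (CI (fun t => k (vline s t)) y (y + h)) <= 2 * h * M).
  { intros s Hs. replace (2 * h * M) with (2 * (y + h - y) * M) by ring.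
    apply CI_bound; [lra|apply rcont_v, Hk|]. intros t Ht. apply HM; simpl; lra. }
  eapply Rle_trans; [apply Cmod_triangle|]. rewrite Cmod_mult, Cmod_Ci.
  pose proof (B1 y ltac:(lra)). pose proof (B1 (y + h) ltac:(lra)).
  pose proof (B2 x ltac:(lra)). pose proof (B2 (x + w) ltac:(lra)).
  pose proof (Cmod_triangle_minus (CI (fun t => k (hline y t)) x (x + w)) (CI (fun t => k (hline (y + h) t)) x (x + w))).
  pose proof (Cmod_triangle_minus (CI (fun t => k (vline (x + w) t)) y (y + h)) (CI (fun t => k (vline x t)) y (y + h))).
  lra.
Qed.

Lemma nested_intervals (x : nat -> R) (w : R) : 0 <= w ->
  (forall n, x n <= x (S n) <= x n + w * (/ 2) ^ S n) ->
  exists X, forall n, x n <= X <= x n + w * (/ 2) ^ n.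
Proof.
  intros Hw Hx.
  assert (Hq : forall n, 0 < (/ 2) ^ n) by (intros; apply pow_lt; lra).
  assert (Hup : forall n j, x n <= x (n + j)%nat /\ x (n + j)%nat + w * (/ 2) ^ (n + j) <= x n + w * (/ 2) ^ n).
  { intros n j. induction j.
    - rewrite Nat.add_0_r. lra.
    - rewrite Nat.add_succ_r. specialize (Hx (n + j)%nat). simpl pow in *.
      assert (0 <= w * (/ 2) ^ (n + j)) by (apply Rmult_le_pos; [lra|left; apply Hq]). lra. }
  assert (Hub : forall n m, x m <= x n + w * (/ 2) ^ n).
  { intros n m. assert (P : 0 <= w * (/ 2) ^ n) by (apply Rmult_le_pos; [lra|left; apply Hq]).
    assert (P' : 0 <= w * (/ 2) ^ m) by (apply Rmult_le_pos; [lra|left; apply Hq]).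
    destruct (Nat.le_ge_cases n m) as [L|L].
    - replace m with (n + (m - n))%nat in * by lia. destruct (Hup n (m - n)%nat). lra.
    - replace n with (m + (n - m))%nat in * by lia. destruct (Hup m (n - m)%nat). lra. }
  destruct (completeness (fun y => exists n, y = x n)) as [X [H1 H2]].
  - exists (x O + w * (/ 2) ^ 0). intros y [n ->]. apply Hub.
  - exists (x O), O. reflexivity.
  - exists X. intros n. split; [apply H1; exists n; reflexivity|].
    apply H2. intros y [m ->]. apply Hub.
Qed.

(** Some quarter of a rectangle carries at least a quarter of its integral. After n subdivisions,
    subtracting the affine approximation at the limit point, whose own integral vanishes, leaves at
    most eps times a multiple of 4^-n, and this cancels the factor 4^n. *)
Theorem goursat (k : C -> C) (x y w h : R) : entire k -> 0 <= w -> 0 <= h ->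
  rect_int k x y w h = 0%C.
Proof.
  intros Hk Hw Hh.
  assert (Hc : forall z, ccont k z) by (intros; apply entire_ccont, Hk).
  set (q := fun n : nat => (/ 2) ^ n).
  assert (Hq : forall n, 0 < q n) by (intros; apply pow_lt; lra).
  set (I := fun n (p : C) => rect_int k (fst p) (snd p) (w * q n) (h * q n)).
  assert (Hstep : forall a : nat * C, exists p' : C,
    (fst (snd a) <= fst p' <= fst (snd a) + w * q (S (fst a))) /\
    (snd (snd a) <= snd p' <= snd (snd a) + h * q (S (fst a))) /\
    Cmod (I (fst a) (snd a)) <= 4 * Cmod (I (S (fst a)) p')).
  { intros [n p]. simpl fst; simpl snd. unfold I at 1.
    assert (Ew : w * q n = w * q (S n) + w * q (S n)) by (unfold q; simpl; lra).
    assert (Eh : h * q n = h * q (S n) + h * q (S n)) by (unfold q; simpl; lra).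
    rewrite Ew, Eh, rect_int_split by exact Hc.
    assert (Pw : 0 <= w * q (S n)) by (apply Rmult_le_pos; [lra|left; apply Hq]).
    assert (Ph : 0 <= h * q (S n)) by (apply Rmult_le_pos; [lra|left; apply Hq]).
    set (W := w * q (S n)) in *. set (H := h * q (S n)) in *.
    set (A := rect_int k (fst p) (snd p) W H).
    set (B := rect_int k (fst p + W) (snd p) W H).
    set (A' := rect_int k (fst p) (snd p + H) W H).
    set (B' := rect_int k (fst p + W) (snd p + H) W H).
    assert (T : Cmod (A + B + (A' + B')) <= Cmod A + Cmod B + (Cmod A' + Cmod B')).
    { eapply Rle_trans; [apply Cmod_triangle|]. apply Rplus_le_compat; apply Cmod_triangle. }
    destruct (Rle_dec (Cmod (A + B + (A' + B'))) (4 * Cmod A)) as [L|L].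
    { exists (fst p, snd p). simpl. repeat split; try lra. exact L. }
    destruct (Rle_dec (Cmod (A + B + (A' + B'))) (4 * Cmod B)) as [L1|L1].
    { exists (fst p + W, snd p). simpl. repeat split; try lra. exact L1. }
    destruct (Rle_dec (Cmod (A + B + (A' + B'))) (4 * Cmod A')) as [L2|L2].
    { exists (fst p, snd p + H). simpl. repeat split; try lra. exact L2. }
    exists (fst p + W, snd p + H). simpl. repeat split; try lra.
    change (Cmod (A + B + (A' + B')) <= 4 * Cmod B'). lra. }
  apply choice in Hstep. destruct Hstep as [next Hnext].
  set (p := fix p n := match n with O => (x, y) : C | S n' => next (n', p n') end).
  assert (Hp : forall n, (fst (p n) <= fst (p (S n)) <= fst (p n) + w * q (S n)) /\
    (snd (p n) <= snd (p (S n)) <= snd (p n) + h * q (S n)) /\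
    Cmod (I n (p n)) <= 4 * Cmod (I (S n) (p (S n)))).
  { intros n. exact (Hnext (n, p n)). }
  destruct (nested_intervals (fun n => fst (p n)) w Hw) as [X HX]; [intros n; apply Hp|].
  destruct (nested_intervals (fun n => snd (p n)) h Hh) as [Y HY]; [intros n; apply Hp|].
  assert (HI : forall n, Cmod (I O (p O)) <= 4 ^ n * Cmod (I n (p n))).
  { induction n; [simpl; lra|]. destruct (Hp n) as [_ [_ H3]]. simpl pow.
    assert (0 < 4 ^ n) by (apply pow_lt; lra). nra. }
  set (P := (X, Y) : C). set (l := D k P).
  assert (Hsmall : forall eps, 0 < eps -> Cmod (I O (p O)) <= 4 * (w + h) * (w + h) * eps).
  { intros eps He. destruct (D_spec k P Hk eps He) as [d [Hd Hder]]. fold l in Hder.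
    assert (Hn : exists n, (w + h) * q n < d).
    { destruct (pow_lt_1_zero (/ 2)) with (y := d / (w + h + 1)) as [n Hn].
      - rewrite Rabs_pos_eq; lra.
      - apply Rdiv_lt_0_compat; lra.
      - exists n. specialize (Hn n (Nat.le_refl n)). fold (q n) in Hn.
        rewrite Rabs_pos_eq in Hn by (left; apply Hq).
        apply Rmult_lt_compat_l with (r := w + h + 1) in Hn; [|lra].
        replace ((w + h + 1) * (d / (w + h + 1))) with d in Hn by (field; lra).
        specialize (Hq n). nra. }
    destruct Hn as [n Hn].
    set (E := fun z => (k z - ((k P - l * P) + l * z))%C).
    assert (Haff : entire (fun z => (k P - l * P) + l * z)%C).
    { apply entire_plus; [apply entire_const|].
      apply entire_mult; [apply entire_const|apply entire_id]. }
    assert (HEc : forall z, ccont E z) by (intros z; apply entire_ccont, entire_minus; assumption).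
    assert (Hk2 : I n (p n) = rect_int E (fst (p n)) (snd (p n)) (w * q n) (h * q n)).
    { unfold I.
      replace k with (fun z => ((k P - l * P) + l * z) + E z)%C at 1
        by (apply functional_extensionality; intros z; unfold E; ring).
      rewrite rect_int_plus; [|intros; apply entire_ccont, Haff|exact HEc].
      rewrite rect_int_affine. ring. }
    assert (Hb : Cmod (I n (p n)) <= 4 * (w * q n + h * q n) * (eps * ((w + h) * q n))).
    { rewrite Hk2. pose proof (Hq n) as Hqn.
      apply rect_int_bound; [nra|nra|exact HEc|]. intros z Hz1 Hz2.
      assert (Hz : Cmod (z - P) <= (w + h) * q n).
      { eapply Rle_trans; [apply Cmod_le_abs|]. unfold P; simpl.
        specialize (HX n). specialize (HY n). simpl in HX, HY. fold (q n) in HX, HY.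
        assert (Rabs (fst z + - X) <= w * q n) by (apply Rabs_le; lra).
        assert (Rabs (snd z + - Y) <= h * q n) by (apply Rabs_le; lra). lra. }
      specialize (Hder (z - P)%C ltac:(lra)).
      replace (P + (z - P))%C with z in Hder by ring.
      replace (E z) with (k z - k P - l * (z - P))%C by (unfold E; ring).
      eapply Rle_trans; [exact Hder|]. apply Rmult_le_compat_l; lra. }
    specialize (HI n). assert (H4 : 4 ^ n * (q n * q n) = 1).
    { unfold q. rewrite <- !Rpow_mult_distr. replace (4 * (/ 2 * / 2)) with 1 by field. apply pow1. }
    assert (0 < 4 ^ n) by (apply pow_lt; lra).
    eapply Rle_trans; [exact HI|].
    apply Rle_trans with (4 ^ n * (4 * (w * q n + h * q n) * (eps * ((w + h) * q n)))).
    - apply Rmult_le_compat_l; lra.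
    - right. replace (4 ^ n * (4 * (w * q n + h * q n) * (eps * ((w + h) * q n))))
        with ((4 ^ n * (q n * q n)) * (4 * (w + h) * (w + h) * eps)) by ring.
      rewrite H4. ring. }
  apply Cmod_eq_0.
  replace (rect_int k x y w h) with (I O (p O)) by (unfold I, q; simpl; rewrite !Rmult_1_r; reflexivity).
  apply Rle_antisym; [|apply Cmod_ge_0]. apply Rnot_lt_le. intros Hlt.
  set (K := 4 * (w + h) * (w + h)) in *.
  assert (HK : 0 <= K) by (unfold K; nra).
  (* With this eps the bound K eps stays below half of the supposed positive value. *)
  specialize (Hsmall (Cmod (I O (p O)) / (2 * (K + 1)))).
  assert (0 < Cmod (I O (p O)) / (2 * (K + 1))) by (apply Rdiv_lt_0_compat; lra).
  specialize (Hsmall H).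
  assert (E : (K + 1) * (Cmod (I O (p O)) / (2 * (K + 1))) = Cmod (I O (p O)) / 2) by (field; lra).
  nra.
Qed.

(** Substituting u = [cexp zeta] turns (f(z+u) - f(z)) u^-2 du into this kernel times d zeta.
    Subtracting [f z] makes it tend to f'(z) as the real part of [zeta] goes to minus infinity. *)
Definition cauchy_kernel (f : C -> C) (z zeta : C) : C := ((f (z + cexp zeta)%C - f z) * cexp (- zeta))%C.

Lemma entire_cauchy_kernel (f : C -> C) (z : C) : entire f -> entire (cauchy_kernel f z).
Proof.
  intros Hf. unfold cauchy_kernel. apply entire_mult.
  - apply entire_minus; [|apply entire_const].
    apply (entire_comp f (fun w => z + cexp w)%C); [exact Hf|].
    apply entire_plus; [apply entire_const|apply entire_cexp].
  - apply (entire_comp cexp (fun w => - w)%C); [apply entire_cexp|].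
    replace (fun w : C => (- w)%C) with (fun w : C => (0 - w)%C)
      by (apply functional_extensionality; intros; ring).
    apply entire_minus; [apply entire_const|apply entire_id].
Qed.

(* In the logarithmic coordinate the circle integrals become integrals over vertical segments; the
   horizontal sides of the rectangle cancel because [cexp] is periodic. *)
Lemma cauchy_formula_D (f : C -> C) (z : C) (s : R) : entire f ->
  CI (fun t => cauchy_kernel f z (vline s t)) 0 (2 * PI) = (RtoC (2 * PI) * D f z)%C.
Proof.
  intros Hf. pose proof (entire_cauchy_kernel f z Hf) as Hk.
  set (k := cauchy_kernel f z) in *. set (l := D f z).
  assert (Hc : forall z, ccont k z) by (intros; apply entire_ccont, Hk).
  pose proof PI_RGT_0 as Hpi.
  assert (Hper : forall t, k (hline (0 + 2 * PI) t) = k (hline 0 t)).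
  { intros t. unfold k, cauchy_kernel, cexp, hline. simpl.
    rewrite !cos_neg, !sin_neg, Rplus_0_l, cos_2PI, sin_2PI, cos_0, sin_0. reflexivity. }
  assert (Hind : forall s0, s0 <= s ->
     CI (fun t => k (vline s t)) 0 (2 * PI) = CI (fun t => k (vline s0 t)) 0 (2 * PI)).
  { intros s0 Hs. pose proof (goursat k s0 0 (s - s0) (2 * PI) Hk ltac:(lra) ltac:(lra)) as H.
    unfold rect_int in H. rewrite Rplus_0_l in H.
    replace (fun t => k (hline (2 * PI) t)) with (fun t => k (hline 0 t)) in H
      by (apply functional_extensionality; intros t; rewrite <- (Hper t), Rplus_0_l; reflexivity).
    replace (s0 + (s - s0)) with s in H by ring.
    set (A := CI (fun t => k (hline 0 t)) s0 s) in H.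
    set (B := CI (fun t => k (vline s t)) 0 (2 * PI)) in *.
    set (B0 := CI (fun t => k (vline s0 t)) 0 (2 * PI)) in *.
    assert (H' : (Ci * (B - B0) = 0)%C) by (rewrite <- H; ring).
    apply (f_equal Cmod) in H'. rewrite Cmod_mult, Cmod_Ci, Cmod_0, Rmult_1_l in H'.
    apply Cmod_eq_0 in H'. replace B with (B - B0 + B0)%C by ring. rewrite H'. ring. }
  (* Far to the left the kernel is uniformly close to [l], and by [Hind] the integral may be
     computed there. *)
  assert (Hsm : forall eps, 0 < eps ->
    Cmod (CI (fun t => k (vline s t)) 0 (2 * PI) - RtoC (2 * PI) * l) <= 4 * PI * eps).
  { intros eps He. destruct (D_spec f z Hf eps He) as [d [Hd Hder]]. fold l in Hder.
    set (s0 := Rmin s (ln (d / 2))). rewrite (Hind s0) by apply Rmin_l.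
    assert (Hlc : CI (fun _ => l) 0 (2 * PI) = (RtoC (2 * PI) * l)%C).
    { replace (fun _ : R => l) with (fun t : R => l + RtoC t * 0)%C
        by (apply functional_extensionality; intros; ring).
      rewrite CI_affine, Rminus_0_r. ring. }
    assert (Hlr : rcont (fun _ => l)).
    { intros t e He'. exists 1. split; [lra|]. intros _ _.
      replace (l - l)%C with (RtoC 0) by ring. rewrite Cmod_0. exact He'. }
    rewrite <- Hlc, <- CI_minus; [|apply rcont_v, Hc|exact Hlr].
    replace (4 * PI * eps) with (2 * (2 * PI - 0) * eps) by ring.
    apply CI_bound; [lra| |].
    - replace (fun t => k (vline s0 t) - l)%C with (fun t => k (vline s0 t) + (- (1)) * l)%C
        by (apply functional_extensionality; intros; ring).
      apply rcont_plus; [apply rcont_v, Hc|]. apply rcont_scal, Hlr.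
    - intros t _. set (zeta := vline s0 t).
      assert (E : (k zeta - l)%C = ((f (z + cexp zeta)%C - f z - l * cexp zeta) * cexp (- zeta))%C).
      { unfold k, cauchy_kernel. transitivity ((f (z + cexp zeta)%C - f z) * cexp (- zeta) - l * 1)%C; [ring|].
        rewrite <- (cexp_opp zeta). ring. }
      rewrite E, Cmod_mult.
      assert (Hm : Cmod (cexp zeta) < d).
      { rewrite Cmod_cexp. simpl. apply Rle_lt_trans with (d / 2); [|lra].
        rewrite <- (exp_ln (d / 2)) by lra. destruct (Rmin_r s (ln (d / 2))) as [L|L].
        - left. apply exp_increasing. exact L.
        - right. f_equal. exact L. }
      specialize (Hder (cexp zeta) Hm).
      apply Rle_trans with (eps * Cmod (cexp zeta) * Cmod (cexp (- zeta))).
      + apply Rmult_le_compat_r; [apply Cmod_ge_0|exact Hder].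
      + rewrite Rmult_assoc, <- Cmod_mult, cexp_opp, Cmod_1. lra. }
  set (A := CI (fun t => k (vline s t)) 0 (2 * PI)) in *.
  assert (HA : Cmod (A - RtoC (2 * PI) * l) = 0).
  { apply Rle_antisym; [|apply Cmod_ge_0]. apply Rnot_lt_le. intros Hlt.
    set (m := Cmod (A - RtoC (2 * PI) * l)) in *.
    specialize (Hsm (m / (8 * PI)) ltac:(apply Rdiv_lt_0_compat; lra)).
    replace (4 * PI * (m / (8 * PI))) with (m / 2) in Hsm by (field; lra). lra. }
  apply Cmod_eq_0 in HA. replace A with (A - RtoC (2 * PI) * l + RtoC (2 * PI) * l)%C by ring.
  rewrite HA. ring.
Qed.

(** At abscissa [ln r] the segment traverses the circle |u| = r, where the factor [cexp (- zeta)]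
    contributes 1/r. *)
Lemma cauchy_estimate_diff (f : C -> C) (z : C) (r M : R) : entire f -> 0 < r ->
  (forall u, Cmod u = r -> Cmod (f (z + u)%C - f z) <= M) -> Cmod (D f z) <= 2 * M / r.
Proof.
  intros Hf Hr HM. pose proof PI_RGT_0 as Hpi.
  pose proof (cauchy_formula_D f z (ln r) Hf) as E.
  assert (B : Cmod (CI (fun t => cauchy_kernel f z (vline (ln r) t)) 0 (2 * PI))
    <= 2 * (2 * PI - 0) * (M / r)).
  { apply CI_bound; [lra| |].
    - apply rcont_v. intros; apply entire_ccont, entire_cauchy_kernel, Hf.
    - intros t _. unfold cauchy_kernel. rewrite Cmod_mult, (Cmod_cexp (- _)).
      simpl. rewrite exp_Ropp, exp_ln by exact Hr. unfold Rdiv. apply Rmult_le_compat_r.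
      + left. apply Rinv_0_lt_compat, Hr.
      + apply HM. rewrite Cmod_cexp. simpl. apply exp_ln, Hr. }
  rewrite E, Cmod_mult, Cmod_R, Rabs_pos_eq in B by lra.
  apply Rmult_le_reg_l with (2 * PI); [lra|]. eapply Rle_trans; [exact B|]. right. field. lra.
Qed.

Lemma cauchy_estimate (f : C -> C) (z : C) (r M : R) : entire f -> 0 < r ->
  (forall w, Cmod (w - z) <= r -> Cmod (f w) <= M) -> Cmod (D f z) <= 4 * M / r.
Proof.
  intros Hf Hr HM. replace (4 * M / r) with (2 * (M + M) / r) by (field; lra).
  apply cauchy_estimate_diff; [exact Hf|exact Hr|]. intros u Hu.
  eapply Rle_trans; [apply Cmod_triangle_minus|]. apply Rplus_le_compat; apply HM.
  - replace (z + u - z)%C with u by ring. lra.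
  - replace (z - z)%C with (RtoC 0) by ring. rewrite Cmod_0. lra.
Qed.

(** * Mean value bounds and differentiability of the derivative *)

Lemma line_derive_fst (f : C -> C) (z v l : C) (t : R) : cderiv f (z + RtoC t * v)%C l ->
  is_derive (fun s : R => fst (f (z + RtoC s * v)%C)) t (fst (l * v)%C).
Proof.
  intros H. apply is_derive_Reals. intros eps He.
  pose proof (Cmod_ge_0 v) as Hv.
  destruct (H (eps / (2 * (Cmod v + 1)))) as [d [Hd Hh]]; [apply Rdiv_lt_0_compat; lra|].
  assert (Hd' : 0 < d / (Cmod v + 1)) by (apply Rdiv_lt_0_compat; lra).
  exists (mkposreal _ Hd'). intros s Hs0 Hs. simpl in Hs.
  assert (Hsp : 0 < Rabs s) by (apply Rabs_pos_lt, Hs0).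
  assert (Hm : Cmod (RtoC s * v) <= Rabs s * (Cmod v + 1)).
  { rewrite Cmod_mult, Cmod_R. nra. }
  assert (Hm2 : Rabs s * (Cmod v + 1) < d).
  { apply Rmult_lt_compat_r with (r := Cmod v + 1) in Hs; [|lra].
    replace (d / (Cmod v + 1) * (Cmod v + 1)) with d in Hs by (field; lra). exact Hs. }
  specialize (Hh (RtoC s * v)%C ltac:(lra)).
  replace (z + RtoC t * v + RtoC s * v)%C with (z + RtoC (t + s) * v)%C in Hh
    by (rewrite RtoC_plus; ring).
  pose proof (fst_le_Cmod (f (z + RtoC (t + s) * v) - f (z + RtoC t * v) - l * (RtoC s * v))%C) as Hf.
  set (A := f (z + RtoC (t + s) * v)%C) in *. set (B := f (z + RtoC t * v)%C) in *.
  replace (fst (A - B - l * (RtoC s * v))%C) with (((fst A - fst B) / s - fst (l * v)%C) * s) in Hf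
    by (unfold Cminus, Cplus, Copp, Cmult, RtoC; simpl; field; exact Hs0).
  rewrite Rabs_mult in Hf.
  apply Rmult_lt_reg_r with (Rabs s); [exact Hsp|].
  eapply Rle_lt_trans; [exact Hf|]. eapply Rle_lt_trans; [exact Hh|].
  apply Rle_lt_trans with (eps / (2 * (Cmod v + 1)) * (Rabs s * (Cmod v + 1))).
  - apply Rmult_le_compat_l; [|exact Hm]. left. apply Rdiv_lt_0_compat; lra.
  - replace (eps / (2 * (Cmod v + 1)) * (Rabs s * (Cmod v + 1))) with (eps / 2 * Rabs s) by (field; lra).
    apply Rmult_lt_compat_r; lra.
Qed.

(** The imaginary part of f is the real part of -i f. *)
Lemma line_derive_snd (f : C -> C) (z v l : C) (t : R) : cderiv f (z + RtoC t * v)%C l ->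
  is_derive (fun s : R => snd (f (z + RtoC s * v)%C)) t (snd (l * v)%C).
Proof.
  intros H.
  assert (H' : cderiv (fun w => - Ci * f w)%C (z + RtoC t * v)%C (- Ci * l)%C) by (apply cderiv_scal, H).
  apply line_derive_fst in H'.
  replace (snd (l * v)%C) with (fst (- Ci * l * v)%C)
    by (unfold Copp, Cmult, Ci; simpl; ring).
  refine (is_derive_ext _ _ _ _ _ H'). intros s. unfold Copp, Cmult, Ci; simpl; ring.
Qed.

(** The real mean value theorem is applied to the two components, in general at two different points
    of the segment; adding them costs the factor 2. *)
Lemma mean_value_bound (f : C -> C) (z v : C) (M : R) : entire f ->
  (forall t, 0 <= t <= 1 -> Cmod (D f (z + RtoC t * v)%C) <= M) ->
  Cmod (f (z + v)%C - f z) <= 2 * M * Cmod v.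
Proof.
  intros Hf HM.
  assert (Hd : forall t, cderiv f (z + RtoC t * v)%C (D f (z + RtoC t * v)%C)) by (intros; apply D_spec, Hf).
  assert (H0 : (z + RtoC 0 * v = z)%C) by ring.
  assert (H1 : (z + RtoC 1 * v = z + v)%C) by ring.
  assert (Hb : forall t, 0 <= t <= 1 -> Cmod (D f (z + RtoC t * v) * v)%C <= M * Cmod v).
  { intros t Ht. rewrite Cmod_mult. apply Rmult_le_compat_r; [apply Cmod_ge_0|apply HM, Ht]. }
  destruct (MVT_gen (fun s => fst (f (z + RtoC s * v)%C)) 0 1 (fun t => fst (D f (z + RtoC t * v) * v)%C))
    as [a [Ha Ea]].
  { intros t _. apply line_derive_fst, Hd. }
  { intros t _. apply continuity_pt_filterlim, (ex_derive_continuous (fun s => fst (f (z + RtoC s * v)%C))).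
    eexists. apply line_derive_fst, Hd. }
  destruct (MVT_gen (fun s => snd (f (z + RtoC s * v)%C)) 0 1 (fun t => snd (D f (z + RtoC t * v) * v)%C))
    as [b [Hb' Eb]].
  { intros t _. apply line_derive_snd, Hd. }
  { intros t _. apply continuity_pt_filterlim, (ex_derive_continuous (fun s => snd (f (z + RtoC s * v)%C))).
    eexists. apply line_derive_snd, Hd. }
  rewrite H0, H1 in Ea, Eb. rewrite Rmin_left, Rmax_right in Ha, Hb' by lra.
  eapply Rle_trans; [apply Cmod_le_abs|].
  change (Rabs (fst (f (z + v)%C) - fst (f z)) + Rabs (snd (f (z + v)%C) - snd (f z)) <= 2 * M * Cmod v).
  rewrite Ea, Eb, Rminus_0_r, !Rmult_1_r.
  pose proof (Hb a Ha). pose proof (Hb b Hb').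
  pose proof (fst_le_Cmod (D f (z + RtoC a * v) * v)%C).
  pose proof (snd_le_Cmod (D f (z + RtoC b * v) * v)%C). lra.
Qed.

Lemma entire_shift (f : C -> C) (h : C) : entire f -> entire (fun w => f (w + h)%C).
Proof.
  intros Hf. apply (entire_comp f (fun w => w + h)%C); [exact Hf|].
  apply entire_plus; [apply entire_id|apply entire_const].
Qed.

Lemma cderiv_shift (f : C -> C) (z h l : C) : cderiv f (z + h)%C l -> cderiv (fun w => f (w + h)%C) z l.
Proof.
  intros H. replace l with (l * (1 + 0))%C by ring.
  apply (cderiv_comp f (fun w => w + h)%C); [|exact H].
  apply cderiv_plus; [apply cderiv_id|apply cderiv_const].
Qed.

(** The increment f(v+h) - f(v) is itself entire in v and of size O(|h|); Cauchy's estimate for it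
    bounds its derivative, which is the increment of [D f]. *)
Lemma D_locally_lipschitz (f : C -> C) (z0 : C) : entire f -> exists K, 0 < K /\
  forall w h, Cmod (w - z0) <= 1 -> Cmod h <= 1 -> Cmod (D f (w + h)%C - D f w) <= K * Cmod h.
Proof.
  (* The radii 4, 3, 2, 1 leave a margin of 1 for each of the successive estimates. *)
  intros Hf. destruct (entire_bounded_on_disc f z0 4 Hf) as [M [HM Hb]].
  assert (H1 : forall w, Cmod (w - z0) <= 3 -> Cmod (D f w) <= 4 * M).
  { intros w Hw. replace (4 * M) with (4 * M / 1) by field.
    apply cauchy_estimate; [exact Hf|lra|]. intros v Hv. apply Hb.
    pose proof (Cmod_minus_triangle v w z0). lra. }
  assert (H2 : forall w h, Cmod (w - z0) <= 2 -> Cmod h <= 1 -> Cmod (f (w + h)%C - f w) <= 8 * M * Cmod h).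
  { intros w h Hw Hh. replace (8 * M) with (2 * (4 * M)) by ring.
    apply mean_value_bound; [exact Hf|]. intros t Ht. apply H1.
    replace (w + RtoC t * h - z0)%C with ((w - z0) + RtoC t * h)%C by ring.
    eapply Rle_trans; [apply Cmod_triangle|]. rewrite Cmod_mult, Cmod_R, Rabs_pos_eq by lra.
    pose proof (Cmod_ge_0 h). nra. }
  exists (32 * M). split; [lra|]. intros w h Hw Hh.
  set (F := fun v => (f (v + h)%C - f v)%C).
  assert (HF : entire F) by (apply entire_minus; [apply entire_shift, Hf|exact Hf]).
  assert (HD : D F w = (D f (w + h)%C - D f w)%C).
  { apply D_eq. apply cderiv_minus; [|apply D_spec, Hf]. apply cderiv_shift, D_spec, Hf. }
  rewrite <- HD. replace (32 * M * Cmod h) with (2 * (8 * M * Cmod h + 8 * M * Cmod h) / 1) by field.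
  apply cauchy_estimate_diff; [exact HF|lra|]. intros u Hu.
  eapply Rle_trans; [apply Cmod_triangle_minus|]. apply Rplus_le_compat; apply H2; try assumption.
  - replace (w + u - z0)%C with ((w - z0) + u)%C by ring.
    eapply Rle_trans; [apply Cmod_triangle|]. lra.
  - lra.
Qed.

Lemma D_ccont (f : C -> C) (z : C) : entire f -> ccont (D f) z.
Proof.
  intros Hf eps He. destruct (D_locally_lipschitz f z Hf) as [K [HK H]].
  exists (Rmin 1 (eps / K)). split; [apply Rmin_pos; [lra|apply Rdiv_lt_0_compat; lra]|].
  intros w Hw. replace w with (z + (w - z))%C by ring.
  eapply Rle_lt_trans; [apply H|].
  - replace (z - z)%C with (RtoC 0) by ring. rewrite Cmod_0. lra.
  - left. eapply Rlt_le_trans; [exact Hw|apply Rmin_l].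
  - assert (Hw2 : Cmod (w - z) < eps / K) by (eapply Rlt_le_trans; [exact Hw|apply Rmin_r]).
    apply Rmult_lt_compat_l with (r := K) in Hw2; [|lra].
    replace (K * (eps / K)) with eps in Hw2 by (field; lra). exact Hw2.
Qed.

(** Cauchy's formula on the unit circle is differentiated in z under the integral sign. The
    Lipschitz bound on [D f] already gives a quadratic remainder for f, uniformly near z, so the
    error of the integrand is O(|h|^2). *)
Theorem entire_D (f : C -> C) : entire f -> entire (D f).
Proof.
  intros Hf z. apply differentiable_cderiv. pose proof PI_RGT_0 as Hpi.
  destruct (D_locally_lipschitz f z Hf) as [K [HK HL]].
  (* The mean value bound is applied to f minus its linear part at [w]; the remainder is uniform in
     [w], which ranges over the whole circle of integration. *)
  assert (H2 : forall w h, Cmod (w - z) <= 1 -> Cmod h <= 1 ->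
    Cmod (f (w + h)%C - f w - h * D f w) <= 2 * (K * Cmod h) * Cmod h).
  { intros w h Hw Hh. set (G := fun v => (f (v + w)%C - D f w * v)%C).
    assert (HG : entire G).
    { apply entire_minus; [apply entire_shift, Hf|]. apply entire_mult; [apply entire_const|apply entire_id]. }
    assert (HGD : forall v, D G v = (D f (v + w)%C - D f w)%C).
    { intros v. apply D_eq. apply cderiv_minus; [apply cderiv_shift, D_spec, Hf|].
      pose proof (cderiv_scal (D f w) _ v _ (cderiv_id v)) as E. rewrite Cmult_1_r in E. exact E. }
    pose proof (mean_value_bound G 0 h (K * Cmod h) HG) as HB.
    replace (f (w + h)%C - f w - h * D f w)%C with (G (0 + h)%C - G 0%C)%C.
    - apply HB. intros t Ht. rewrite HGD.
      replace (0 + RtoC t * h + w)%C with (w + RtoC t * h)%C by ring.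
      assert (Hth : Cmod (RtoC t * h) <= Cmod h).
      { rewrite Cmod_mult, Cmod_R, Rabs_pos_eq by lra. pose proof (Cmod_ge_0 h). nra. }
      eapply Rle_trans; [apply HL; lra|]. apply Rmult_le_compat_l; lra.
    - unfold G. rewrite !Cplus_0_l, (Cplus_comm h w). ring. }
  set (kD := fun zeta : C => ((D f (z + cexp zeta)%C - D f z) * cexp (- zeta))%C).
  assert (Hec : forall zeta : C, fst zeta = 0 -> Cmod (cexp zeta) = 1 /\ Cmod (cexp (- zeta)) = 1).
  { intros zeta E. rewrite !Cmod_cexp. simpl. rewrite E, Ropp_0, exp_0. auto. }
  assert (HkD : rcont (fun t => kD (vline 0 t))).
  (* Continuity cannot be quoted from [entire_cauchy_kernel], since at this stage [D f] is only
     known to be continuous. *)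
  { apply rcont_v. intros zeta. unfold kD.
    assert (Hc1 : ccont (fun w => D f (z + cexp w)%C - D f z)%C zeta).
    { intros eps He. destruct (D_ccont f (z + cexp zeta)%C Hf eps He) as [d [Hd H]].
      destruct (entire_ccont cexp zeta entire_cexp d Hd) as [d' [Hd' H']].
      exists d'. split; [exact Hd'|]. intros w Hw.
      replace (D f (z + cexp w) - D f z - (D f (z + cexp zeta) - D f z))%C
        with (D f (z + cexp w) - D f (z + cexp zeta))%C by ring.
      apply H. replace (z + cexp w - (z + cexp zeta))%C with (cexp w - cexp zeta)%C by ring.
      apply H', Hw. }
    assert (Hc2 : ccont (fun w => cexp (- w)) zeta).
    { intros eps He. destruct (entire_ccont cexp (- zeta)%C entire_cexp eps He) as [d [Hd H]].
      exists d. split; [exact Hd|]. intros w Hw. apply H.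
      replace (- w - - zeta)%C with (- (w - zeta))%C by ring. rewrite Cmod_opp. exact Hw. }
    intros eps He.
    set (a := Cmod (D f (z + cexp zeta)%C - D f z)). set (b := Cmod (cexp (- zeta))).
    assert (Ha : 0 <= a) by apply Cmod_ge_0. assert (Hb : 0 <= b) by apply Cmod_ge_0.
    destruct (Hc1 (eps / (2 * (b + 1)))) as [d1 [Hd1 H1]]; [apply Rdiv_lt_0_compat; lra|].
    destruct (Hc2 (Rmin 1 (eps / (2 * (a + 1))))) as [d2 [Hd2 H2']];
      [apply Rmin_pos; [lra|apply Rdiv_lt_0_compat; lra]|].
    exists (Rmin d1 d2). split; [apply Rmin_pos; assumption|]. intros w Hw.
    specialize (H1 w (Rlt_le_trans _ _ _ Hw (Rmin_l _ _))).
    specialize (H2' w (Rlt_le_trans _ _ _ Hw (Rmin_r _ _))).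
    set (P := (D f (z + cexp w)%C - D f z)%C) in *. set (P0 := (D f (z + cexp zeta)%C - D f z)%C) in *.
    set (Q := cexp (- w)) in *. set (Q0 := cexp (- zeta)) in *.
    replace (P * Q - P0 * Q0)%C with ((P - P0) * Q + P0 * (Q - Q0))%C by ring.
    eapply Rle_lt_trans; [apply Cmod_triangle|]. rewrite !Cmod_mult. fold a.
    assert (HQ : Cmod Q < b + 1).
    { pose proof (Cmod_triangle_inv Q Q0). fold b in H. pose proof (Rmin_l 1 (eps / (2 * (a + 1)))). lra. }
    assert (HQ2 : Cmod (Q - Q0) < eps / (2 * (a + 1))).
    { eapply Rlt_le_trans; [exact H2'|apply Rmin_r]. }
    apply Rlt_le_trans with (eps / (2 * (b + 1)) * (b + 1) + (a + 1) * (eps / (2 * (a + 1)))).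
    - apply Rplus_lt_compat.
      + apply Rmult_le_0_lt_compat; try apply Cmod_ge_0; assumption.
      + pose proof (Cmod_ge_0 (Q - Q0)). assert (0 < eps / (2 * (a + 1))) by lra. nra.
    - right. field. lra. }
  exists (/ RtoC (2 * PI) * CI (fun t => kD (vline 0 t)) 0 (2 * PI))%C.
  (* The integrand will be at most 4 K |h|^2, and [CI_bound] adds a factor 2 to the length 2 pi;
     after division by 2 pi, 8 K |h| <= eps remains. *)
  intros eps He. exists (Rmin 1 (eps / (8 * K))).
  split; [apply Rmin_pos; [lra|apply Rdiv_lt_0_compat; lra]|]. intros h Hh.
  assert (Hh1 : Cmod h < 1) by (eapply Rlt_le_trans; [exact Hh|apply Rmin_l]).
  assert (Hh2 : Cmod h < eps / (8 * K)) by (eapply Rlt_le_trans; [exact Hh|apply Rmin_r]).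
  assert (H2pi : RtoC (2 * PI) <> 0%C).
  { apply Cmod_gt_0. rewrite Cmod_R, Rabs_pos_eq; lra. }
  set (k1 := fun t => cauchy_kernel f (z + h)%C (vline 0 t)).
  set (k0 := fun t => cauchy_kernel f z (vline 0 t)).
  set (k2 := fun t => kD (vline 0 t)) in *.
  assert (Hk1 : rcont k1) by (apply rcont_v; intros; apply entire_ccont, entire_cauchy_kernel, Hf).
  assert (Hk0 : rcont k0) by (apply rcont_v; intros; apply entire_ccont, entire_cauchy_kernel, Hf).
  assert (R1 : rcont (fun t => k1 t + (- (1)) * k0 t)%C).
  { apply rcont_plus; [exact Hk1|]. apply rcont_scal, Hk0. }
  assert (R2 : rcont (fun t => - h * k2 t)%C) by (apply rcont_scal, HkD).
  assert (E : (RtoC (2 * PI) * (D f (z + h)%C - D f z - / RtoC (2 * PI) * CI k2 0 (2 * PI) * h))%C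
     = CI (fun t => (k1 t + (- (1)) * k0 t) + (- h) * k2 t)%C 0 (2 * PI)).
  { rewrite (CI_plus (fun t => k1 t + (- (1)) * k0 t)%C); [|exact R1|exact R2].
    rewrite CI_plus; [|exact Hk1|apply rcont_scal, Hk0]. rewrite !CI_scal by assumption.
    unfold k1, k0. rewrite !cauchy_formula_D by exact Hf. field. exact H2pi. }
  apply Rmult_le_reg_l with (2 * PI); [lra|].
  replace (2 * PI * Cmod (D f (z + h)%C - D f z - / RtoC (2 * PI) * CI k2 0 (2 * PI) * h))
    with (Cmod (CI (fun t => (k1 t + (- (1)) * k0 t) + (- h) * k2 t)%C 0 (2 * PI)))
    by (rewrite <- E, Cmod_mult, Cmod_R, Rabs_pos_eq by lra; reflexivity).
  apply Rle_trans with (2 * (2 * PI - 0) * (4 * (K * Cmod h) * Cmod h)).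
  - apply CI_bound; [lra|apply rcont_plus; assumption|]. intros t _.
    unfold k1, k0, k2, kD, cauchy_kernel. set (zeta := vline 0 t).
    destruct (Hec zeta eq_refl) as [U1 U2]. set (u := cexp zeta) in *.
    replace ((f (z + h + u)%C - f (z + h)%C) * cexp (- zeta) + - (1) * ((f (z + u)%C - f z) * cexp (- zeta))
        + - h * ((D f (z + u)%C - D f z) * cexp (- zeta)))%C
      with (((f (z + u + h)%C - f (z + u)%C - h * D f (z + u)%C) - (f (z + h)%C - f z - h * D f z)) * cexp (- zeta))%C
      by (replace (z + u + h)%C with (z + h + u)%C by ring; ring).
    rewrite Cmod_mult, U2, Rmult_1_r. eapply Rle_trans; [apply Cmod_triangle_minus|].
    assert (B1 : Cmod (f (z + u + h)%C - f (z + u)%C - h * D f (z + u)%C) <= 2 * (K * Cmod h) * Cmod h).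
    { apply H2; [|lra]. replace (z + u - z)%C with u by ring. lra. }
    assert (B2 : Cmod (f (z + h)%C - f z - h * D f z) <= 2 * (K * Cmod h) * Cmod h).
    { apply H2; [|lra]. replace (z - z)%C with (RtoC 0) by ring. rewrite Cmod_0. lra. }
    lra.
  - pose proof (Cmod_ge_0 h).
    assert (HKh : 8 * K * Cmod h <= eps).
    { apply Rmult_lt_compat_l with (r := 8 * K) in Hh2; [|lra].
      replace (8 * K * (eps / (8 * K))) with eps in Hh2 by (field; lra). lra. }
    replace (2 * (2 * PI - 0) * (4 * (K * Cmod h) * Cmod h)) with (2 * PI * ((8 * K * Cmod h) * Cmod h)) by ring.
    apply Rmult_le_compat_l; [lra|]. apply Rmult_le_compat_r; lra.
Qed.

(** * Laplacians and the maximum principle *)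

(** A relation, with the first derivative required only for |t| < d: the functions at stake involve
    logarithms and are smooth only near [z]. *)
Definition line2 (u : C -> R) (z e : C) (d A : R) : Prop :=
  exists v1 : R -> R,
    (forall t, Rabs t < d -> is_derive (fun s : R => u (z + RtoC s * e)%C) t (v1 t)) /\ is_derive v1 0 A.

Definition laplacian (u : C -> R) (z : C) (L : R) : Prop :=
  exists d A B, 0 < d /\ line2 u z 1 d A /\ line2 u z Ci d B /\ L = A + B.

(** If A > 0, then v1(c') < v1(0) < v1(c) for all small c' < 0 < c. The mean value theorem on either
    side of the maximum yields such points with v1(c) <= 0 <= v1(c'). *)
Lemma second_derivative_test (v v1 : R -> R) (d A : R) : 0 < d ->
  (forall t, Rabs t < d -> is_derive v t (v1 t)) -> is_derive v1 0 A ->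
  (forall t, Rabs t < d -> v t <= v 0) -> A <= 0.
Proof.
  intros Hd Hv Hv1 Hmax. apply Rnot_lt_le. intros HA.
  apply is_derive_Reals in Hv1. destruct (Hv1 A HA) as [e He].
  assert (Hs : forall t, t <> 0 -> Rabs t < e -> 0 < (v1 t - v1 0) / t).
  { intros t Ht Hte. specialize (He t Ht Hte). rewrite Rplus_0_l in He.
    apply Rabs_lt_between in He. lra. }
  set (t := Rmin d e / 2).
  assert (Ht0 : 0 < Rmin d e) by (apply Rmin_pos; [exact Hd|apply cond_pos]).
  pose proof (Rmin_l d e). pose proof (Rmin_r d e).
  assert (Ht : 0 < t < d /\ t < e) by (unfold t; lra).
  destruct (MVT_cor2 v v1 0 t) as [c [Ec Hc]]; [lra| |].
  { intros c Hc. apply is_derive_Reals, Hv. rewrite Rabs_pos_eq; lra. }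
  destruct (MVT_cor2 v v1 (- t) 0) as [c' [Ec' Hc']]; [lra| |].
  { intros c' Hc'. apply is_derive_Reals, Hv. rewrite Rabs_left1; lra. }
  assert (P1 : v1 0 < v1 c).
  { specialize (Hs c ltac:(lra)). rewrite Rabs_pos_eq in Hs by lra. specialize (Hs ltac:(lra)).
    apply Rmult_lt_compat_r with (r := c) in Hs; [|lra].
    replace ((v1 c - v1 0) / c * c) with (v1 c - v1 0) in Hs by (field; lra). lra. }
  assert (P2 : v1 c' < v1 0).
  { specialize (Hs c' ltac:(lra)). rewrite Rabs_left1 in Hs by lra. specialize (Hs ltac:(lra)).
    apply Rmult_lt_compat_r with (r := - c') in Hs; [|lra].
    replace ((v1 c' - v1 0) / c' * - c') with (v1 0 - v1 c') in Hs by (field; lra). lra. }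
  pose proof (Hmax t ltac:(rewrite Rabs_pos_eq; lra)).
  pose proof (Hmax (- t) ltac:(rewrite Rabs_left1; lra)). nra.
Qed.

Lemma laplacian_local_max (u : C -> R) (z : C) (L r : R) : laplacian u z L -> 0 < r ->
  (forall w, Cmod (w - z) < r -> u w <= u z) -> L <= 0.
Proof.
  intros [d [A [B [Hd [[v1 [H1 H1']] [[v2 [H2 H2']] ->]]]]]] Hr Hmax.
  assert (Hd' : 0 < Rmin d r) by (apply Rmin_pos; assumption).
  pose proof (Rmin_l d r) as M1. pose proof (Rmin_r d r) as M2.
  assert (Hv : forall e, Cmod e = 1 -> forall t, Rabs t < Rmin d r ->
    u (z + RtoC t * e)%C <= u (z + RtoC 0 * e)%C).
  { intros e He t Ht. replace (z + RtoC 0 * e)%C with z by ring. apply Hmax.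
    replace (z + RtoC t * e - z)%C with (RtoC t * e)%C by ring.
    rewrite Cmod_mult, Cmod_R, He. lra. }
  assert (A <= 0).
  { apply (second_derivative_test (fun s => u (z + RtoC s * 1)%C) v1 (Rmin d r)); try assumption.
    - intros t Ht. apply H1. lra.
    - apply Hv, Cmod_1. }
  assert (B <= 0).
  { apply (second_derivative_test (fun s => u (z + RtoC s * Ci)%C) v2 (Rmin d r)); try assumption.
    - intros t Ht. apply H2. lra.
    - apply Hv, Cmod_Ci. }
  lra.
Qed.

Lemma line2_plus (u v : C -> R) (z e : C) (d1 d2 A B : R) :
  line2 u z e d1 A -> line2 v z e d2 B -> line2 (fun w => u w + v w) z e (Rmin d1 d2) (A + B).
Proof.
  intros [u1 [H1 H1']] [v1 [H2 H2']]. exists (fun t => u1 t + v1 t). split.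
  - intros t Ht. apply (is_derive_plus (fun s : R => u (z + RtoC s * e)%C) (fun s : R => v (z + RtoC s * e)%C)).
    + apply H1. eapply Rlt_le_trans; [exact Ht|apply Rmin_l].
    + apply H2. eapply Rlt_le_trans; [exact Ht|apply Rmin_r].
  - apply (is_derive_plus u1 v1); assumption.
Qed.

Lemma laplacian_plus (u v : C -> R) (z : C) (L M : R) :
  laplacian u z L -> laplacian v z M -> laplacian (fun w => u w + v w) z (L + M).
Proof.
  intros [d [A [B [Hd [H1 [H2 ->]]]]]] [d' [A' [B' [Hd' [H1' [H2' ->]]]]]].
  exists (Rmin d d'), (A + A'), (B + B'). split; [apply Rmin_pos; assumption|].
  split; [apply line2_plus; assumption|]. split; [apply line2_plus; assumption|]. ring.
Qed.

Definition modsq (z : C) : R := fst z ^ 2 + snd z ^ 2.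

Lemma modsq_Cmod (z : C) : modsq z = Cmod z ^ 2.
Proof. symmetry. apply Cmod_sqr. Qed.

Lemma modsq_ge_0 (z : C) : 0 <= modsq z.
Proof. rewrite modsq_Cmod. apply pow2_ge_0. Qed.

Lemma modsq_pos (z : C) : z <> 0%C -> 0 < modsq z.
Proof. intros H. rewrite modsq_Cmod. apply pow_lt, Cmod_gt_0, H. Qed.

(** Chain rule along a line: [a] and [c] are the first and second derivatives of [phi] in the
    direction [e]. *)
Lemma line2_modsq (phi : C -> C) (t t1 : R -> R) (T2 eta : R) (z e : C) : entire phi -> 0 < eta ->
  (forall X, Rabs (X - modsq (phi z)) < eta -> is_derive t X (t1 X)) ->
  is_derive t1 (modsq (phi z)) T2 ->
  let p := phi z in let a := (D phi z * e)%C in let c := (D (D phi) z * e * e)%C in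
  exists d, 0 < d /\
  line2 (fun w => t (modsq (phi w))) z e d
    (T2 * (2 * (fst p * fst a + snd p * snd a)) ^ 2
     + t1 (modsq p) * (2 * (fst a ^ 2 + snd a ^ 2 + fst p * fst c + snd p * snd c))).
Proof.
  intros Hphi Heta Ht Ht1 p a c.
  pose proof (entire_D phi Hphi) as Hphi1.
  set (F := fun s => fst (phi (z + RtoC s * e)%C)). set (G := fun s => snd (phi (z + RtoC s * e)%C)).
  set (F1 := fun s => fst (D phi (z + RtoC s * e) * e)%C). set (G1 := fun s => snd (D phi (z + RtoC s * e) * e)%C).
  assert (HF : forall s, is_derive F s (F1 s)) by (intros; apply line_derive_fst, D_spec, Hphi).
  assert (HG : forall s, is_derive G s (G1 s)) by (intros; apply line_derive_snd, D_spec, Hphi).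
  assert (E0 : (z + RtoC 0 * e)%C = z) by ring.
  assert (Hce : cderiv (fun w => D phi w * e)%C (z + RtoC 0 * e)%C (D (D phi) z * e)%C).
  { rewrite E0. replace (D (D phi) z * e)%C with (D (D phi) z * e + D phi z * 0)%C by ring.
    apply (cderiv_mult (D phi) (fun _ => e)); [apply D_spec, Hphi1|apply cderiv_const]. }
  assert (HF1 : is_derive F1 0 (fst c)) by (apply (line_derive_fst (fun w => D phi w * e)%C), Hce).
  assert (HG1 : is_derive G1 0 (snd c)) by (apply (line_derive_snd (fun w => D phi w * e)%C), Hce).
  set (X := fun s => F s ^ 2 + G s ^ 2). set (X1 := fun s => 2 * (F s * F1 s + G s * G1 s)).
  assert (HX : forall s, is_derive X s (X1 s)).
  { intros s. unfold X, X1. auto_derive.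
    - split; [exists (F1 s); apply HF|]. split; [exists (G1 s); apply HG|exact I].
    - replace (Derive (fun x : R => F x) s) with (F1 s) by (symmetry; apply is_derive_unique, HF).
      replace (Derive (fun x : R => G x) s) with (G1 s) by (symmetry; apply is_derive_unique, HG). ring. }
  assert (E1 : F 0 = fst p /\ G 0 = snd p /\ F1 0 = fst a /\ G1 0 = snd a)
    by (unfold F, G, F1, G1; rewrite E0; auto).
  destruct E1 as [EF [EG [EF1 EG1]]].
  assert (HX1 : is_derive X1 0 (2 * (fst a ^ 2 + snd a ^ 2 + fst p * fst c + snd p * snd c))).
  { unfold X1. auto_derive.
    - repeat split; eexists; eauto.
    - replace (Derive (fun x : R => F x) 0) with (F1 0) by (symmetry; apply is_derive_unique, HF).
      replace (Derive (fun x : R => G x) 0) with (G1 0) by (symmetry; apply is_derive_unique, HG).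
      replace (Derive (fun x : R => F1 x) 0) with (fst c) by (symmetry; apply is_derive_unique, HF1).
      replace (Derive (fun x : R => G1 x) 0) with (snd c) by (symmetry; apply is_derive_unique, HG1).
      rewrite EF, EG, EF1, EG1. ring. }
  assert (EX : X 0 = modsq p) by (unfold X; rewrite EF, EG; reflexivity).
  assert (HcX : continuity_pt X 0).
  { apply continuity_pt_filterlim, (ex_derive_continuous X). eexists; apply HX. }
  destruct (HcX eta Heta) as [d [Hd Hnear]].
  exists d. split; [exact Hd|]. exists (fun s => t1 (X s) * X1 s). split.
  - intros s Hs. replace (t1 (X s) * X1 s) with (scal (X1 s) (t1 (X s))) by (unfold scal; simpl; unfold mult; simpl; ring).
    apply (is_derive_comp t X); [|apply HX]. apply Ht.
    destruct (Req_dec s 0) as [->|Hs0].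
    + rewrite EX. unfold Rminus. rewrite Rplus_opp_r, Rabs_R0. exact Heta.
    + fold p. rewrite <- EX. apply Hnear. split; [split; [exact I|auto]|]. simpl. unfold Rdist.
      rewrite Rminus_0_r. exact Hs.
  - assert (Hc : is_derive (fun s => t1 (X s)) 0 (X1 0 * T2)).
    { apply (is_derive_comp t1 X); [rewrite EX; exact Ht1|apply HX]. }
    pose proof (is_derive_mult _ X1 0 _ _ Hc HX1 Rmult_comm) as Hm.
    refine (eq_ind _ (fun l => is_derive (fun s => t1 (X s) * X1 s) 0 l) Hm _ _).
    set (Q := 2 * (fst a ^ 2 + snd a ^ 2 + fst p * fst c + snd p * snd c)).
    change ((X1 0 * T2) * X1 0 + t1 (X 0) * Q
      = T2 * (2 * (fst p * fst a + snd p * snd a)) ^ 2 + t1 (modsq p) * Q).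
    rewrite EX. unfold X1. rewrite EF, EG, EF1, EG1. ring.
Qed.

(** Summing over the directions 1 and i, the terms with the second derivative of [phi] cancel
    because 1 + i^2 = 0, and the squared inner products add up to a multiple of |phi|^2 |phi'|^2.
    Every Laplacian needed later is a sum of instances of this one. *)
Lemma laplacian_modsq (phi : C -> C) (t t1 : R -> R) (T2 eta : R) (z : C) : entire phi -> 0 < eta ->
  (forall X, Rabs (X - modsq (phi z)) < eta -> is_derive t X (t1 X)) ->
  is_derive t1 (modsq (phi z)) T2 ->
  laplacian (fun w => t (modsq (phi w))) z
    (4 * modsq (D phi z) * (t1 (modsq (phi z)) + modsq (phi z) * T2)).
Proof.
  intros Hphi Heta Ht Ht1.
  destruct (line2_modsq phi t t1 T2 eta z 1 Hphi Heta Ht Ht1) as [d1 [Hd1 H1]].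
  destruct (line2_modsq phi t t1 T2 eta z Ci Hphi Heta Ht Ht1) as [d2 [Hd2 H2]].
  assert (Hw : forall u e d d' A, d' <= d -> line2 u z e d A -> line2 u z e d' A).
  { intros u e d d' A Hle [v1 [Ha Hb]]. exists v1. split; [|exact Hb]. intros s Hs. apply Ha. lra. }
  eexists (Rmin d1 d2), _, _. split; [apply Rmin_pos; assumption|].
  split; [eapply Hw; [apply Rmin_l|exact H1]|]. split; [eapply Hw; [apply Rmin_r|exact H2]|].
  unfold modsq, Cmult, Ci, RtoC; simpl. ring.
Qed.

(** * Maximum and minimum principles *)

Definition rcont_at (u : C -> R) (z : C) : Prop :=
  forall eps, 0 < eps -> exists d, 0 < d /\ forall w, Cmod (w - z) < d -> Rabs (u w - u z) < eps.

Lemma rcont_at_usc (K : C -> Prop) (u : C -> R) : (forall z, K z -> rcont_at u z) -> usc_on K u.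
Proof.
  intros H z Hz eps He. destruct (H z Hz eps He) as [d [Hd Hw]]. exists d. split; [exact Hd|].
  intros w _ Hwz. specialize (Hw w Hwz). apply Rabs_lt_between in Hw. lra.
Qed.

Lemma rcont_at_comp (t : R -> R) (u : C -> R) (z : C) :
  continuity_pt t (u z) -> rcont_at u z -> rcont_at (fun w => t (u w)) z.
Proof.
  intros Ht Hu eps He. destruct (Ht eps He) as [e [He' H]]. destruct (Hu e He') as [d [Hd H']].
  exists d. split; [exact Hd|]. intros w Hw. destruct (Req_dec (u w) (u z)) as [->|Hne].
  - unfold Rminus. rewrite Rplus_opp_r, Rabs_R0. exact He.
  - apply H. split; [split; [exact I|auto]|]. apply H', Hw.
Qed.

Lemma rcont_at_plus (u v : C -> R) (z : C) : rcont_at u z -> rcont_at v z -> rcont_at (fun w => u w + v w) z.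
Proof.
  intros Hu Hv eps He. destruct (Hu (eps / 2)) as [d1 [Hd1 H1]]; [lra|].
  destruct (Hv (eps / 2)) as [d2 [Hd2 H2]]; [lra|].
  exists (Rmin d1 d2). split; [apply Rmin_pos; assumption|]. intros w Hw.
  specialize (H1 w (Rlt_le_trans _ _ _ Hw (Rmin_l _ _))).
  specialize (H2 w (Rlt_le_trans _ _ _ Hw (Rmin_r _ _))).
  replace (u w + v w - (u z + v z)) with ((u w - u z) + (v w - v z)) by ring.
  eapply Rle_lt_trans; [apply Rabs_triang|]. lra.
Qed.

Lemma rcont_at_modsq (f : C -> C) (z : C) : ccont f z -> rcont_at (fun w => modsq (f w)) z.
Proof.
  intros Hf.
  assert (H1 : rcont_at (fun w => fst (f w)) z).
  { intros eps He. destruct (Hf eps He) as [d [Hd H]]. exists d. split; [exact Hd|]. intros w Hw.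
    eapply Rle_lt_trans; [|apply (H w Hw)]. exact (fst_le_Cmod (f w - f z)%C). }
  assert (H2 : rcont_at (fun w => snd (f w)) z).
  { intros eps He. destruct (Hf eps He) as [d [Hd H]]. exists d. split; [exact Hd|]. intros w Hw.
    eapply Rle_lt_trans; [|apply (H w Hw)]. exact (snd_le_Cmod (f w - f z)%C). }
  assert (Hsq : forall x, continuity_pt (fun y => y ^ 2) x).
  { intros x. apply derivable_continuous_pt, derivable_pt_pow. }
  unfold modsq. apply rcont_at_plus.
  - apply (rcont_at_comp (fun y => y ^ 2) (fun w => fst (f w))); [apply Hsq|exact H1].
  - apply (rcont_at_comp (fun y => y ^ 2) (fun w => snd (f w))); [apply Hsq|exact H2].
Qed.

(** A maximum at an interior point would force a nonpositive Laplacian there. *)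
Lemma positive_laplacian_max (u : C -> R) (c : C) (r : R) : 0 < r ->
  (forall z, Cmod (z - c) <= r -> rcont_at u z) ->
  (forall z, Cmod (z - c) < r -> exists L, 0 < L /\ laplacian u z L) ->
  forall w, Cmod (w - c) <= r -> exists b, Cmod (b - c) = r /\ u w <= u b.
Proof.
  intros Hr Hc HL w Hw.
  destruct (usc_attains_max c r u) as [z0 [Hz0 Hmax]]; [lra|apply rcont_at_usc, Hc|].
  exists z0. split; [|apply Hmax, Hw].
  destruct (Rle_lt_or_eq_dec _ _ Hz0) as [Hlt|Heq]; [|exact Heq]. exfalso.
  destruct (HL z0 Hlt) as [L [HLp HLl]].
  assert (L <= 0); [|lra].
  apply (laplacian_local_max u z0 L (r - Cmod (z0 - c))); [exact HLl|lra|].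
  intros v Hv. apply Hmax. pose proof (Cmod_minus_triangle v z0 c). lra.
Qed.

Lemma entire_minus_const (c : C) : entire (fun w => w - c)%C.
Proof. apply entire_minus; [apply entire_id|apply entire_const]. Qed.

Lemma D_minus_const (c z : C) : D (fun w => w - c)%C z = 1%C.
Proof.
  apply D_eq. replace (RtoC 1) with (1 - 0)%C by ring.
  apply cderiv_minus; [apply cderiv_id|apply cderiv_const].
Qed.

Lemma laplacian_square_dist (c z : C) (eps : R) :
  laplacian (fun w => eps * modsq (w - c)%C) z (4 * eps).
Proof.
  pose proof (laplacian_modsq (fun w => w - c)%C (fun X => eps * X) (fun _ => eps) 0 1 z) as H.
  rewrite D_minus_const in H.
  replace (4 * eps) with (4 * modsq 1%C * (eps + modsq (z - c)%C * 0))
    by (unfold modsq, RtoC; simpl; ring).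
  apply H; [apply entire_minus_const|lra| |].
  - intros X _. auto_derive; [exact I|ring].
  - apply (is_derive_const (V := R_NormedModule)).
Qed.

Lemma rcont_at_square_dist (c z : C) (eps : R) : rcont_at (fun w => eps * modsq (w - c)%C) z.
Proof.
  apply (rcont_at_comp (fun X => eps * X) (fun w => modsq (w - c)%C)).
  - apply derivable_continuous_pt, derivable_pt_scal, derivable_pt_id.
  - apply rcont_at_modsq, entire_ccont, entire_minus_const.
Qed.

Theorem maximum_principle (f : C -> C) (c : C) (r M : R) : entire f -> 0 < r ->
  (forall w, Cmod (w - c) = r -> Cmod (f w) <= M) ->
  forall w, Cmod (w - c) <= r -> Cmod (f w) <= M.
Proof.
  intros Hf Hr HM w Hw.
  assert (HM0 : 0 <= M).
  { apply Rle_trans with (Cmod (f (c + RtoC r)%C)); [apply Cmod_ge_0|]. apply HM.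
    replace (c + RtoC r - c)%C with (RtoC r) by ring. rewrite Cmod_R. apply Rabs_pos_eq. lra. }
  (* The Laplacian 4 |f'|^2 of |f|^2 may vanish; the term eps |v - c|^2 makes it strictly positive
     and costs exactly e on the circle. *)
  assert (H : modsq (f w) <= M ^ 2).
  { apply le_epsilon. intros e He. set (eps := e / r ^ 2).
    assert (Hr2 : 0 < r ^ 2) by (apply pow_lt, Hr).
    assert (Heps : 0 < eps) by (apply Rdiv_lt_0_compat; assumption).
    destruct (positive_laplacian_max (fun v => modsq (f v) + eps * modsq (v - c)%C) c r Hr) with (w := w)
      as [b [Hb1 Hb2]]; [| |exact Hw|].
    - intros z _. apply rcont_at_plus; [apply rcont_at_modsq, entire_ccont, Hf|apply rcont_at_square_dist].
    - intros z _. exists (4 * modsq (D f z) * (1 + modsq (f z) * 0) + 4 * eps). split.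
      + pose proof (modsq_ge_0 (D f z)). lra.
      + apply laplacian_plus; [|apply laplacian_square_dist].
        apply (laplacian_modsq f (fun X => X) (fun _ => 1) 0 1 z Hf Rlt_0_1).
        * intros X _. apply (is_derive_id (K := R_AbsRing)).
        * apply (is_derive_const (V := R_NormedModule)).
    - assert (eps * modsq (b - c)%C = e).
      { rewrite modsq_Cmod, Hb1. unfold eps. field. lra. }
      assert (modsq (f b) <= M ^ 2).
      { rewrite modsq_Cmod. apply pow_incr. split; [apply Cmod_ge_0|apply HM, Hb1]. }
      pose proof (modsq_ge_0 (w - c)%C). assert (0 <= eps * modsq (w - c)%C) by (apply Rmult_le_pos; lra).
      lra. }
  rewrite modsq_Cmod in H.
  apply Rnot_lt_le. intros Hlt. pose proof (Cmod_ge_0 (f w)). nra.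
Qed.

(** Since 1/f need not be entire, the argument is repeated for 1/|f|^2: with t(X) = 1/X one has t' +
    X t'' = 1/X^2 > 0. *)
Theorem minimum_principle (f : C -> C) (c : C) (r m : R) : entire f -> 0 < r -> 0 < m ->
  (forall w, Cmod (w - c) <= r -> f w <> 0%C) ->
  (forall w, Cmod (w - c) = r -> m <= Cmod (f w)) -> m <= Cmod (f c).
Proof.
  intros Hf Hr Hm H0 HM.
  assert (Hc : Cmod (c - c) <= r).
  { replace (c - c)%C with (RtoC 0) by ring. rewrite Cmod_0. lra. }
  assert (Hp : forall w, Cmod (w - c) <= r -> 0 < modsq (f w)) by (intros w Hw; apply modsq_pos, H0, Hw).
  assert (H : / modsq (f c) <= / m ^ 2).
  { apply le_epsilon. intros e He. set (eps := e / r ^ 2).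
    assert (Hr2 : 0 < r ^ 2) by (apply pow_lt, Hr).
    assert (Heps : 0 < eps) by (apply Rdiv_lt_0_compat; assumption).
    destruct (positive_laplacian_max (fun v => / modsq (f v) + eps * modsq (v - c)%C) c r Hr) with (w := c)
      as [b [Hb1 Hb2]]; [| |exact Hc|].
    - intros z Hz. apply rcont_at_plus; [|apply rcont_at_square_dist].
      apply (rcont_at_comp Rinv (fun w => modsq (f w))).
      + apply (continuity_pt_inv (fun x => x)); [apply derivable_continuous_pt, derivable_pt_id|].
        specialize (Hp z Hz). lra.
      + apply rcont_at_modsq, entire_ccont, Hf.
    - intros z Hz. assert (Hz' : Cmod (z - c) <= r) by lra. pose proof (Hp z Hz') as HX.
      set (X0 := modsq (f z)) in *.
      exists (4 * modsq (D f z) * (- / X0 ^ 2 + X0 * (2 / X0 ^ 3)) + 4 * eps). split.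
      + replace (- / X0 ^ 2 + X0 * (2 / X0 ^ 3)) with (/ X0 ^ 2) by (field; lra).
        pose proof (modsq_ge_0 (D f z)).
        assert (0 < / X0 ^ 2) by (apply Rinv_0_lt_compat, pow_lt, HX). nra.
      + apply laplacian_plus; [|apply laplacian_square_dist].
        apply (laplacian_modsq f Rinv (fun X => - / X ^ 2) (2 / X0 ^ 3) X0 z Hf HX).
        * intros X HXX. apply Rabs_lt_between in HXX. fold X0 in HXX. auto_derive; [lra|field; lra].
        * fold X0. auto_derive; [intros E; nra|field; lra].
    - assert (E1 : eps * modsq (b - c)%C = e).
      { rewrite modsq_Cmod, Hb1. unfold eps. field. lra. }
      assert (E2 : / modsq (f b) <= / m ^ 2).
      { apply Rinv_le_contravar; [apply pow_lt, Hm|]. rewrite modsq_Cmod.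
        apply pow_incr. split; [lra|apply HM, Hb1]. }
      pose proof (modsq_ge_0 (c - c)%C). assert (0 <= eps * modsq (c - c)%C) by (apply Rmult_le_pos; lra).
      lra. }
  assert (H' : m ^ 2 <= modsq (f c)).
  { rewrite <- (Rinv_inv (m ^ 2)), <- (Rinv_inv (modsq (f c))).
    apply Rinv_le_contravar; [apply Rinv_0_lt_compat, Hp, Hc|exact H]. }
  rewrite modsq_Cmod in H'. apply Rnot_lt_le. intros Hlt. pose proof (Cmod_ge_0 (f c)). nra.
Qed.

(** * Liouville's theorem and the open mapping theorem *)

Lemma D_zero_const (f : C -> C) : entire f -> (forall z, D f z = 0%C) -> forall z w, f z = f w.
Proof.
  intros Hf H0 z w.
  pose proof (mean_value_bound f w (z - w)%C 0 Hf) as H.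
  replace (w + (z - w))%C with z in H by ring.
  assert (E : Cmod (f z - f w) = 0).
  { apply Rle_antisym; [|apply Cmod_ge_0]. eapply Rle_trans; [apply H|right; ring].
    intros t _. rewrite H0, Cmod_0. lra. }
  apply Cmod_eq_0 in E. replace (f z) with (f z - f w + f w)%C by ring. rewrite E. ring.
Qed.

Lemma le_all_div_eq_0 (x K : R) : 0 <= x -> (forall R0, exists r, R0 <= r /\ 0 < r /\ x <= K / r) -> x = 0.
Proof.
  intros Hx H. apply Rle_antisym; [|exact Hx]. apply Rnot_lt_le. intros Hp.
  destruct (H ((Rabs K + 1) / x)) as [r [H1 [H2 H3]]].
  pose proof (Rabs_pos K). pose proof (Rle_abs K).
  assert (Hxr : x * r <= K).
  { apply Rmult_le_compat_r with (r := r) in H3; [|lra].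
    replace (K / r * r) with K in H3 by (field; lra). exact H3. }
  apply Rmult_le_compat_l with (r := x) in H1; [|lra].
  replace (x * ((Rabs K + 1) / x)) with (Rabs K + 1) in H1 by (field; lra). lra.
Qed.

Theorem liouville (f : C -> C) (M : R) : entire f -> (forall z, Cmod (f z) <= M) -> forall z w, f z = f w.
Proof.
  intros Hf HM. apply D_zero_const; [exact Hf|]. intros z. apply Cmod_eq_0.
  apply le_all_div_eq_0 with (4 * M); [apply Cmod_ge_0|]. intros R0. exists (Rmax R0 1).
  split; [apply Rmax_l|]. assert (0 < Rmax R0 1) by (pose proof (Rmax_r R0 1); lra).
  split; [assumption|]. apply cauchy_estimate; auto.
Qed.

Definition is_affine (h : C -> C) : Prop := exists a b, forall z, h z = (a * z + b)%C.

Lemma D_const_affine (h : C -> C) (a : C) : entire h -> (forall z, D h z = a) -> is_affine h.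
Proof.
  intros Hh H. exists a, (h 0%C). intros z.
  assert (Haff : entire (fun z => a * z)%C) by (apply entire_mult; [apply entire_const|apply entire_id]).
  assert (E : (h z - a * z = h 0 - a * 0)%C).
  { apply (D_zero_const (fun z => h z - a * z)%C); [apply entire_minus; assumption|].
    intros w. apply D_eq. replace (RtoC 0) with (a - a * 1)%C by ring.
    apply cderiv_minus; [rewrite <- (H w); apply D_spec, Hh|]. apply cderiv_scal, cderiv_id. }
  transitivity (h z - a * z + a * z)%C; [ring|]. rewrite E. ring.
Qed.

(** Cauchy's estimate on a disc of radius r/2 about z, available once r >= 2|z|, bounds the
    derivative by a constant independent of z; Liouville's theorem makes the derivative constant. *)
Lemma linear_growth_affine (h : C -> C) (K : R) : entire h ->
  (forall R0, exists r, R0 <= r /\ 0 < r /\ forall z, Cmod z <= r -> Cmod (h z) <= K * r) -> is_affine h.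
Proof.
  intros Hh H.
  assert (HD : forall z, Cmod (D h z) <= 8 * K).
  { intros z. destruct (H (2 * Cmod z)) as [r [H1 [H2 H3]]].
    replace (8 * K) with (4 * (K * r) / (r / 2)) by (field; lra).
    apply cauchy_estimate; [exact Hh|lra|]. intros w Hw. apply H3.
    replace w with (w - z + z)%C by ring. eapply Rle_trans; [apply Cmod_triangle|]. lra. }
  apply D_const_affine with (D h 0%C); [exact Hh|]. intros z.
  apply (liouville (D h) (8 * K)); [apply entire_D, Hh|exact HD].
Qed.

Lemma cderiv_ext_loc (f g : C -> C) (z l : C) (r : R) : 0 < r ->
  (forall w, Cmod (w - z) < r -> f w = g w) -> cderiv f z l -> cderiv g z l.
Proof.
  intros Hr E H eps He. destruct (H eps He) as [d [Hd Hh]]. exists (Rmin d r).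
  split; [apply Rmin_pos; assumption|]. intros h Hhd.
  rewrite <- !E; [apply Hh; eapply Rlt_le_trans; [exact Hhd|apply Rmin_l]| |].
  - replace (z - z)%C with (RtoC 0) by ring. rewrite Cmod_0. exact Hr.
  - replace (z + h - z)%C with h by ring. eapply Rlt_le_trans; [exact Hhd|apply Rmin_r].
Qed.

Lemma Cminus_eq_0 (a b : C) : (a - b)%C = 0%C -> a = b.
Proof. intros E. replace a with (a - b + b)%C by ring. rewrite E. ring. Qed.

(** The quotient, extended by f'(a), is differentiable at [a] with derivative f''(a)/2, by a
    second-order Taylor estimate that uses differentiability of [D f]. *)
Lemma entire_divide_root (f : C -> C) (a : C) : entire f -> f a = 0%C ->
  exists q : C -> C, entire q /\ forall w, f w = ((w - a) * q w)%C.
Proof.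
  intros Hf Hfa. pose proof (entire_D f Hf) as Hf1.
  set (q := fun w => if excluded_middle_informative (w = a) then D f a else (f w / (w - a))%C).
  assert (qa : q a = D f a).
  { unfold q. destruct (excluded_middle_informative (a = a)); [reflexivity|contradiction]. }
  assert (qw : forall w, w <> a -> q w = (f w / (w - a))%C).
  { intros w Hw. unfold q. destruct (excluded_middle_informative (w = a)); [contradiction|reflexivity]. }
  assert (Hne : forall w, w <> a -> (w - a)%C <> 0%C) by (intros w Hw E; apply Hw, Cminus_eq_0, E).
  exists q. split.
  - intros z. apply differentiable_cderiv. destruct (excluded_middle_informative (z = a)) as [->|Hz].
    + set (m := D (D f) a). exists (/ RtoC 2 * m)%C. intros eps He.
      destruct (D_spec (D f) a Hf1 (eps / 2)) as [d [Hd Hder]]; [lra|]. fold m in Hder.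
      exists d. split; [exact Hd|]. intros h Hh.
      destruct (excluded_middle_informative (h = 0%C)) as [->|Hh0].
      { replace (a + 0)%C with a by ring. replace (q a - q a - / RtoC 2 * m * 0)%C with (RtoC 0) by ring.
        rewrite Cmod_0. lra. }
      assert (Hah : (a + h)%C <> a).
      { intros E. apply Hh0. replace h with (a + h - a)%C by ring. rewrite E. ring. }
      rewrite qa, qw by exact Hah. replace (a + h - a)%C with h by ring.
      (* [G] is the second-order Taylor remainder of f at [a]; its derivative is o(|v|). *)
      set (G := fun v => (f (v + a)%C - D f a * v - / RtoC 2 * m * (v * v))%C).
      assert (HGd : forall v, cderiv G v (D f (v + a)%C - D f a * 1 - / RtoC 2 * m * (1 * v + v * 1))%C).
      { intros v. apply cderiv_minus.
        - apply cderiv_minus; [apply cderiv_shift, D_spec, Hf|apply cderiv_scal, cderiv_id].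
        - apply cderiv_scal. apply cderiv_mult; apply cderiv_id. }
      assert (H2 : RtoC 2 <> 0%C) by (intros E; apply RtoC_inj in E; lra).
      assert (HB : Cmod (G (0 + h)%C - G 0%C) <= 2 * (eps / 2 * Cmod h) * Cmod h).
      { apply mean_value_bound; [exact (entire_of_cderiv _ _ HGd)|]. intros t Ht.
        rewrite (D_eq _ _ _ (HGd _)). set (v := (0 + RtoC t * h)%C).
        assert (Hv : Cmod v <= Cmod h).
        { unfold v. rewrite Cplus_0_l, Cmod_mult, Cmod_R, Rabs_pos_eq by lra. pose proof (Cmod_ge_0 h). nra. }
        specialize (Hder v ltac:(lra)). replace (a + v)%C with (v + a)%C in Hder by ring.
        replace (D f (v + a)%C - D f a * 1 - / RtoC 2 * m * (1 * v + v * 1))%C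
          with (D f (v + a)%C - D f a - m * v)%C
          by (transitivity (D f (v + a)%C - D f a - (/ RtoC 2 * RtoC 2) * m * v)%C;
              [rewrite Cinv_l by exact H2; ring|replace (RtoC 2) with (1 + 1)%C at 2
                 by (rewrite <- RtoC_plus; f_equal; ring); ring]).
        eapply Rle_trans; [exact Hder|]. apply Rmult_le_compat_l; lra. }
      assert (E : (f (a + h)%C / h - D f a - / RtoC 2 * m * h)%C = ((G (0 + h)%C - G 0%C) / h)%C).
      { unfold G. rewrite !Cplus_0_l, Hfa, (Cplus_comm h a). field; auto. }
      rewrite E, Cmod_div by exact Hh0.
      assert (Hhp : 0 < Cmod h) by (apply Cmod_gt_0, Hh0).
      apply Rmult_le_reg_r with (Cmod h); [exact Hhp|].
      replace (Cmod (G (0 + h)%C - G 0%C) / Cmod h * Cmod h) with (Cmod (G (0 + h)%C - G 0%C)) by (field; lra).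
      lra.
    + eexists. apply (cderiv_ext_loc (fun w => f w * / (w - a))%C q z _ (Cmod (z - a))).
      * apply Cmod_gt_0, Hne, Hz.
      * intros w Hw. symmetry. apply qw. intros ->. rewrite Cmod_minus_sym in Hw. lra.
      * apply (cderiv_mult f (fun w => / (w - a))%C); [apply D_spec, Hf|].
        apply (cderiv_comp Cinv (fun w => w - a)%C); [|apply cderiv_inv, Hne, Hz].
        apply cderiv_minus; [apply cderiv_id|apply cderiv_const].
  - intros w. destruct (excluded_middle_informative (w = a)) as [->|Hw].
    + rewrite Hfa. ring.
    + rewrite qw by exact Hw. field. apply Hne, Hw.
Qed.

(** An identity theorem without power series. If every power of w - a divides f, the maximum
    principle for the quotients on a disc of radius rho >= 2|w - a| gives |f(w)| <= M 2^-n for all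
    n. *)
Lemma finite_order_of_zero (f : C -> C) (a : C) : entire f -> ~ (forall w, f w = 0%C) ->
  exists (n : nat) (q : C -> C), entire q /\ q a <> 0%C /\ forall w, f w = ((w - a) ^ n * q w)%C.
Proof.
  intros Hf Hnz. apply NNPP. intros Hno.
  assert (Hall : forall n : nat, exists q : C -> C, entire q /\ forall w, f w = ((w - a) ^ n * q w)%C).
  { induction n as [|n [q [Hq Eq]]].
    - exists f. split; [exact Hf|]. intros w. simpl. ring.
    - assert (Hqa : q a = 0%C).
      { apply NNPP. intros Hqa. apply Hno. exists n, q. auto. }
      destruct (entire_divide_root q a Hq Hqa) as [q' [Hq' Eq']]. exists q'. split; [exact Hq'|].
      intros w. rewrite Eq, Eq'. simpl. ring. }
  apply Hnz. intros w. apply Cmod_eq_0.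
  (* The factor 2 produces the ratio 1/2; the summand 1 keeps the radius positive when w = a. *)
  set (rho := 2 * Cmod (w - a) + 1). pose proof (Cmod_ge_0 (w - a)) as Hw0.
  assert (Hrho : 0 < rho) by (unfold rho; lra).
  destruct (entire_bounded_on_disc f a rho Hf) as [M [HM Hb]].
  assert (Hbd : forall n, Cmod (f w) <= M * (/ 2) ^ n).
  { intros n. destruct (Hall n) as [q [Hq Eq]].
    assert (Hrn : 0 < rho ^ n) by (apply pow_lt, Hrho).
    assert (HQ : Cmod (q w) <= M / rho ^ n).
    { apply (maximum_principle q a rho); [exact Hq|exact Hrho| |unfold rho; lra].
      intros v Hv. apply Rmult_le_reg_l with (rho ^ n); [exact Hrn|].
      replace (rho ^ n * (M / rho ^ n)) with M by (field; lra).
      rewrite <- Hv at 1. rewrite <- Cmod_pow, <- Cmod_mult, <- Eq. apply Hb. lra. }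
    rewrite Eq, Cmod_mult, Cmod_pow.
    apply Rle_trans with (Cmod (w - a) ^ n * (M / rho ^ n)).
    { apply Rmult_le_compat_l; [apply pow_le, Hw0|exact HQ]. }
    replace (Cmod (w - a) ^ n * (M / rho ^ n)) with (M * (Cmod (w - a) / rho) ^ n)
      by (unfold Rdiv; rewrite Rpow_mult_distr, pow_inv; ring).
    apply Rmult_le_compat_l; [lra|]. apply pow_incr. split.
    - apply Rmult_le_pos; [exact Hw0|left; apply Rinv_0_lt_compat, Hrho].
    - apply Rmult_le_reg_r with rho; [exact Hrho|]. unfold Rdiv. rewrite Rmult_assoc, Rinv_l by lra.
      unfold rho. lra. }
  apply Rle_antisym; [|apply Cmod_ge_0]. apply Rnot_lt_le. intros Hp.
  destruct (pow_lt_1_zero (/ 2)) with (y := Cmod (f w) / M) as [n Hn].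
  { rewrite Rabs_pos_eq; lra. } { apply Rdiv_lt_0_compat; lra. }
  specialize (Hn n (Nat.le_refl n)). specialize (Hbd n).
  rewrite Rabs_pos_eq in Hn by (apply pow_le; lra).
  apply Rmult_lt_compat_l with (r := M) in Hn; [|lra].
  replace (M * (Cmod (f w) / M)) with (Cmod (f w)) in Hn by (field; lra). lra.
Qed.

(** With f - f(z) = (w - z)^n q(w) and q(z) nonzero, |f - f(z)| is at least some m > 0 on a small
    circle. A value v within m/2 of f(z) that is omitted inside would contradict the minimum
    principle for f - v. *)
Theorem open_mapping (f : C -> C) (z : C) (r : R) : entire f -> ~ (forall v w, f v = f w) -> 0 < r ->
  exists r', 0 < r' /\ forall v, Cmod (v - f z) < r' -> exists u, Cmod (u - z) < r /\ f u = v.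
Proof.
  intros Hf Hnc Hr.
  destruct (finite_order_of_zero (fun w => f w - f z)%C z) as [n [q [Hq [Hqz Eq]]]].
  { apply entire_minus; [exact Hf|apply entire_const]. }
  { intros H. apply Hnc. intros v w. rewrite (Cminus_eq_0 _ _ (H v)), (Cminus_eq_0 _ _ (H w)). reflexivity. }
  assert (Hqp : 0 < Cmod (q z)) by (apply Cmod_gt_0, Hqz).
  destruct (entire_ccont q z Hq (Cmod (q z) / 2)) as [d [Hd Hcq]]; [lra|].
  set (rho := Rmin d r / 2).
  assert (Hm : 0 < Rmin d r) by (apply Rmin_pos; assumption).
  pose proof (Rmin_l d r). pose proof (Rmin_r d r).
  assert (Hrho : 0 < rho < d /\ rho < r) by (unfold rho; lra).
  set (m := rho ^ n * (Cmod (q z) / 2)).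
  assert (Hmp : 0 < m) by (apply Rmult_lt_0_compat; [apply pow_lt; lra|lra]).
  assert (Hcirc : forall w, Cmod (w - z) = rho -> m <= Cmod (f w - f z)).
  { intros w Hw. rewrite Eq, Cmod_mult, Cmod_pow, Hw. apply Rmult_le_compat_l; [apply pow_le; lra|].
    specialize (Hcq w ltac:(lra)). pose proof (Cmod_triangle_inv (q z) (q w)).
    rewrite (Cmod_minus_sym (q z)) in H1. lra. }
  exists (m / 2). split; [lra|]. intros v Hv. apply NNPP. intros Hno.
  assert (m / 2 <= Cmod (f z - v)); [|rewrite Cmod_minus_sym in Hv; lra].
  apply (minimum_principle (fun w => f w - v)%C z rho (m / 2)); [|lra|lra| |].
  - apply entire_minus; [exact Hf|apply entire_const].
  - intros w Hw E. apply Hno. exists w. split; [lra|]. apply Cminus_eq_0, E.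
  - intros w Hw. specialize (Hcirc w Hw).
    pose proof (Cmod_minus_triangle (f w) v (f z)). lra.
Qed.

(** * A negatively curved metric on the twice punctured plane *)

Definition qrt (X : R) : R := sqrt (sqrt X).

Lemma qrt_pos (X : R) : 0 < X -> 0 < qrt X.
Proof. intros H. apply sqrt_lt_R0, sqrt_lt_R0, H. Qed.

Lemma qrt_pow2 (X : R) : qrt X ^ 2 = sqrt X.
Proof. unfold qrt. apply pow2_sqrt, sqrt_pos. Qed.

Lemma qrt_pow4 (X : R) : 0 <= X -> qrt X ^ 4 = X.
Proof.
  intros H. replace (qrt X ^ 4) with ((qrt X ^ 2) ^ 2) by ring. rewrite qrt_pow2. apply pow2_sqrt, H.
Qed.

Lemma is_derive_qrt (X : R) : 0 < X -> is_derive qrt X (qrt X / (4 * X)).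
Proof.
  intros H. assert (Hs : 0 < sqrt X) by (apply sqrt_lt_R0, H).
  unfold qrt. auto_derive; [split; [exact H|split; [exact Hs|exact I]]|].
  assert (Hq : 0 < sqrt (sqrt X)) by (apply sqrt_lt_R0, Hs).
  assert (EX : X = sqrt X ^ 2) by (symmetry; apply pow2_sqrt; lra).
  assert (Es : sqrt X = sqrt (sqrt X) ^ 2) by (symmetry; apply pow2_sqrt; lra).
  replace (4 * X) with (4 * sqrt X ^ 2) by (rewrite <- EX; reflexivity).
  set (q := sqrt (sqrt X)) in *. rewrite Es. field. lra.
Qed.

(* With [p = |w|^(1/2)] and [q = |w - 1|^(1/2)] the metric [rho2] below is
   [(1 + p) (1 + q) / (p^3 q^3 L^2)]: at [0] and [1] the powers balance curvature against density, and at
   infinity the density is that of [|dw| / (|w| log |w|)], which is complete.  The constant [256] in [Lw]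
   absorbs the positive curvature coming from the logarithm. *)
Definition tm (X : R) : R := / 2 * ln (1 + qrt X) - 3 / 8 * ln X.
Definition tm1 (X : R) : R := qrt X / (8 * X * (1 + qrt X)) - 3 / (8 * X).
Definition tm2 (X : R) : R :=
  (qrt X / (32 * X * (1 + qrt X) ^ 2) - qrt X / (8 * X * (1 + qrt X))) / X + 3 / (8 * X ^ 2).

Lemma is_derive_tm (X : R) : 0 < X -> is_derive tm X (tm1 X).
Proof.
  intros H. pose proof (qrt_pos X H) as Hq. pose proof (is_derive_qrt X H) as Hd.
  unfold tm. auto_derive.
  - repeat split; try lra. eexists; exact Hd.
  - replace (Derive (fun x : R => qrt x) X) with (qrt X / (4 * X)) by (symmetry; apply is_derive_unique, Hd).
    unfold tm1. field. lra.
Qed.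

Lemma is_derive_tm1 (X : R) : 0 < X -> is_derive tm1 X (tm2 X).
Proof.
  intros H. pose proof (qrt_pos X H) as Hq. pose proof (is_derive_qrt X H) as Hd.
  assert (Hn : 8 * X * (1 + qrt X) <> 0) by nra.
  unfold tm1. auto_derive.
  - repeat split; try lra; try (eexists; exact Hd).
  - replace (Derive (fun x : R => qrt x) X) with (qrt X / (4 * X)) by (symmetry; apply is_derive_unique, Hd).
    unfold tm2. field. lra.
Qed.

Definition Lw (X : R) : R := 256 + ln (1 + X).
Definition tl (X : R) : R := - ln (Lw X).
Definition tl1 (X : R) : R := - / ((1 + X) * Lw X).
Definition tl2 (X : R) : R := (Lw X + 1) / ((1 + X) * Lw X) ^ 2.

Lemma Lw_ge (X : R) : 0 <= X -> 256 <= Lw X.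
Proof.
  intros H. unfold Lw. assert (0 <= ln (1 + X)); [|lra].
  rewrite <- ln_1. destruct H as [H| <-].
  - left. apply ln_increasing; lra.
  - right. f_equal. ring.
Qed.

Lemma Lw_pos_near (X : R) : - / 2 < X -> 0 < Lw X.
Proof.
  intros H. unfold Lw.
  assert (ln (/ 2) < ln (1 + X)) by (apply ln_increasing; lra).
  rewrite ln_Rinv in H0 by lra. assert (ln 2 < ln (exp 1)).
  { apply ln_increasing; [lra|]. pose proof (exp_ineq1 1). lra. }
  rewrite ln_exp in H1. lra.
Qed.

Lemma is_derive_tl (X : R) : - / 2 < X -> is_derive tl X (tl1 X).
Proof.
  intros H. pose proof (Lw_pos_near X H) as HL. unfold tl, tl1, Lw in *. auto_derive.
  - repeat split; lra.
  - field. lra.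
Qed.

Lemma is_derive_tl1 (X : R) : 0 <= X -> is_derive tl1 X (tl2 X).
Proof.
  intros H. pose proof (Lw_ge X H) as HL. unfold tl1, tl2, Lw in *. auto_derive.
  - repeat split; try lra. apply Rmult_integral_contrapositive; lra.
  - field. lra.
Qed.

(** The squared density, written as an exponential so that half its logarithm is a sum of functions
    of squared moduli, to which [laplacian_modsq] applies. *)
Definition rho2 (w : C) : R := exp (2 * (tm (modsq w) + tl (modsq w) + tm (modsq (w - 1)%C))).

Lemma exp_tm (X : R) : 0 < X -> exp (2 * tm X) = (1 + qrt X) / qrt X ^ 3.
Proof.
  intros H. pose proof (qrt_pos X H) as Hq. unfold tm.
  rewrite <- (qrt_pow4 X) at 2 by lra.
  replace (2 * (/ 2 * ln (1 + qrt X) - 3 / 8 * ln (qrt X ^ 4)))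
    with (ln (1 + qrt X) + - ln (qrt X ^ 3)).
  - rewrite exp_plus, exp_Ropp, !exp_ln by (try apply pow_lt; lra). reflexivity.
  - rewrite !ln_pow by exact Hq. simpl INR. lra.
Qed.

Lemma exp_tl (X : R) : 0 <= X -> exp (2 * tl X) = / Lw X ^ 2.
Proof.
  intros H. pose proof (Lw_ge X H). unfold tl.
  replace (2 * - ln (Lw X)) with (- ln (Lw X ^ 2)).
  - rewrite exp_Ropp, exp_ln by (apply pow_lt; lra). reflexivity.
  - rewrite ln_pow by lra. simpl INR. lra.
Qed.

Lemma rho2_eq (w : C) : w <> 0%C -> w <> 1%C ->
  let p := qrt (modsq w) in let q := qrt (modsq (w - 1)%C) in
  rho2 w = (1 + p) * (1 + q) / (p ^ 3 * q ^ 3 * Lw (modsq w) ^ 2).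
Proof.
  intros H0 H1 p q.
  assert (HP : 0 < modsq w) by (apply modsq_pos, H0).
  assert (HQ : 0 < modsq (w - 1)%C).
  { apply modsq_pos. intros E. apply H1, Cminus_eq_0, E. }
  pose proof (qrt_pos _ HP). pose proof (qrt_pos _ HQ). pose proof (Lw_ge (modsq w) (modsq_ge_0 w)).
  unfold rho2. rewrite !Rmult_plus_distr_l, !exp_plus, !exp_tm, exp_tl by lra.
  fold p q. field. unfold p, q. repeat split; lra.
Qed.

Lemma Rinv_le_of (a b : R) : 0 < a -> a <= b -> / b <= / a.
Proof. intros H1 H2. apply Rinv_le_contravar; assumption. Qed.

(** Each puncture, and infinity, has its own term: the first suffices for |w| small, the second for
    |w - 1| small, the third elsewhere. The hypotheses on p and q are the triangle inequalities for
    0, 1 and w, with p^2 = |w| and q^2 = |w - 1|. *)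
Lemma curvature_core (p q : R) : 0 < p -> 0 < q -> p ^ 2 <= q ^ 2 + 1 -> q ^ 2 <= p ^ 2 + 1 ->
  1 <= p ^ 2 + q ^ 2 ->
  / 20000 * ((1 + p) * (1 + q) / (p ^ 3 * q ^ 3)) <=
  / (64 * p ^ 3 * (1 + p) ^ 2) + / (64 * q ^ 3 * (1 + q) ^ 2) + p ^ 4 / (1 + p ^ 4) ^ 2.
Proof.
  assert (Hsmall : forall p q, 0 < p -> 0 < q -> p <= / 2 -> q ^ 2 <= p ^ 2 + 1 -> 1 <= p ^ 2 + q ^ 2 ->
    / 20000 * ((1 + p) * (1 + q) / (p ^ 3 * q ^ 3)) <= / (64 * p ^ 3 * (1 + p) ^ 2)).
  { clear p q. intros p q Hp Hq Hp2 H1 H2.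
    assert (Hq1 : / 2 <= q) by nra. assert (Hq2 : q <= 3 / 2) by nra.
    assert (Hq3 : / 8 <= q ^ 3).
    { replace (/ 8) with ((/ 2) ^ 3) by field. apply pow_incr. lra. }
    assert (Hp3 : 0 < p ^ 3) by (apply pow_lt, Hp).
    replace (/ 20000 * ((1 + p) * (1 + q) / (p ^ 3 * q ^ 3)))
      with (/ p ^ 3 * (/ 20000 * ((1 + p) * (1 + q)) * / q ^ 3)) by (field; lra).
    replace (/ (64 * p ^ 3 * (1 + p) ^ 2)) with (/ p ^ 3 * / (64 * (1 + p) ^ 2)) by (field; lra).
    apply Rmult_le_compat_l; [left; apply Rinv_0_lt_compat, Hp3|].
    apply Rle_trans with (/ 20000 * (3 / 2 * (5 / 2)) * 8).
    - apply Rmult_le_compat.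
      + apply Rmult_le_pos; [lra|]. apply Rmult_le_pos; lra.
      + left. apply Rinv_0_lt_compat. lra.
      + apply Rmult_le_compat_l; [lra|]. apply Rmult_le_compat; lra.
      + replace 8 with (/ / 8) by field. apply Rinv_le_of; lra.
    (* 144 is 64 times (3/2)^2, from p <= 1/2. *)
    - apply Rle_trans with (/ 144); [lra|]. apply Rinv_le_of; [|].
      + apply Rmult_lt_0_compat; [lra|]. apply pow_lt. lra.
      + assert ((1 + p) ^ 2 <= (3 / 2) ^ 2) by (apply pow_incr; lra). lra. }
  intros Hp Hq H1 H2 H3.
  assert (Hp3 : 0 < p ^ 3) by (apply pow_lt, Hp). assert (Hq3 : 0 < q ^ 3) by (apply pow_lt, Hq).
  assert (Hp4 : 0 < p ^ 4) by (apply pow_lt, Hp).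
  assert (A1 : 0 < / (64 * p ^ 3 * (1 + p) ^ 2)).
  { apply Rinv_0_lt_compat, Rmult_lt_0_compat; [lra|apply pow_lt; lra]. }
  assert (A2 : 0 < / (64 * q ^ 3 * (1 + q) ^ 2)).
  { apply Rinv_0_lt_compat, Rmult_lt_0_compat; [lra|apply pow_lt; lra]. }
  assert (A3 : 0 < p ^ 4 / (1 + p ^ 4) ^ 2) by (apply Rdiv_lt_0_compat; [lra|apply pow_lt; lra]).
  destruct (Rle_dec p (/ 2)) as [C1|C1].
  { pose proof (Hsmall p q Hp Hq C1 H2 H3). lra. }
  destruct (Rle_dec q (/ 2)) as [C2|C2].
  { pose proof (Hsmall q p Hq Hp C2 H1 ltac:(lra)) as H.
    replace ((1 + q) * (1 + p) / (q ^ 3 * p ^ 3)) with ((1 + p) * (1 + q) / (p ^ 3 * q ^ 3)) in H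
      by (field; lra). lra. }
  assert (Hpq : p ^ 2 <= 5 * q ^ 2) by nra.
  assert (Hp16 : / 16 <= p ^ 4).
  { replace (/ 16) with ((/ 2) ^ 4) by field. apply pow_incr. lra. }
  (* For p > 1/2 one has 1 <= 16 p^4, whence 289 = 17^2. Together with the 45 of [B2] this asks for
     a constant of at least 45 times 289, that is 13005; 20000 is enough. *)
  assert (B1 : / 289 * / p ^ 4 <= p ^ 4 / (1 + p ^ 4) ^ 2).
  { assert (H17 : (1 + p ^ 4) ^ 2 <= (17 * p ^ 4) ^ 2) by (apply pow_incr; lra).
    replace (/ 289 * / p ^ 4) with (p ^ 4 * / (17 * p ^ 4) ^ 2) by (field; lra).
    unfold Rdiv. apply Rmult_le_compat_l; [lra|]. apply Rinv_le_of; [apply pow_lt; lra|exact H17]. }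
  assert (B2 : (1 + p) * (1 + q) / (p ^ 3 * q ^ 3) <= 45 * / p ^ 4).
  { apply Rle_trans with (3 * p * (3 * q) / (p ^ 3 * q ^ 3)).
    - unfold Rdiv. apply Rmult_le_compat_r.
      + left. apply Rinv_0_lt_compat, Rmult_lt_0_compat; assumption.
      + apply Rmult_le_compat; lra.
    - replace (3 * p * (3 * q) / (p ^ 3 * q ^ 3)) with (9 * / p ^ 2 * / q ^ 2) by (field; lra).
      replace (45 * / p ^ 4) with (9 * / p ^ 2 * (5 * / p ^ 2)) by (field; lra).
      assert (0 < p ^ 2) by (apply pow_lt, Hp).
      apply Rmult_le_compat_l.
      + apply Rmult_le_pos; [lra|left; apply Rinv_0_lt_compat; assumption].
      + replace (5 * / p ^ 2) with (/ (p ^ 2 / 5)) by (field; lra). apply Rinv_le_of; lra. }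
  assert (0 < / p ^ 4) by (apply Rinv_0_lt_compat, Hp4). lra.
Qed.

(** The logarithm contributes the negative term -1/(L (1 + p^4)^2). It is paid for by half of the
    first curvature term, which is why the 32 here becomes 64 in [curvature_core]. *)
Lemma curvature_bound (p q L : R) : 0 < p -> 0 < q -> p ^ 2 <= q ^ 2 + 1 -> q ^ 2 <= p ^ 2 + 1 ->
  1 <= p ^ 2 + q ^ 2 -> 256 <= L ->
  / 20000 * ((1 + p) * (1 + q) / (p ^ 3 * q ^ 3 * L ^ 2)) <=
  / (32 * p ^ 3 * (1 + p) ^ 2) + / (32 * q ^ 3 * (1 + q) ^ 2) + (p ^ 4 - L) / ((1 + p ^ 4) ^ 2 * L ^ 2).
Proof.
  intros Hp Hq H1 H2 H3 HL.
  pose proof (curvature_core p q Hp Hq H1 H2 H3) as Hc.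
  assert (Hp3 : 0 < p ^ 3) by (apply pow_lt, Hp). assert (Hq3 : 0 < q ^ 3) by (apply pow_lt, Hq).
  assert (Hp4 : 0 < p ^ 4) by (apply pow_lt, Hp).
  set (a := / (64 * p ^ 3 * (1 + p) ^ 2)) in *. set (b := / (64 * q ^ 3 * (1 + q) ^ 2)) in *.
  set (c := p ^ 4 / (1 + p ^ 4) ^ 2) in *.
  assert (Hden : 0 < 64 * p ^ 3 * (1 + p) ^ 2) by (apply Rmult_lt_0_compat; [lra|apply pow_lt; lra]).
  assert (Ha : 0 < a) by (apply Rinv_0_lt_compat, Hden).
  assert (Hb : 0 < b) by (apply Rinv_0_lt_compat, Rmult_lt_0_compat; [lra|apply pow_lt; lra]).
  assert (E1 : / (32 * p ^ 3 * (1 + p) ^ 2) = 2 * a) by (unfold a; field; lra).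
  assert (E2 : / (32 * q ^ 3 * (1 + q) ^ 2) = 2 * b) by (unfold b; field; lra).
  assert (E3 : (p ^ 4 - L) / ((1 + p ^ 4) ^ 2 * L ^ 2) = c * / L ^ 2 - / (L * (1 + p ^ 4) ^ 2))
    by (unfold c; field; lra).
  assert (Hneg : / (L * (1 + p ^ 4) ^ 2) <= a).
  { apply Rinv_le_of; [exact Hden|].
    (* Multiplied by 64, this is what is asked for as soon as L >= 64 times 4; hence the constant
       256 in [Lw]. *)
    assert (Hpoly : p ^ 3 * (1 + p) ^ 2 <= 4 * (1 + p ^ 4) ^ 2).
    { destruct (Rle_dec p 1) as [L1|L1].
      - assert (p ^ 3 <= 1) by (rewrite <- (pow1 3); apply pow_incr; lra).
        assert ((1 + p) ^ 2 <= 4) by nra.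
        assert (1 <= (1 + p ^ 4) ^ 2) by nra.
        assert (0 < (1 + p) ^ 2) by (apply pow_lt; lra). nra.
      - assert ((1 + p) ^ 2 <= 4 * p ^ 2) by nra.
        assert (p ^ 3 * (1 + p) ^ 2 <= p ^ 3 * (4 * p ^ 2)) by (apply Rmult_le_compat_l; lra).
        assert (p ^ 5 <= p ^ 8) by (apply Rle_pow; [lra|lia]).
        replace (p ^ 3 * (4 * p ^ 2)) with (4 * p ^ 5) in * by ring.
        replace ((1 + p ^ 4) ^ 2) with (1 + 2 * p ^ 4 + p ^ 8) by ring. lra. }
    assert (0 < (1 + p ^ 4) ^ 2) by (apply pow_lt; lra). nra. }
  assert (Hi : 0 < / L ^ 2 <= 1).
  { split; [apply Rinv_0_lt_compat, pow_lt; lra|]. rewrite <- Rinv_1. apply Rinv_le_of; [lra|nra]. }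
  replace (/ 20000 * ((1 + p) * (1 + q) / (p ^ 3 * q ^ 3 * L ^ 2)))
    with ((/ 20000 * ((1 + p) * (1 + q) / (p ^ 3 * q ^ 3))) * / L ^ 2) by (field; lra).
  rewrite E1, E2, E3.
  apply Rmult_le_compat_r with (r := / L ^ 2) in Hc; [|lra]. nra.
Qed.

Lemma punctured_plane_coordinates (w : C) : w <> 0%C -> w <> 1%C ->
  let p := qrt (modsq w) in let q := qrt (modsq (w - 1)%C) in
  0 < p /\ 0 < q /\ p ^ 2 <= q ^ 2 + 1 /\ q ^ 2 <= p ^ 2 + 1 /\ 1 <= p ^ 2 + q ^ 2 /\
  p ^ 4 = modsq w /\ q ^ 4 = modsq (w - 1)%C.
Proof.
  intros H0 H1 p q.
  assert (E : forall v, qrt (modsq v) ^ 2 = Cmod v).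
  { intros v. rewrite qrt_pow2, modsq_Cmod. apply sqrt_pow2, Cmod_ge_0. }
  assert (Hw1 : (w - 1)%C <> 0%C) by (intros E'; apply H1, Cminus_eq_0, E').
  unfold p, q. rewrite !E, !qrt_pow4 by apply modsq_ge_0.
  pose proof (Cmod_triangle_inv w 1%C) as T1. rewrite Cmod_1 in T1.
  pose proof (Cmod_triangle_minus w 1%C) as T2. rewrite Cmod_1 in T2.
  pose proof (Cmod_triangle_inv 1%C w) as T3. rewrite Cmod_1, (Cmod_minus_sym 1%C w) in T3.
  repeat split; try lra; apply qrt_pos, modsq_pos; assumption.
Qed.

(** * Ahlfors' lemma: the pulled back metric against the metric of a disc *)

Lemma rcont_at_mult (u v : C -> R) (z : C) : rcont_at u z -> rcont_at v z -> rcont_at (fun w => u w * v w) z.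
Proof.
  intros Hu Hv.
  assert (Hsq : forall f, rcont_at f z -> rcont_at (fun w => f w ^ 2) z).
  { intros f Hf. apply (rcont_at_comp (fun y => y ^ 2) f); [|exact Hf].
    apply derivable_continuous_pt, derivable_pt_pow. }
  assert (Hsc : forall k f, rcont_at f z -> rcont_at (fun w => k * f w) z).
  { intros k f Hf. apply (rcont_at_comp (fun y => k * y) f); [|exact Hf].
    apply derivable_continuous_pt, derivable_pt_scal, derivable_pt_id. }
  (* Polarisation reduces products to squares, which are compositions. *)
  replace (fun w => u w * v w) with (fun w => / 4 * ((u w + v w) ^ 2 + -1 * ((u w + -1 * v w) ^ 2)))
    by (apply functional_extensionality; intros; field).
  apply Hsc. apply rcont_at_plus.
  - apply Hsq, rcont_at_plus; assumption.
  - apply Hsc, Hsq, rcont_at_plus; [assumption|apply Hsc, Hv].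
Qed.

Lemma is_derive_continuity_pt (f : R -> R) (x l : R) : is_derive f x l -> continuity_pt f x.
Proof.
  intros H. apply continuity_pt_filterlim, (ex_derive_continuous f). eexists; exact H.
Qed.

(** Up to a constant factor, r divided by this weight is the Poincare density of the disc;
    multiplying by the weight compares a metric with the hyperbolic one and makes the product vanish
    on the boundary. *)
Definition disc_weight (c : C) (r : R) (w : C) : R := r ^ 2 - modsq (w - c)%C.

Definition pullback_density (f : C -> C) (c : C) (r : R) (w : C) : R :=
  rho2 (f w) * modsq (D f w) * disc_weight c r w ^ 2.

Definition half_log_density (f : C -> C) (c : C) (r : R) (w : C) : R :=
  tm (modsq (f w)) + tl (modsq (f w)) + tm (modsq (f w - 1)%C) + / 2 * ln (modsq (D f w))
  + ln (disc_weight c r w).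

Lemma entire_minus_one (f : C -> C) : entire f -> entire (fun w => f w - 1)%C.
Proof. intros Hf. apply entire_minus; [exact Hf|apply entire_const]. Qed.

Lemma omitting_modsq_pos (f : C -> C) (c : C) (r : R) (w : C) :
  (forall w, Cmod (w - c) <= r -> f w <> 0%C /\ f w <> 1%C) ->
  Cmod (w - c) <= r -> 0 < modsq (f w) /\ 0 < modsq (f w - 1)%C.
Proof.
  intros Homit Hw. destruct (Homit w Hw) as [H0 H1]. split; apply modsq_pos; [exact H0|].
  intros E. apply H1, Cminus_eq_0, E.
Qed.

Lemma pullback_density_cont (f : C -> C) (c : C) (r : R) (z : C) : entire f ->
  (forall w, Cmod (w - c) <= r -> f w <> 0%C /\ f w <> 1%C) ->
  Cmod (z - c) <= r -> rcont_at (pullback_density f c r) z.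
Proof.
  intros Hf Homit Hz. destruct (omitting_modsq_pos f c r z Homit Hz) as [HP HQ].
  pose proof (rcont_at_modsq f z (entire_ccont f z Hf)) as C1.
  pose proof (rcont_at_modsq _ z (entire_ccont _ z (entire_minus_one f Hf))) as C2.
  unfold pullback_density, rho2. apply rcont_at_mult; [apply rcont_at_mult|].
  - apply (rcont_at_comp (fun y => exp (2 * y)) (fun w => tm (modsq (f w)) + tl (modsq (f w)) + tm (modsq (f w - 1)%C))).
    + apply is_derive_continuity_pt with (2 * exp (2 * (tm (modsq (f z)) + tl (modsq (f z)) + tm (modsq (f z - 1)%C)))).
      auto_derive; [exact I|ring].
    + apply rcont_at_plus; [apply rcont_at_plus|].
      * apply (rcont_at_comp tm (fun w => modsq (f w))); [|exact C1].
        eapply is_derive_continuity_pt, is_derive_tm, HP.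
      * apply (rcont_at_comp tl (fun w => modsq (f w))); [|exact C1].
        eapply is_derive_continuity_pt, is_derive_tl. lra.
      * apply (rcont_at_comp tm (fun w => modsq (f w - 1)%C)); [|exact C2].
        eapply is_derive_continuity_pt, is_derive_tm, HQ.
  - apply rcont_at_modsq, entire_ccont, entire_D, Hf.
  - assert (Hw : rcont_at (disc_weight c r) z).
    { unfold disc_weight. apply (rcont_at_comp (fun y => r ^ 2 - y) (fun w => modsq (w - c)%C)).
      - apply is_derive_continuity_pt with (- 1). auto_derive; [exact I|ring].
      - apply rcont_at_modsq, entire_ccont, entire_minus_const. }
    apply (rcont_at_comp (fun y => y ^ 2) (disc_weight c r)); [|exact Hw].
    apply derivable_continuous_pt, derivable_pt_pow.
Qed.

Lemma pullback_density_exp (f : C -> C) (c : C) (r : R) (w : C) :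
  D f w <> 0%C -> 0 < disc_weight c r w -> pullback_density f c r w = exp (2 * half_log_density f c r w).
Proof.
  intros H1 H2. unfold pullback_density, half_log_density, rho2.
  rewrite (Rmult_plus_distr_l 2 _ (ln (disc_weight c r w))), (Rmult_plus_distr_l 2 _ (/ 2 * _)).
  rewrite !exp_plus.
  replace (2 * (/ 2 * ln (modsq (D f w)))) with (ln (modsq (D f w))) by field.
  replace (2 * ln (disc_weight c r w)) with (ln (disc_weight c r w ^ 2)) by (rewrite ln_pow by exact H2; simpl INR; ring).
  rewrite !exp_ln; [reflexivity|apply pow_lt, H2|apply modsq_pos, H1].
Qed.

Lemma D_minus_one (f : C -> C) (z : C) : entire f -> D (fun w => f w - 1)%C z = D f z.
Proof.
  intros Hf. apply D_eq. replace (D f z) with (D f z - 0)%C by ring.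
  apply cderiv_minus; [apply D_spec, Hf|apply cderiv_const].
Qed.

(** Of the five summands, ln |f'| is harmonic off the zeros of f', and the weight contributes the
    last, negative term; the other three give the curvature terms in p, q and L. *)
Lemma half_log_density_laplacian (f : C -> C) (c : C) (r : R) (z : C) : entire f ->
  (forall w, Cmod (w - c) <= r -> f w <> 0%C /\ f w <> 1%C) ->
  Cmod (z - c) <= r -> D f z <> 0%C -> 0 < disc_weight c r z ->
  let p := qrt (modsq (f z)) in let q := qrt (modsq (f z - 1)%C) in let L := Lw (modsq (f z)) in
  laplacian (half_log_density f c r) z (4 * modsq (D f z) * (/ (32 * p ^ 3 * (1 + p) ^ 2) + / (32 * q ^ 3 * (1 + q) ^ 2)
      + (p ^ 4 - L) / ((1 + p ^ 4) ^ 2 * L ^ 2)) - 4 * r ^ 2 / disc_weight c r z ^ 2).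
Proof.
  intros Hf Homit Hz HD Hw p q L. destruct (omitting_modsq_pos f c r z Homit Hz) as [HP HQ].
  destruct (Homit z Hz) as [H0 H1].
  destruct (punctured_plane_coordinates (f z) H0 H1) as [Pp [Pq [_ [_ [_ [E4 E4']]]]]]. fold p q in Pp, Pq, E4, E4'.
  pose proof (Lw_ge (modsq (f z)) (modsq_ge_0 _)) as HL. fold L in HL.
  pose proof (modsq_pos _ HD) as HD2.
  assert (HX : 0 <= modsq (z - c)%C) by apply modsq_ge_0.
  assert (L1 := laplacian_modsq f tm tm1 (tm2 (modsq (f z))) (modsq (f z)) z Hf HP).
  assert (L2 := laplacian_modsq f tl tl1 (tl2 (modsq (f z))) (modsq (f z)) z Hf HP).
  assert (L3 := laplacian_modsq _ tm tm1 (tm2 (modsq (f z - 1)%C)) (modsq (f z - 1)%C) z (entire_minus_one f Hf) HQ).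
  assert (L4 := laplacian_modsq (D f) (fun X => / 2 * ln X) (fun X => / (2 * X)) (- / (2 * modsq (D f z) ^ 2))
     (modsq (D f z)) z (entire_D f Hf) HD2).
  assert (L5 := laplacian_modsq (fun w => w - c)%C (fun X => ln (r ^ 2 - X)) (fun X => - / (r ^ 2 - X))
     (- / disc_weight c r z ^ 2) (disc_weight c r z) z (entire_minus_const c) Hw).
  rewrite D_minus_const in L5. rewrite D_minus_one in L3 by exact Hf. simpl in L3.
  assert (Hnear : forall Y X, Rabs (X - Y) < Y -> 0 < X) by (intros Y X HX'; apply Rabs_lt_between in HX'; lra).
  specialize (L1 ltac:(intros X HX'; apply is_derive_tm, (Hnear _ _ HX')) (is_derive_tm1 _ HP)).
  specialize (L2 ltac:(intros X HX'; apply is_derive_tl; pose proof (Hnear _ _ HX'); lra)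
    ltac:(apply is_derive_tl1; lra)).
  specialize (L3 ltac:(intros X HX'; apply is_derive_tm, (Hnear _ _ HX')) (is_derive_tm1 _ HQ)).
  assert (K4 : laplacian (fun w => / 2 * ln (modsq (D f w))) z 0).
  { refine (eq_ind _ (fun l => laplacian (fun w => / 2 * ln (modsq (D f w))) z l) (L4 _ _) _ _).
    - intros X HX'. pose proof (Hnear _ _ HX'). auto_derive; [lra|field; lra].
    - auto_derive; [lra|field; lra].
    - field. lra. }
  assert (K5 : laplacian (fun w => ln (disc_weight c r w)) z (- 4 * r ^ 2 / disc_weight c r z ^ 2)).
  { refine (eq_ind _ (fun l => laplacian (fun w => ln (disc_weight c r w)) z l) (L5 _ _) _ _).
    - intros X HX'. unfold disc_weight in HX'. apply Rabs_lt_between in HX'. auto_derive; [lra|field; lra].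
    - unfold disc_weight in *. auto_derive; [lra|field; lra].
    - unfold disc_weight in *. unfold modsq at 1. simpl. field. lra. }
  pose proof (laplacian_plus _ _ _ _ _ (laplacian_plus _ _ _ _ _
    (laplacian_plus _ _ _ _ _ (laplacian_plus _ _ _ _ _ L1 L2) L3) K4) K5) as Lall.
  refine (eq_ind _ (fun l => laplacian (half_log_density f c r) z l) Lall _ _).
  unfold tm1, tm2, tl1, tl2. fold p q L. rewrite <- E4, <- E4'.
  assert (Hw0 : disc_weight c r z <> 0) by lra.
  assert (1 + p ^ 4 <> 0) by (pose proof (pow_lt p 4 Pp); lra).
  field. repeat split; lra.
Qed.

Theorem ahlfors (f : C -> C) (c : C) (r : R) (w : C) : entire f -> 0 < r ->
  (forall w, Cmod (w - c) <= r -> f w <> 0%C /\ f w <> 1%C) ->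
  Cmod (w - c) <= r ->
  rho2 (f w) * modsq (D f w) * (r ^ 2 - modsq (w - c)%C) ^ 2 <= 20000 * r ^ 2.
Proof.
  intros Hf Hr Homit. set (m := pullback_density f c r). set (u := half_log_density f c r).
  destruct (usc_attains_max c r m) as [z0 [Hz0 Hmax]]; [lra|apply rcont_at_usc; intros z; apply pullback_density_cont; assumption|].
  intros Hw. apply Rle_trans with (m z0); [apply (Hmax w Hw)|].
  assert (Hr2 : 0 < r ^ 2) by (apply pow_lt, Hr).
  (* When the maximum is positive, f'(z0) is nonzero and z0 lies inside the disc, so the logarithm
     of the density is available near z0. *)
  destruct (Rle_dec (m z0) 0) as [Hm0|Hm0]; [lra|].
  assert (HD : D f z0 <> 0%C).
  { intros E. apply Hm0. unfold m, pullback_density. rewrite E. right. unfold modsq, RtoC; simpl. ring. }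
  assert (Hlt : Cmod (z0 - c) < r).
  { destruct (Rle_lt_or_eq_dec _ _ Hz0) as [H|H]; [exact H|]. exfalso. apply Hm0.
    unfold m, pullback_density, disc_weight. rewrite (modsq_Cmod (z0 - c)%C), H. right. ring. }
  assert (Hwpos : forall v, Cmod (v - c) < r -> 0 < disc_weight c r v).
  { intros v Hv. unfold disc_weight. rewrite modsq_Cmod. pose proof (Cmod_ge_0 (v - c)). nra. }
  destruct (D_ccont f z0 Hf (Cmod (D f z0))) as [d [Hd Hcd]]; [apply Cmod_gt_0, HD|].
  pose proof (half_log_density_laplacian f c r z0 Hf Homit Hz0 HD (Hwpos z0 Hlt)) as Hlap. simpl in Hlap.
  set (p := qrt (modsq (f z0))) in *. set (q := qrt (modsq (f z0 - 1)%C)) in *.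
  set (L := Lw (modsq (f z0))) in *.
  apply (laplacian_local_max _ _ _ (Rmin d (r - Cmod (z0 - c)))) in Hlap.
  - destruct (Homit z0 Hz0) as [H0 H1].
    destruct (punctured_plane_coordinates (f z0) H0 H1) as [Pp [Pq [Q1 [Q2 [Q3 [E4 E4']]]]]].
    fold p q in Pp, Pq, Q1, Q2, Q3, E4, E4'.
    pose proof (curvature_bound p q L Pp Pq Q1 Q2 Q3 (Lw_ge _ (modsq_ge_0 _))) as Hcur.
    pose proof (rho2_eq (f z0) H0 H1) as Erho. simpl in Erho. fold p q L in Erho.
    change (p * (p * (p * 1))) with (p ^ 3) in Erho. change (q * (q * (q * 1))) with (q ^ 3) in Erho.
    change (L * (L * 1)) with (L ^ 2) in Erho.
    rewrite <- Erho in Hcur.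
    match type of Hcur with _ <= ?s => set (S := s) in * end.
    change (4 * modsq (D f z0) * S - 4 * r ^ 2 / disc_weight c r z0 ^ 2 <= 0) in Hlap.
    pose proof (Hwpos z0 Hlt) as Hw0. assert (Hw2 : 0 < disc_weight c r z0 ^ 2) by (apply pow_lt, Hw0).
    assert (B : modsq (D f z0) * S * disc_weight c r z0 ^ 2 <= r ^ 2).
    { apply Rmult_le_reg_r with (/ disc_weight c r z0 ^ 2); [apply Rinv_0_lt_compat, Hw2|].
      rewrite Rmult_assoc, Rinv_r, Rmult_1_r by lra. fold (r ^ 2 / disc_weight c r z0 ^ 2). lra. }
    unfold m, pullback_density. pose proof (modsq_ge_0 (D f z0)) as HM.
    assert (B2 : modsq (D f z0) * disc_weight c r z0 ^ 2 * (/ 20000 * rho2 (f z0)) <= modsq (D f z0) * disc_weight c r z0 ^ 2 * S).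
    { apply Rmult_le_compat_l; [|exact Hcur]. apply Rmult_le_pos; lra. }
    lra.
  - apply Rmin_pos; lra.
  - intros v Hv.
    assert (Hv1 : Cmod (v - z0) < d) by (eapply Rlt_le_trans; [exact Hv|apply Rmin_l]).
    assert (Hv2 : Cmod (v - c) < r).
    { assert (Cmod (v - z0) < r - Cmod (z0 - c)) by (eapply Rlt_le_trans; [exact Hv|apply Rmin_r]).
      pose proof (Cmod_minus_triangle v z0 c). lra. }
    assert (HDv : D f v <> 0%C).
    { intros E. specialize (Hcd v Hv1). rewrite E in Hcd.
      replace (0 - D f z0)%C with (- D f z0)%C in Hcd by ring. rewrite Cmod_opp in Hcd. lra. }
    assert (Hmv : m v <= m z0) by (apply Hmax; lra).
    unfold m in Hmv. rewrite !pullback_density_exp in Hmv by auto. fold u in Hmv.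
    apply Rnot_lt_le. intros Hu. change (u z0 < u v) in Hu. assert (2 * u z0 < 2 * u v) by lra. apply exp_increasing in H. lra.
Qed.

(** * The theorems of Schottky, Picard and Montel *)

(** The left side is the square of the derivative of ln(256 + ln(1 + x^2)) at x = |w|. So the
    logarithm of [Lw] is Lipschitz for the metric, and as it is unbounded, infinity lies at infinite
    distance. *)
Lemma rho2_complete_at_infinity (w : C) : w <> 0%C -> w <> 1%C ->
  (2 * Cmod w / ((1 + modsq w) * Lw (modsq w))) ^ 2 <= 8 * rho2 w.
Proof.
  intros H0 H1. destruct (punctured_plane_coordinates w H0 H1) as [Pp [Pq [Q1 [Q2 [Q3 [E4 E4']]]]]].
  rewrite rho2_eq by assumption. simpl in *.
  pose proof (Lw_ge _ (modsq_ge_0 w)) as HL.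
  set (p := qrt (modsq w)) in *. set (q := qrt (modsq (w - 1)%C)) in *. set (L := Lw (modsq w)) in *.
  assert (EC : Cmod w = p ^ 2).
  { unfold p. rewrite qrt_pow2, modsq_Cmod. symmetry. apply sqrt_pow2, Cmod_ge_0. }
  change (p * (p * (p * (p * 1)))) with (p ^ 4) in E4. rewrite EC, <- E4.
  change (p * (p * (p * 1))) with (p ^ 3). change (q * (q * (q * 1))) with (q ^ 3).
  change (L * (L * 1)) with (L ^ 2).
  assert (Hp3 : 0 < p ^ 3) by (apply pow_lt, Pp). assert (Hq3 : 0 < q ^ 3) by (apply pow_lt, Pq).
  assert (Hp4 : 0 < p ^ 4) by (apply pow_lt, Pp).
  assert (Hpoly : p ^ 4 * (p ^ 3 * q ^ 3) <= 2 * ((1 + p) * (1 + q)) * (1 + p ^ 4) ^ 2).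
  { assert (Hq : q ^ 3 <= (1 + q) * (1 + p ^ 2)).
    { replace (q ^ 3) with (q * q ^ 2) by ring. apply Rmult_le_compat; nra. }
    assert (Hp : p ^ 7 * (1 + p ^ 2) <= 2 * (1 + p) * (1 + p ^ 4) ^ 2).
    { replace (p ^ 7 * (1 + p ^ 2)) with (p ^ 7 + p * p ^ 8) by ring.
      replace ((1 + p ^ 4) ^ 2) with (1 + 2 * p ^ 4 + p ^ 8) by ring.
      assert (0 < p ^ 8) by (apply pow_lt, Pp).
      assert (p ^ 7 <= 1 + p ^ 8).
      { destruct (Rle_dec p 1) as [L1|L1].
        - assert (p ^ 7 <= 1) by (rewrite <- (pow1 7); apply pow_incr; lra). lra.
        - assert (p ^ 7 <= p ^ 8) by (apply Rle_pow; [lra|lia]). lra. }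
      nra. }
    assert (0 < p ^ 7) by (apply pow_lt, Pp).
    replace (p ^ 4 * (p ^ 3 * q ^ 3)) with (p ^ 7 * q ^ 3) by ring.
    apply Rle_trans with (p ^ 7 * ((1 + q) * (1 + p ^ 2))); [apply Rmult_le_compat_l; lra|].
    replace (p ^ 7 * ((1 + q) * (1 + p ^ 2))) with ((1 + q) * (p ^ 7 * (1 + p ^ 2))) by ring.
    replace (2 * ((1 + p) * (1 + q)) * (1 + p ^ 4) ^ 2) with ((1 + q) * (2 * (1 + p) * (1 + p ^ 4) ^ 2)) by ring.
    apply Rmult_le_compat_l; lra. }
  assert (HL2 : 0 < L ^ 2) by (apply pow_lt; lra).
  assert (H14 : 0 < (1 + p ^ 4) ^ 2) by (apply pow_lt; lra).
  set (K := p ^ 3 * q ^ 3 * L ^ 2 * (1 + p ^ 4) ^ 2).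
  assert (HK : 0 < K) by (unfold K; apply Rmult_lt_0_compat; [apply Rmult_lt_0_compat; [apply Rmult_lt_0_compat|]|]; assumption).
  apply Rmult_le_reg_r with K; [exact HK|].
  replace ((2 * p ^ 2 / ((1 + p ^ 4) * L)) * ((2 * p ^ 2 / ((1 + p ^ 4) * L)) * 1) * K)
    with (4 * (p ^ 4 * (p ^ 3 * q ^ 3))) by (unfold K; field; lra).
  replace (8 * ((1 + p) * (1 + q) / (p ^ 3 * q ^ 3 * L ^ 2)) * K)
    with (8 * ((1 + p) * (1 + q)) * (1 + p ^ 4) ^ 2) by (unfold K; field; lra).
  lra.
Qed.

Lemma log_Lw_derive (f : C -> C) (c v : C) (t : R) : entire f ->
  let w := (c + RtoC t * v)%C in
  exists l, is_derive (fun s : R => ln (Lw (modsq (f (c + RtoC s * v)%C)))) t l /\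
    Rabs l <= 2 * Cmod (f w) / ((1 + modsq (f w)) * Lw (modsq (f w))) * (Cmod (D f w) * Cmod v).
Proof.
  intros Hf w.
  set (F := fun s => fst (f (c + RtoC s * v)%C)). set (G := fun s => snd (f (c + RtoC s * v)%C)).
  set (a := (D f w * v)%C).
  assert (HF : is_derive F t (fst a)) by (apply line_derive_fst, D_spec, Hf).
  assert (HG : is_derive G t (snd a)) by (apply line_derive_snd, D_spec, Hf).
  pose proof (Lw_ge _ (modsq_ge_0 (f w))) as HL. pose proof (modsq_ge_0 (f w)) as HX.
  set (X1 := 2 * (fst (f w) * fst a + snd (f w) * snd a)).
  exists (X1 / ((1 + modsq (f w)) * Lw (modsq (f w)))). split.
  - change (is_derive (fun s => ln (256 + ln (1 + (F s ^ 2 + G s ^ 2)))) t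
      (X1 / ((1 + modsq (f w)) * Lw (modsq (f w))))).
    change (256 <= 256 + ln (1 + (F t ^ 2 + G t ^ 2))) in HL.
    change (0 <= F t ^ 2 + G t ^ 2) in HX.
    auto_derive.
    + repeat split; try (eexists; eassumption).
      * simpl in HX. lra.
      * simpl in HL. lra.
    + replace (Derive (fun x : R => F x) t) with (fst a) by (symmetry; apply is_derive_unique, HF).
      replace (Derive (fun x : R => G x) t) with (snd a) by (symmetry; apply is_derive_unique, HG).
      change (X1 / ((1 + modsq (f w)) * Lw (modsq (f w))))
        with (2 * (F t * fst a + G t * snd a) / ((1 + (F t ^ 2 + G t ^ 2)) * (256 + ln (1 + (F t ^ 2 + G t ^ 2))))).
      simpl in *. field. lra.
  - assert (HX1 : Rabs X1 <= 2 * (Cmod (f w) * Cmod a)).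
    { unfold X1. rewrite Rabs_mult, (Rabs_pos_eq 2) by lra. apply Rmult_le_compat_l; [lra|].
      (* Writing the inner product as the real part of f(w) times the conjugate of [a] gives the
         Cauchy-Schwarz inequality from multiplicativity of the modulus. *)
      replace (fst (f w) * fst a + snd (f w) * snd a) with (fst (f w * Cconj a)%C)
        by (unfold Cmult, Cconj; simpl; ring).
      rewrite <- (Cmod_conj a), <- Cmod_mult. apply fst_le_Cmod. }
    assert (Hd : 0 < (1 + modsq (f w)) * Lw (modsq (f w))) by (apply Rmult_lt_0_compat; lra).
    unfold Rdiv. rewrite Rabs_mult, Rabs_inv, (Rabs_pos_eq ((1 + modsq (f w)) * Lw (modsq (f w)))) by lra.
    unfold a in HX1. rewrite Cmod_mult in HX1.
    apply Rle_trans with (2 * (Cmod (f w) * (Cmod (D f w) * Cmod v)) * / ((1 + modsq (f w)) * Lw (modsq (f w)))).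
    + apply Rmult_le_compat_r; [left; apply Rinv_0_lt_compat, Hd|exact HX1].
    + right. ring.
Qed.

(** Along the segment from c to z the derivative of the logarithm of [Lw] is at most a constant
    times the speed in the pulled back metric, which [ahlfors] bounds; the mean value theorem
    integrates this. *)
Lemma log_Lw_bound (f : C -> C) (c z : C) (R0 : R) : entire f -> 0 < R0 ->
  (forall w, Cmod (w - c) < R0 -> f w <> 0%C /\ f w <> 1%C) -> Cmod (z - c) <= R0 / 2 ->
  ln (Lw (modsq (f z))) <= ln (Lw (modsq (f c))) + 480.
Proof.
  intros Hf HR Homit Hz. set (r := 3 * R0 / 4).
  assert (Hr : 0 < r) by (unfold r; lra).
  assert (Hom : forall w, Cmod (w - c) <= r -> f w <> 0%C /\ f w <> 1%C).
  { intros w Hw. apply Homit. unfold r in Hw. lra. }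
  pose proof (fun w => ahlfors f c r w Hf Hr Hom) as Hahl.
  set (v := (z - c)%C) in *.
  set (phi := fun s : R => ln (Lw (modsq (f (c + RtoC s * v)%C)))).
  assert (Hder : forall t, exists l, is_derive phi t l /\ (0 <= t <= 1 -> Rabs l <= 480)).
  { intros t. destruct (log_Lw_derive f c v t Hf) as [l [Hl Hb]]. exists l. split; [exact Hl|]. intros Ht.
    set (w := (c + RtoC t * v)%C) in *.
    assert (Hwc : Cmod (w - c) <= R0 / 2).
    { unfold w. replace (c + RtoC t * v - c)%C with (RtoC t * v)%C by ring.
      rewrite Cmod_mult, Cmod_R, Rabs_pos_eq by lra. pose proof (Cmod_ge_0 v). nra. }
    assert (Hwr : Cmod (w - c) <= r) by (unfold r; lra).
    specialize (Hahl w Hwr). destruct (Hom w Hwr) as [H0 H1].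
    pose proof (rho2_complete_at_infinity (f w) H0 H1) as Hrho.
    set (a := 2 * Cmod (f w) / ((1 + modsq (f w)) * Lw (modsq (f w)))) in *.
    rewrite (modsq_Cmod (D f w)), (modsq_Cmod (w - c)%C) in Hahl.
    pose proof (Cmod_ge_0 (w - c)) as Hwc0. pose proof (Cmod_ge_0 v) as Hv0.
    set (W := r ^ 2 - Cmod (w - c) ^ 2) in *.
    assert (HW : 5 / 16 * R0 ^ 2 <= W) by (unfold W, r; nra).
    assert (HR2 : 0 < R0 ^ 2) by (apply pow_lt, HR).
    set (b := Cmod (D f w)) in *. assert (Hb0 : 0 <= b) by apply Cmod_ge_0.
    (* With r = 3 R0 / 4 the weight is at least 5 R0^2 / 16, and 8 * 20000 * (9/16) * (256/25) / 4 =
       480^2. *)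
    assert (Hsq : l ^ 2 <= 480 ^ 2).
    { rewrite <- (pow2_abs l).
      apply Rle_trans with ((a * (b * Cmod v)) ^ 2); [apply pow_incr; split; [apply Rabs_pos|exact Hb]|].
      assert (Hrp : 0 <= rho2 (f w)) by (left; apply exp_pos).
      assert (Hab : (a * b) ^ 2 * W ^ 2 <= 8 * (20000 * r ^ 2)).
      { apply Rle_trans with (8 * rho2 (f w) * b ^ 2 * W ^ 2); [|lra].
        rewrite Rpow_mult_distr. apply Rmult_le_compat_r; [apply pow2_ge_0|].
        apply Rmult_le_compat_r; [apply pow2_ge_0|exact Hrho]. }
      assert (HW2 : (5 / 16 * R0 ^ 2) ^ 2 <= W ^ 2) by (apply pow_incr; lra).
      assert (Hab2 : (a * b) ^ 2 * (5 / 16 * R0 ^ 2) ^ 2 <= 8 * (20000 * r ^ 2)).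
      { eapply Rle_trans; [|exact Hab]. apply Rmult_le_compat_l; [apply pow2_ge_0|exact HW2]. }
      assert (Hv2 : Cmod v ^ 2 <= (R0 / 2) ^ 2) by (apply pow_incr; lra).
      assert (Hab3 : (a * b) ^ 2 * R0 ^ 2 <= 8 * 20000 * (9 / 16) * (256 / 25)).
      { apply Rmult_le_reg_r with (25 / 256 * R0 ^ 2); [lra|]. unfold r in Hab2.
        replace ((a * b) ^ 2 * R0 ^ 2 * (25 / 256 * R0 ^ 2)) with ((a * b) ^ 2 * (5 / 16 * R0 ^ 2) ^ 2) by field.
        eapply Rle_trans; [exact Hab2|]. right. field. }
      replace ((a * (b * Cmod v)) ^ 2) with ((a * b) ^ 2 * Cmod v ^ 2) by ring.
      apply Rle_trans with ((a * b) ^ 2 * (R0 / 2) ^ 2).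
      - apply Rmult_le_compat_l; [apply pow2_ge_0|exact Hv2].
      - replace ((a * b) ^ 2 * (R0 / 2) ^ 2) with ((a * b) ^ 2 * R0 ^ 2 / 4) by field. lra. }
    apply Rabs_le. split; nra. }
  apply choice in Hder. destruct Hder as [dphi Hd].
  destruct (MVT_gen phi 0 1 dphi) as [t [Ht Et]].
  { intros x _. apply Hd. }
  { intros x _. apply is_derive_continuity_pt with (dphi x), Hd. }
  rewrite Rmin_left, Rmax_right in Ht by lra.
  destruct (Hd t) as [_ Hb]. specialize (Hb Ht). apply Rabs_le_between in Hb.
  unfold phi in Et. replace (c + RtoC 1 * v)%C with z in Et by (unfold v; ring).
  replace (c + RtoC 0 * v)%C with c in Et by ring. lra.
Qed.

Theorem schottky (M : R) : exists M', forall (f : C -> C) (c z : C) (R0 : R), entire f -> 0 < R0 ->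
  (forall w, Cmod (w - c) < R0 -> f w <> 0%C /\ f w <> 1%C) -> Cmod (f c) <= M ->
  Cmod (z - c) <= R0 / 2 -> Cmod (f z) <= M'.
Proof.
  (* [B] will bound [Lw (modsq (f z))], so exp B bounds |f(z)|^2, and a number whose square is at
     most exp B is at most 1 + exp B. *)
  set (B := Lw (M ^ 2) * exp 480). exists (1 + exp B). intros f c z R0 Hf HR Homit Hc Hz.
  pose proof (log_Lw_bound f c z R0 Hf HR Homit Hz) as H.
  pose proof (Lw_ge _ (modsq_ge_0 (f c))) as HLc. pose proof (Lw_ge _ (modsq_ge_0 (f z))) as HLz.
  assert (H1 : Lw (modsq (f z)) <= Lw (modsq (f c)) * exp 480).
  { rewrite <- (exp_ln (Lw (modsq (f z)))), <- (exp_ln (Lw (modsq (f c)))) by lra.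
    rewrite <- exp_plus. destruct H as [H|H]; [left; apply exp_increasing, H|right; rewrite H; reflexivity]. }
  pose proof (modsq_ge_0 (f c)) as Hmc. pose proof (modsq_ge_0 (f z)) as Hmz.
  assert (Hmono : modsq (f c) <= M ^ 2).
  { rewrite modsq_Cmod. apply pow_incr. split; [apply Cmod_ge_0|exact Hc]. }
  assert (H2 : Lw (modsq (f c)) <= Lw (M ^ 2)).
  { unfold Lw. apply Rplus_le_compat_l. destruct Hmono as [Hm|Hm]; [|rewrite Hm; lra].
    left. apply ln_increasing; lra. }
  assert (H3 : Lw (modsq (f z)) <= B).
  { eapply Rle_trans; [exact H1|]. apply Rmult_le_compat_r; [left; apply exp_pos|exact H2]. }
  unfold Lw in H3 at 1.
  assert (H4 : modsq (f z) <= exp B).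
  { assert (1 + modsq (f z) < exp B); [|lra].
    rewrite <- (exp_ln (1 + modsq (f z))) by lra. apply exp_increasing. lra. }
  rewrite modsq_Cmod in H4. pose proof (exp_pos B). pose proof (Cmod_ge_0 (f z)).
  apply Rnot_lt_le. intros Hlt. nra.
Qed.

Definition omits_on (f : C -> C) (c : C) (r : R) (a b : C) : Prop :=
  forall w, Cmod (w - c) < r -> f w <> a /\ f w <> b.

(** The affine map sending a, b to 0, 1 reduces this to the previous theorem. Uniformity in a and b
    matters: in the covering argument the omitted values move with the radius. *)
Theorem schottky_two_values (M d : R) : 0 < d ->
  exists M', forall (f : C -> C) (a b c z : C) (R0 : R), entire f -> 0 < R0 ->
  Cmod a <= M -> Cmod b <= M -> d <= Cmod (b - a) -> omits_on f c R0 a b ->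
  Cmod (f c) <= M -> Cmod (z - c) <= R0 / 2 -> Cmod (f z) <= M'.
Proof.
  intros Hd. destruct (schottky (2 * M / d)) as [M1 HM1]. exists (M + 2 * M * M1).
  intros f a b c z R0 Hf HR Ha Hb Hab Homit Hc Hz.
  assert (Hne : (b - a)%C <> 0%C) by (apply Cmod_gt_0; lra).
  set (F := fun w => (/ (b - a) * (f w - a))%C).
  assert (HF : entire F).
  { apply entire_mult; [apply entire_const|]. apply entire_minus; [exact Hf|apply entire_const]. }
  assert (HFz : Cmod (F z) <= M1).
  { apply (HM1 F c z R0 HF HR).
    - intros w Hw. destruct (Homit w Hw) as [H0 H1]. unfold F. split; intros E.
      + apply H0, Cminus_eq_0. replace (f w - a)%C with ((b - a) * (/ (b - a) * (f w - a)))%C by (field; exact Hne).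
        rewrite E. ring.
      + apply H1, Cminus_eq_0.
        replace (f w - b)%C with ((b - a) * (/ (b - a) * (f w - a)) - (b - a))%C by (field; exact Hne).
        rewrite E. ring.
    - unfold F. rewrite Cmod_mult, Cmod_inv by exact Hne.
      pose proof (Cmod_triangle_minus (f c) a). pose proof (Cmod_ge_0 (f c - a)).
      apply Rle_trans with (/ d * (2 * M)); [|right; unfold Rdiv; ring].
      apply Rmult_le_compat; [left; apply Rinv_0_lt_compat; lra|assumption|apply Rinv_le_contravar; lra|lra].
    - exact Hz. }
  replace (f z) with (a + (b - a) * F z)%C by (unfold F; field; exact Hne).
  eapply Rle_trans; [apply Cmod_triangle|]. rewrite Cmod_mult.
  pose proof (Cmod_triangle_minus b a). pose proof (Cmod_ge_0 (F z)). pose proof (Cmod_ge_0 (b - a)).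
  apply Rplus_le_compat; [exact Ha|]. apply Rmult_le_compat; lra.
Qed.

(** Schottky's bound does not depend on the radius, so it bounds f on the whole plane, and
    Liouville's theorem applies. *)
Theorem picard (f : C -> C) (a b : C) : entire f -> a <> b ->
  (forall z, f z <> a /\ f z <> b) -> forall z w, f z = f w.
Proof.
  intros Hf Hab Homit.
  assert (Hd : 0 < Cmod (b - a)).
  { apply Cmod_gt_0. intros E. apply Hab. symmetry. apply Cminus_eq_0, E. }
  set (M := Cmod a + Cmod b + Cmod (f 0%C)).
  pose proof (Cmod_ge_0 a). pose proof (Cmod_ge_0 b). pose proof (Cmod_ge_0 (f 0%C)).
  destruct (schottky_two_values M _ Hd) as [M' HM']. apply liouville with M'; [exact Hf|]. intros z.
  apply (HM' f a b 0%C z (2 * Cmod z + 1)); unfold M; try lra.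
  - exact Hf.
  - pose proof (Cmod_ge_0 z). lra.
  - intros w _. apply Homit.
  - replace (z - 0)%C with z by ring. pose proof (Cmod_ge_0 z). lra.
Qed.

Lemma unif_to_infty_iff (c : C) (r : R) (F : nat -> C -> C) :
  unif_to_infty_on (ball c r) F <->
  forall M, exists N, forall k, (N <= k)%nat -> forall w, Cmod (w - c) < r -> M < Cmod (F k w).
Proof.
  split; intros H M; destruct (H M) as [N HN]; exists N; intros k Hk w Hw.
  - rewrite <- Cnorm_Cmod. apply HN; [exact Hk|]. apply ball_iff, Hw.
  - rewrite Cnorm_Cmod. apply HN; [exact Hk|]. apply ball_iff, Hw.
Qed.

Definition unif_dichotomy (c : C) (r : R) (F : nat -> C -> C) : Prop :=
  unif_cauchy_on (ball c r) F \/ unif_to_infty_on (ball c r) F.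

(** If the values at the centre stay bounded along a subsequence, Schottky's and Cauchy's estimates
    supply the hypotheses of Arzela-Ascoli. Otherwise these values tend to infinity, and Schottky's
    theorem is read backwards: a small value at a nearby w would force a small value at c. *)
Theorem montel (F : nat -> C -> C) (a b c : C) (r : R) : (forall k, entire (F k)) -> 0 < r -> a <> b ->
  (forall k, omits_on (F k) c r a b) ->
  exists phi, incr phi /\ unif_dichotomy c (r / 4) (fun k => F (phi k)).
Proof.
  intros HF Hr Hab Homit.
  assert (Hd : 0 < Cmod (b - a)).
  { apply Cmod_gt_0. intros E. apply Hab. symmetry. apply Cminus_eq_0, E. }
  pose proof (Cmod_ge_0 a). pose proof (Cmod_ge_0 b).
  destruct (classic (exists M, forall N, exists k, (N <= k)%nat /\ Cmod (F k c) <= M)) as [[M HM]|Hno].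
  - destruct (extract (fun _ k => Cmod (F k c) <= M)) as [phi [Hphi Hb]]; [intros _ N; apply HM|].
    set (M1 := M + Cmod a + Cmod b).
    assert (HM0 : 0 <= M) by (eapply Rle_trans; [apply Cmod_ge_0|apply (Hb O)]).
    destruct (schottky_two_values M1 _ Hd) as [M' HM'].
    assert (Hbd : forall k w, Cmod (w - c) <= r / 2 -> Cmod (F (phi k) w) <= M').
    { intros k w Hw. apply (HM' (F (phi k)) a b c w r); unfold M1; try lra; auto.
      specialize (Hb k). lra. }
    assert (HM'0 : 0 <= M').
    { eapply Rle_trans; [apply Cmod_ge_0|apply (Hbd O c)].
      replace (c - c)%C with (RtoC 0) by ring. rewrite Cmod_0. lra. }
    destruct (arzela_ascoli (fun k => F (phi k)) c (r / 4) M' (2 * (16 * M' / r))) as [psi [Hpsi Hc]].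
    + apply Rmult_le_pos; [lra|]. apply Rmult_le_pos; [lra|left; apply Rinv_0_lt_compat, Hr].
    + intros k w Hw. apply Hbd. lra.
    + intros k v w Hv Hw. replace v with (w + (v - w))%C at 1 by ring.
      apply mean_value_bound; [apply HF|]. intros t Ht. set (p := (w + RtoC t * (v - w))%C).
      assert (Hp : Cmod (p - c) < r / 4).
      { replace (p - c)%C with (RtoC (1 - t) * (w - c) + RtoC t * (v - c))%C
          by (unfold p; rewrite RtoC_minus; ring).
        eapply Rle_lt_trans; [apply Cmod_triangle|]. rewrite !Cmod_mult, !Cmod_R, !Rabs_pos_eq by lra.
        destruct (Req_dec t 0) as [->|Ht0]; [rewrite Rminus_0_r; lra|].
        assert (0 < t) by lra. assert ((1 - t) * Cmod (w - c) <= (1 - t) * (r / 4)) by (apply Rmult_le_compat_l; lra).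
        assert (t * Cmod (v - c) < t * (r / 4)) by (apply Rmult_lt_compat_l; lra). lra. }
      replace (16 * M' / r) with (4 * M' / (r / 4)) by (field; lra).
      apply cauchy_estimate; [apply HF|lra|]. intros x Hx. apply Hbd.
      pose proof (Cmod_minus_triangle x p c). lra.
    + exists (fun k => phi (psi k)). split; [apply incr_comp; assumption|]. left. exact Hc.
  - exists (fun k => k). split; [intros k; lia|]. right. apply unif_to_infty_iff. intros M.
    set (M1 := Rabs M + Cmod a + Cmod b).
    destruct (schottky_two_values M1 _ Hd) as [M' HM']. pose proof (Rle_abs M). pose proof (Rabs_pos M).
    apply NNPP. intros Hn. apply Hno. exists M'. intros N. apply NNPP. intros HN. apply Hn. exists N.
    intros k Hk w Hw. apply Rnot_le_lt. intros Hle. apply HN. exists k. split; [exact Hk|].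
    (* The disc of radius r/2 about w lies in the disc of radius r about c, and c is within r/4 of
       w. *)
    apply (HM' (F k) a b w c (r / 2)); unfold M1; try lra; auto.
    + intros x Hx. apply Homit. pose proof (Cmod_minus_triangle x w c). lra.
    + rewrite Cmod_minus_sym. lra.
Qed.

(** * Normality of the iterates *)

(* Uniform version of [iterates_normal_on]: the disc does not depend on the subsequence. *)
Definition normal_disc (h : C -> C) (z : C) (r : R) : Prop :=
  forall s : nat -> nat, exists phi, incr phi /\ unif_dichotomy z r (fun k => iterate h (s (phi k))).

Lemma Cminus_0_r (z : C) : (z - 0)%C = z.
Proof. ring. Qed.

Lemma ball_center (z w : C) (r : R) : Cmod (w - z) < r ->
  forall v, ball w (r - Cmod (w - z)) v -> ball z r v.
Proof.
  intros Hw v Hv. apply ball_iff in Hv. apply ball_iff. pose proof (Cmod_minus_triangle v w z). lra.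
Qed.

Lemma normal_disc_in_Fatou (h : C -> C) (z w : C) (r : R) :
  normal_disc h z r -> Cmod (w - z) < r -> in_Fatou h w.
Proof.
  intros H Hw. exists (r - Cmod (w - z)). split; [lra|]. intros s.
  destruct (H s) as [phi [Hphi Hd]]. exists phi. split; [exact Hphi|].
  assert (Hsub : forall u, ball w (r - Cmod (w - z)) u ->
    exists d, 0 < d /\ (forall v, ball u d v -> ball w (r - Cmod (w - z)) v) /\
      forall v, ball u d v -> ball z r v).
  { intros u Hu. pose proof Hu as Hu'. apply ball_iff in Hu'.
    exists (r - Cmod (w - z) - Cmod (u - w)). split; [lra|].
    pose proof (ball_center w u _ Hu') as Hb. split; [exact Hb|].
    intros v Hv. apply (ball_center z w r Hw), Hb, Hv. }
  destruct Hd as [Hc|Hi].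
  - left. destruct (unif_cauchy_limit _ _ Hc) as [G HG]. exists G. intros u Hu.
    destruct (Hsub u Hu) as [d [Hd [H1 H2]]]. exists d. split; [exact Hd|]. split; [exact H1|].
    intros eps He. destruct (HG eps He) as [N HN]. exists N. intros k Hk v Hv. apply HN; auto.
  - right. intros u Hu. destruct (Hsub u Hu) as [d [Hd [H1 H2]]]. exists d.
    split; [exact Hd|]. split; [exact H1|]. intros M. destruct (Hi M) as [N HN]. exists N.
    intros k Hk v Hv. apply HN; auto.
Qed.

(** Compactness of the closed disc of half the radius turns local uniformity into uniformity, with
    one radius for all sequences [s]. *)
Lemma in_Fatou_normal_disc (h : C -> C) (z : C) : in_Fatou h z -> exists r, 0 < r /\ normal_disc h z r.
Proof.
  intros [r [Hr H]]. exists (r / 2). split; [lra|]. intros s. destruct (H s) as [phi [Hphi Hd]].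
  exists phi. split; [exact Hphi|]. destruct Hd as [[G HG]|Hi].
  - left. apply unif_conv_cauchy with G. intros eps He.
    destruct (closed_disc_eventually z (r / 2)
      (fun k w => Cnorm (Csub (iterate h (s (phi k)) w) (G w)) < eps)) as [N HN].
    { intros w Hw. destruct (HG w) as [d [Hd [_ Hu]]]; [apply ball_iff; lra|].
      destruct (Hu eps He) as [N HN]. exists d, N. split; [exact Hd|]. intros k v Hk Hv _.
      apply HN; [exact Hk|]. apply ball_iff, Hv. }
    exists N. intros k Hk w Hw. apply ball_iff in Hw. apply HN; [exact Hk|lra].
  - right. intros M.
    destruct (closed_disc_eventually z (r / 2)
      (fun k w => M < Cnorm (iterate h (s (phi k)) w))) as [N HN].
    { intros w Hw. destruct (Hi w) as [d [Hd [_ Hu]]]; [apply ball_iff; lra|].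
      destruct (Hu M) as [N HN]. exists d, N. split; [exact Hd|]. intros k v Hk Hv _.
      apply HN; [exact Hk|]. apply ball_iff, Hv. }
    exists N. intros k Hk w Hw. apply ball_iff in Hw. apply HN; [exact Hk|lra].
Qed.

Lemma unif_cauchy_bounded (c : C) (r : R) (F : nat -> C -> C) : (forall k, entire (F k)) ->
  unif_cauchy_on (ball c r) F ->
  exists N B, forall k w, (N <= k)%nat -> Cmod (w - c) < r -> Cmod (F k w) <= B.
Proof.
  intros HF Hc. destruct (Hc 1 Rlt_0_1) as [N HN].
  destruct (entire_bounded_on_disc (F N) c r (HF N)) as [B [_ HB]].
  exists N, (B + 1). intros k w Hk Hw. specialize (HB w ltac:(lra)).
  specialize (HN k N Hk (Nat.le_refl N) w). rewrite ball_iff in HN. specialize (HN Hw).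
  pose proof (Cmod_triangle_inv (F k w) (F N w)). lra.
Qed.

Lemma nonconstant_large_values (g : C -> C) (B : R) : entire g -> ~ (forall v w, g v = g w) ->
  exists a b, a <> b /\ B < Cmod (g a) /\ B < Cmod (g b).
Proof.
  intros Hg Hnc.
  assert (Hlarge : forall B', exists a, B' < Cmod (g a)).
  { intros B'. apply NNPP. intros Hn. apply Hnc, (liouville g B' Hg). intros z.
    apply Rnot_lt_le. intros Hlt. apply Hn. exists z. exact Hlt. }
  destruct (Hlarge B) as [a Ha]. destruct (Hlarge (Cmod (g a))) as [b Hb].
  exists a, b. split; [|lra]. intros ->. lra.
Qed.

Lemma iterate_commute (h f : C -> C) (n : nat) (z : C) : (forall w, h (f w) = f (h w)) ->
  iterate h n (f z) = f (iterate h n z).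
Proof. intros H. induction n; simpl; [reflexivity|]. rewrite IHn. apply H. Qed.

(* On a disc where [h^(n+1) = g o (h^n o f)] stays bounded, the maps [h^n] omit near [f z] every
   point at which [g] is larger than that bound, so Montel's theorem applies to them. *)
Lemma commuting_factor_preserves_Fatou (f g : C -> C) (z : C) : entire f -> entire g ->
  ~ (forall v w, f v = f w) -> ~ (forall v w, g v = g w) -> (forall w, f (g w) = g (f w)) ->
  in_Fatou (fun w => f (g w)) z -> in_Fatou (fun w => f (g w)) (f z).
Proof.
  intros Hf Hg Hfc Hgc Hcom HF. set (h := fun w => f (g w)) in *.
  assert (Hh : entire h) by (apply (entire_comp f g); assumption).
  assert (Hhf : forall w, h (f w) = f (h w)) by (intros w; unfold h; rewrite <- Hcom; reflexivity).
  assert (Hhg : forall n w, iterate h (S n) w = g (iterate h n (f w))).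
  { intros n w. rewrite (iterate_commute h f n w Hhf). simpl. unfold h at 1. apply Hcom. }
  destruct (in_Fatou_normal_disc h z HF) as [r [Hr HN]].
  (* Openness of f turns statements about the points f(u) into statements on a full disc about
     f(z). *)
  destruct (open_mapping f z r Hf Hfc Hr) as [r' [Hr' Hopen]].
  apply (normal_disc_in_Fatou h (f z) (f z) (r' / 4)).
  2:{ replace (f z - f z)%C with (RtoC 0) by ring. rewrite Cmod_0. lra. }
  (* Normality at z is used for the iterates of order [s k + 1], since [Hhg] spends one iteration on
     f and g. *)
  intros s. destruct (HN (fun k => S (s k))) as [phi [Hphi [Hc|Hi]]].
  - destruct (unif_cauchy_bounded z r _ (fun k => entire_iterate h (S (s (phi k))) Hh) Hc) as [N [B HB]].
    destruct (nonconstant_large_values g B Hg Hgc) as [a [b [Hab [Ha Hb]]]].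
    destruct (montel (fun k => iterate h (s (phi (k + N)%nat))) a b (f z) r') as [psi [Hpsi Hd]].
    + intros k. apply entire_iterate, Hh.
    + exact Hr'.
    + exact Hab.
    + intros k v Hv. destruct (Hopen v Hv) as [u [Hu <-]].
      specialize (HB (k + N)%nat u ltac:(lia) Hu). cbv beta in HB. rewrite Hhg in HB.
      split; intros E; rewrite E in HB; lra.
    + exists (fun k => phi (psi k + N)%nat). split; [|exact Hd].
      intros k. apply incr_lt; [exact Hphi|]. specialize (Hpsi k). lia.
  - exists phi. split; [exact Hphi|]. right. apply unif_to_infty_iff. intros M.
    (* As g is bounded on discs, g(h^n(f(u))) can tend to infinity only if h^n(f(u)) does. *)
    destruct (entire_bounded_on_disc g 0%C M Hg) as [B [_ HB]].
    destruct (proj1 (unif_to_infty_iff z r _) Hi B) as [N HN']. exists N. intros k Hk v Hv.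
    destruct (Hopen v ltac:(lra)) as [u [Hu <-]]. specialize (HN' k Hk u Hu). rewrite Hhg in HN'.
    apply Rnot_le_lt. intros Hle. specialize (HB (iterate h (s (phi k)) (f u))).
    rewrite Cminus_0_r in HB.
    specialize (HB Hle). lra.
Qed.

(** * Covering of large circles *)

(** Otherwise, for arbitrarily large r, the circles of radius 2r and 4r both contain values omitted
    on |z| < r. The rescaled map h(rz)/r omits two values of modulus 2 and 4, so Schottky's theorem
    bounds h by a multiple of r on |z| <= r/2, which makes h affine. *)
Lemma covers_circle (h : C -> C) : entire h -> ~ is_affine h ->
  exists R0, 0 < R0 /\ forall r, R0 <= r -> exists rho, 2 * r <= rho /\
    forall w, Cmod w = rho -> exists z, Cmod z < r /\ h z = w.
Proof.
  intros Hh Hna. apply NNPP. intros Hno. apply Hna.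
  (* 4 bounds the moduli of the two rescaled values, and |h(0)| bounds h(0)/r once r >= 1. *)
  set (M := 4 + Cmod (h 0%C)). pose proof (Cmod_ge_0 (h 0%C)) as Hh0.
  destruct (schottky_two_values M 2) as [M' HM']; [lra|].
  (* The bound M' r on |z| <= r/2 is 2 M' times the radius of that disc. *)
  apply linear_growth_affine with (2 * M'); [exact Hh|]. intros R0.
  set (R1 := Rmax 1 (2 * R0)). pose proof (Rmax_l 1 (2 * R0)). pose proof (Rmax_r 1 (2 * R0)).
  assert (Hr : exists r, R1 <= r /\ forall rho, 2 * r <= rho ->
     exists w, Cmod w = rho /\ forall z, Cmod z < r -> h z <> w).
  { apply NNPP. intros Hn. apply Hno. exists R1. split; [unfold R1; lra|]. intros r Hr.
    apply NNPP. intros Hn'. apply Hn. exists r. split; [exact Hr|]. intros rho Hrho.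
    apply NNPP. intros Hn''. apply Hn'. exists rho. split; [exact Hrho|]. intros w Hw.
    apply NNPP. intros Hz. apply Hn''. exists w. split; [exact Hw|]. intros z Hzr E.
    apply Hz. exists z. auto. }
  destruct Hr as [r [Hr Hom]]. fold R1 in H, H0.
  destruct (Hom (2 * r)) as [w1 [Hw1 Ho1]]; [lra|]. destruct (Hom (4 * r)) as [w2 [Hw2 Ho2]]; [lra|].
  exists (r / 2). split; [lra|]. split; [lra|]. intros x Hx.
  assert (Hrc : RtoC r <> 0%C) by (intros E; apply RtoC_inj in E; lra).
  assert (Hir : Cmod (/ RtoC r) = / r) by (rewrite Cmod_inv, Cmod_R, Rabs_pos_eq by (assumption || lra); reflexivity).
  assert (Hirp : 0 < / r) by (apply Rinv_0_lt_compat; lra).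
  set (F := fun z => (/ RtoC r * h (RtoC r * z)%C)%C).
  assert (HF : entire F).
  { apply entire_mult; [apply entire_const|].
    apply (entire_comp h (fun z => RtoC r * z)%C); [exact Hh|].
    apply entire_mult; [apply entire_const|apply entire_id]. }
  assert (HFx : Cmod (F (/ RtoC r * x)%C) <= M').
  { apply (HM' F (/ RtoC r * w1)%C (/ RtoC r * w2)%C 0%C (/ RtoC r * x)%C 1 HF Rlt_0_1).
    - rewrite Cmod_mult, Hir, Hw1. unfold M. replace (/ r * (2 * r)) with 2 by (field; lra). lra.
    - rewrite Cmod_mult, Hir, Hw2. unfold M. replace (/ r * (4 * r)) with 4 by (field; lra). lra.
    - replace (/ RtoC r * w2 - / RtoC r * w1)%C with (/ RtoC r * (w2 - w1))%C by ring.
      rewrite Cmod_mult, Hir. pose proof (Cmod_triangle_inv w2 w1) as T. rewrite Hw1, Hw2 in T.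
      replace 2 with (/ r * (2 * r)) at 1 by (field; lra). apply Rmult_le_compat_l; lra.
    - intros z Hz. replace (z - 0)%C with z in Hz by ring.
      assert (Hrz : Cmod (RtoC r * z) < r).
      { rewrite Cmod_mult, Cmod_R, Rabs_pos_eq by lra. nra. }
      assert (Hinj : forall w, (/ RtoC r * h (RtoC r * z)%C = / RtoC r * w)%C -> h (RtoC r * z)%C = w).
      { intros w E. replace w with (RtoC r * (/ RtoC r * w))%C by (field; exact Hrc). rewrite <- E. field. exact Hrc. }
      split; intros E; apply Hinj in E; [apply (Ho1 _ Hrz E)|apply (Ho2 _ Hrz E)].
    - unfold F. rewrite Cmult_0_r, Cmod_mult, Hir. unfold M.
      assert (/ r <= 1) by (rewrite <- Rinv_1; apply Rinv_le_contravar; lra). nra.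
    - replace (/ RtoC r * x - 0)%C with (/ RtoC r * x)%C by ring. rewrite Cmod_mult, Hir.
      apply Rmult_le_reg_l with r; [lra|]. rewrite <- Rmult_assoc, Rinv_r by lra. lra. }
  unfold F in HFx. replace (RtoC r * (/ RtoC r * x))%C with x in HFx by (field; exact Hrc).
  rewrite Cmod_mult, Hir in HFx.
  apply Rmult_le_reg_l with (/ r); [exact Hirp|]. eapply Rle_trans; [exact HFx|]. right. field. lra.
Qed.

Lemma maximum_principle_0 (f : C -> C) (r M : R) : entire f -> 0 < r ->
  (forall w, Cmod w = r -> Cmod (f w) <= M) -> forall w, Cmod w <= r -> Cmod (f w) <= M.
Proof.
  intros Hf Hr HM w Hw. apply (maximum_principle f 0%C r M Hf Hr).
  - intros v Hv. apply HM. replace v with (v - 0)%C by ring. exact Hv.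
  - replace (w - 0)%C with w by ring. exact Hw.
Qed.

(** If f o g is affine, then f is of size O(r) on a circle of radius rho >= 2r that g covers from
    |z| < r; by the maximum principle f grows linearly. *)
Lemma comp_not_affine (f g : C -> C) : entire f -> entire g -> ~ is_affine f -> ~ is_affine g ->
  ~ is_affine (fun w => f (g w)).
Proof.
  intros Hf Hg Hfa Hga [al [be E]]. apply Hfa.
  destruct (covers_circle g Hg Hga) as [R0 [HR0 Hcov]].
  pose proof (Cmod_ge_0 al) as Ha. pose proof (Cmod_ge_0 be) as Hb.
  apply linear_growth_affine with (Cmod al + Cmod be); [exact Hf|]. intros R1.
  (* Taking r >= 1 absorbs the constant term [be]. *)
  set (r := Rmax R0 (Rmax R1 1)). pose proof (Rmax_l R0 (Rmax R1 1)). pose proof (Rmax_r R0 (Rmax R1 1)).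
  pose proof (Rmax_l R1 1). pose proof (Rmax_r R1 1). fold r in H, H0.
  destruct (Hcov r H) as [rho [Hrho Hc]]. exists r. split; [lra|]. split; [lra|]. intros w Hw.
  apply (maximum_principle_0 f rho); [exact Hf|lra| |lra]. intros v Hv.
  destruct (Hc v Hv) as [z [Hz <-]]. rewrite E. eapply Rle_trans; [apply Cmod_triangle|].
  rewrite Cmod_mult. assert (Cmod al * Cmod z <= Cmod al * r) by (apply Rmult_le_compat_l; lra). nra.
Qed.

(** One application of h covers a circle of at least twice the radius, and a bound on that circle
    holds inside it by the maximum principle; so a bound for h^(n+1) on a disc passes to h^n on a
    disc twice as large. *)
Lemma iterates_grow (h : C -> C) : entire h -> ~ is_affine h ->
  exists R0, 0 < R0 /\ forall n r B, R0 <= r ->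
    (forall z, Cmod z < r -> Cmod (iterate h n z) <= B) -> 2 ^ n * r <= B.
Proof.
  intros Hh Hna. destruct (covers_circle h Hh Hna) as [R0 [HR0 Hcov]]. exists R0. split; [exact HR0|].
  induction n; intros r B Hr HB.
  - simpl in *. rewrite Rmult_1_l. apply Rnot_lt_le. intros Hlt.
    assert (HB0 : 0 <= B).
    { specialize (HB 0%C). rewrite Cmod_0 in HB. apply HB. lra. }
    specialize (HB (RtoC ((B + r) / 2))). rewrite Cmod_R, Rabs_pos_eq in HB by lra. lra.
  - destruct (Hcov r Hr) as [rho [Hrho Hc]].
    replace (2 ^ S n * r) with (2 ^ n * (2 * r)) by (simpl; ring).
    apply IHn; [lra|]. intros w Hw.
    apply (maximum_principle_0 (iterate h n) rho); [apply entire_iterate, Hh|lra| |lra].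
    intros v Hv. destruct (Hc v Hv) as [z [Hz <-]]. rewrite <- iterate_S_comm. apply HB, Hz.
Qed.

(** * The Julia set has at least two points *)

(** If no bound existed, maps and points with values above j could be picked for every j. A
    subsequence of these maps supplied by normality can neither be bounded on the disc, because of
    these points, nor tend to infinity, because of [w0]. *)
Lemma bounded_on_normal_disc (h : C -> C) (z w0 : C) (r M : R) (n : nat -> nat) : entire h ->
  normal_disc h z r -> Cmod (w0 - z) < r -> (forall k, Cmod (iterate h (n k) w0) <= M) ->
  exists M', forall k w, Cmod (w - z) < r -> Cmod (iterate h (n k) w) <= M'.
Proof.
  intros Hh HN Hw0 HM. apply NNPP. intros Hno.
  assert (Hs : forall j : nat, exists x : nat * C,
    Cmod (snd x - z) < r /\ INR j < Cmod (iterate h (n (fst x)) (snd x))).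
  { intros j. apply NNPP. intros Hj. apply Hno. exists (INR j). intros k w Hw.
    apply Rnot_lt_le. intros Hlt. apply Hj. exists (k, w). auto. }
  apply choice in Hs. destruct Hs as [x Hx].
  destruct (HN (fun j => n (fst (x j)))) as [phi [Hphi [Hc|Hi]]].
  - destruct (unif_cauchy_bounded z r _ (fun k => entire_iterate h _ Hh) Hc) as [N [B HB]].
    destruct (INR_unbounded B) as [j Hj].
    destruct (Hx (phi (N + j)%nat)) as [H1 H2].
    specialize (HB (N + j)%nat (snd (x (phi (N + j)%nat))) ltac:(lia) H1). cbv beta in HB.
    pose proof (incr_ge phi (N + j) Hphi) as Hge.
    assert (INR j <= INR (phi (N + j)%nat)) by (apply le_INR; lia). lra.
  - destruct (proj1 (unif_to_infty_iff z r _) Hi M) as [N HN'].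
    specialize (HN' N (Nat.le_refl N) w0 Hw0). specialize (HM (fst (x (phi N)))). lra.
Qed.

(** A supremum argument on [0, 1]: boundedness up to times near the supremum T crosses a normal disc
    about [p T] and so extends past T, unless T = 1. *)
Lemma bounded_along_path (h : C -> C) (p : R -> C) (n : nat -> nat) (M : R) : entire h -> rcont p ->
  (forall t, 0 <= t <= 1 -> in_Fatou h (p t)) -> (forall k, Cmod (iterate h (n k) (p 0)) <= M) ->
  exists M', forall t k, 0 <= t <= 1 -> Cmod (iterate h (n k) (p t)) <= M'.
Proof.
  intros Hh Hp HF HM.
  set (E := fun t => 0 <= t <= 1 /\ exists M', forall s k, 0 <= s <= t -> Cmod (iterate h (n k) (p s)) <= M').
  assert (E0 : E 0).
  { split; [lra|]. exists M. intros s k Hs. replace s with 0 by lra. apply HM. }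
  destruct (completeness E) as [T [HT1 HT2]]; [exists 1; intros t [Ht _]; lra|exists 0; exact E0|].
  assert (HT : 0 <= T <= 1) by (split; [apply HT1, E0|apply HT2; intros t [Ht _]; lra]).
  destruct (in_Fatou_normal_disc h (p T) (HF T HT)) as [r [Hr HN]].
  destruct (Hp T r Hr) as [d [Hd Hpd]].
  assert (Ht : exists t, E t /\ T - d < t <= T).
  { apply NNPP. intros Hn. assert (T <= T - d); [|lra]. apply HT2. intros t Et.
    apply Rnot_lt_le. intros Hlt. apply Hn. exists t. split; [exact Et|]. split; [exact Hlt|apply HT1, Et]. }
  destruct Ht as [t [[Ht [M1 HM1]] HtT]].
  destruct (bounded_on_normal_disc h (p T) (p t) r M1 n Hh HN) as [M2 HM2].
  { apply Hpd. apply Rabs_lt_between. lra. }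
  { intros k. apply HM1. lra. }
  set (T' := Rmin 1 (T + d / 2)).
  assert (HT' : T' <= 1 /\ T' <= T + d / 2) by (split; [apply Rmin_l|apply Rmin_r]).
  assert (HT'T : T <= T') by (apply Rmin_glb; lra).
  assert (ET' : E T').
  { split; [lra|]. exists (Rmax M1 M2). intros s k Hs. destruct (Rle_dec s t) as [Hst|Hst].
    - eapply Rle_trans; [apply HM1; lra|apply Rmax_l].
    - eapply Rle_trans; [apply HM2, Hpd, Rabs_lt_between; lra|apply Rmax_r]. }
  assert (T' <= T) by (apply HT1, ET').
  assert (HT1' : T' = 1).
  { unfold T' in *. destruct (Rle_dec 1 (T + d / 2)) as [L|L]; [apply Rmin_left, L|].
    rewrite Rmin_right in H by lra. lra. }
  destruct ET' as [_ [M' HM']]. rewrite HT1' in HM'. exists M'. intros s k Hs. apply HM', Hs.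
Qed.

(** A subsequence bounded at p stays bounded along a ray leading away from a, then around a circle
    about a, hence in its disc by the maximum principle. That disc contains |z| < R0, where a bound
    for h^n is at least 2^n R0. *)
Lemma orbits_escape (h : C -> C) (a p : C) (M : R) : entire h -> ~ is_affine h ->
  (forall w, w <> a -> in_Fatou h w) -> p <> a ->
  ~ (forall N, exists k, (N <= k)%nat /\ Cmod (iterate h k p) <= M).
Proof.
  intros Hh Hna HF Hpa Hb.
  destruct (extract (fun _ k => Cmod (iterate h k p) <= M)) as [n [Hn HM]]; [intros _ N; apply Hb|].
  destruct (iterates_grow h Hh Hna) as [R0 [HR0 Hgrow]].
  assert (Hpp : 0 < Cmod (p - a)) by (apply Cmod_gt_0; intros E; apply Hpa, Cminus_eq_0, E).
  (* Large enough that the ray from p to this radius leads away from a, and that the disc about a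
     contains |z| < R0. *)
  set (rho := Cmod (p - a) + R0 + Cmod a). pose proof (Cmod_ge_0 a) as Ha0.
  assert (Hrho : 0 < rho) by (unfold rho; lra).
  set (lam := rho / Cmod (p - a)).
  assert (Hlam : 1 <= lam).
  { unfold lam. apply Rmult_le_reg_r with (Cmod (p - a)); [exact Hpp|]. unfold Rdiv.
    rewrite Rmult_assoc, Rinv_l by lra. unfold rho. lra. }
  destruct (bounded_along_path h (fun t => p + RtoC t * (RtoC (lam - 1) * (p - a)))%C n M Hh) as [M1 HM1].
  { apply rcont_line. }
  { intros t Ht. apply HF. intros E. assert (E' : (RtoC (1 + t * (lam - 1)) * (p - a))%C = 0%C).
    { rewrite RtoC_plus, RtoC_mult. replace ((1 + RtoC t * RtoC (lam - 1)) * (p - a))%C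
        with (p + RtoC t * (RtoC (lam - 1) * (p - a)) - a)%C by ring. rewrite E. ring. }
    apply (f_equal Cmod) in E'. rewrite Cmod_mult, Cmod_R, Cmod_0, Rabs_pos_eq in E' by nra.
    assert (0 <= t * (lam - 1)) by (apply Rmult_le_pos; lra). nra. }
  { intros k. replace (p + RtoC 0 * (RtoC (lam - 1) * (p - a)))%C with p by ring. apply HM. }
  set (q := (p + RtoC 1 * (RtoC (lam - 1) * (p - a)))%C) in *.
  assert (Hqa : (q - a)%C = (RtoC lam * (p - a))%C) by (unfold q; rewrite RtoC_minus; ring).
  assert (Hqr : Cmod (q - a) = rho).
  { rewrite Hqa, Cmod_mult, Cmod_R, Rabs_pos_eq by lra. unfold lam. field. lra. }
  assert (Hq0 : (q - a)%C <> 0%C) by (apply Cmod_gt_0; lra).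
  assert (HMq : forall k, Cmod (iterate h (n k) q) <= M1) by (intros k; apply HM1; lra).
  (* The values pi and -pi of [sg] run from q through the two half circles, matching the range of
     the argument in [polar]. *)
  assert (Hcirc : forall sg : R, exists M2, forall t k, 0 <= t <= 1 ->
     Cmod (iterate h (n k) (a + cexp (0, (t * sg)%R) * (q - a))%C) <= M2).
  { intros sg. apply bounded_along_path with (p := fun t => (a + cexp (0, (t * sg)%R) * (q - a))%C) (M := M1).
    - exact Hh.
      assert (Hrc : rcont (fun t => (fun w => a + cexp (w * (0, sg)) * (q - a))%C (0 + RtoC t * 1)%C)).
      { apply (rcont_comp (fun w => a + cexp (w * (0, sg)) * (q - a))%C (fun t => 0 + RtoC t * 1)%C).
        - intros z. apply entire_ccont. apply entire_plus; [apply entire_const|].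
          apply entire_mult; [|apply entire_const].
          apply (entire_comp cexp (fun w => w * (0, sg))%C); [apply entire_cexp|].
          apply entire_mult; [apply entire_id|apply entire_const].
        - apply rcont_line. }
      replace (fun t => a + cexp (0, (t * sg)%R) * (q - a))%C
        with (fun t => (fun w => a + cexp (w * (0, sg)) * (q - a))%C (0 + RtoC t * 1)%C); [exact Hrc|].
      apply functional_extensionality. intros t. cbv beta. do 3 f_equal.
      unfold Cmult, Cplus, RtoC; simpl; f_equal; ring.
    - intros t _. apply HF. intros E.
      assert (E' : (cexp (0, (t * sg)%R) * (q - a))%C = 0%C).
      { replace (cexp (0, (t * sg)%R) * (q - a))%C with (a + cexp (0, (t * sg)%R) * (q - a) - a)%C by ring.
        rewrite E. ring. }
      apply (Cmult_neq_0 _ _ (cexp_neq_0 _) Hq0 E').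
    - intros k. rewrite Rmult_0_l. change ((0, 0) : C) with (RtoC 0). rewrite cexp_0.
      replace (a + 1 * (q - a))%C with q by ring. apply HMq. }
  pose proof PI_RGT_0 as Hpi.
  destruct (Hcirc PI) as [M2 HM2]. destruct (Hcirc (- PI)) as [M3 HM3].
  assert (Hcircle : forall k w, Cmod (w - a) = rho -> Cmod (iterate h (n k) w) <= Rmax M2 M3).
  { intros k w Hw.
    destruct (polar ((w - a) / (q - a))%C) as [zeta [Hz1 Hz2]].
    { apply Cmod_gt_0. rewrite Cmod_div by exact Hq0. rewrite Hw, Hqr.
      unfold Rdiv. rewrite Rinv_r; lra. }
    assert (Hz0 : fst zeta = 0).
    { apply (f_equal Cmod) in Hz2. rewrite Cmod_cexp, Cmod_div in Hz2 by exact Hq0.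
      rewrite Hw, Hqr in Hz2. unfold Rdiv in Hz2. rewrite Rinv_r in Hz2 by lra.
      rewrite <- exp_0 in Hz2. apply exp_inv, Hz2. }
    assert (Ew : forall sg t, snd zeta = t * sg -> w = (a + cexp (0, (t * sg)%R) * (q - a))%C).
    { intros sg t Et. rewrite <- Et, <- Hz0, <- surjective_pairing, Hz2. field. exact Hq0. }
    destruct (Rle_dec 0 (snd zeta)) as [Hs|Hs].
    - rewrite (Ew PI (snd zeta / PI)) by (field; lra).
      eapply Rle_trans; [apply HM2|apply Rmax_l]. rewrite Rabs_pos_eq in Hz1 by exact Hs.
      split; [apply Rdiv_le_0_compat; lra|]. apply Rmult_le_reg_r with PI; [lra|].
      unfold Rdiv. rewrite Rmult_assoc, Rinv_l; lra.
    - rewrite (Ew (- PI) (- snd zeta / PI)) by (field; lra).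
      eapply Rle_trans; [apply HM3|apply Rmax_r]. rewrite Rabs_left in Hz1 by lra.
      split; [apply Rdiv_le_0_compat; lra|]. apply Rmult_le_reg_r with PI; [lra|].
      unfold Rdiv. rewrite Rmult_assoc, Rinv_l; lra. }
  assert (Hbd : forall k, 2 ^ n k * R0 <= Rmax M2 M3).
  { intros k. apply Hgrow; [lra|]. intros z Hz.
    apply (maximum_principle (iterate h (n k)) a rho); [apply entire_iterate, Hh|exact Hrho|apply Hcircle|].
    pose proof (Cmod_triangle_minus z a). unfold rho. lra. }
  destruct (INR_unbounded (Rmax M2 M3 / R0)) as [k Hk]. specialize (Hbd k).
  assert (Hpow : INR k <= 2 ^ n k).
  { apply Rle_trans with (INR (n k)); [apply le_INR, incr_ge, Hn|].
    generalize (n k) as j. induction j; [simpl; lra|]. rewrite S_INR. simpl pow.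
    assert (1 <= 2 ^ j) by (apply pow_R1_Rle; lra). lra. }
  apply Rmult_lt_compat_r with (r := R0) in Hk; [|exact HR0].
  unfold Rdiv in Hk. rewrite Rmult_assoc, Rinv_l, Rmult_1_r in Hk by lra. nra.
Qed.

Theorem two_points_outside_Fatou (h : C -> C) : entire h -> ~ is_affine h ->
  exists a b : C, a <> b /\ ~ in_Fatou h a /\ ~ in_Fatou h b.
Proof.
  intros Hh Hna. apply NNPP. intros Hno.
  assert (Hex : exists a : C, forall w : C, w <> a -> in_Fatou h w).
  { destruct (classic (exists a : C, ~ in_Fatou h a)) as [[a Ha]|Hall].
    - exists a. intros w Hw. apply NNPP. intros Hn. apply Hno. exists a, w. auto.
    - exists 0%C. intros w _. apply NNPP. intros Hn. apply Hall. exists w. exact Hn. }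
  destruct Hex as [a HF]. pose proof (orbits_escape h a) as Hesc.
  assert (Hfix : forall p, p <> a -> h p <> p).
  { intros p Hp E. apply (Hesc p (Cmod p) Hh Hna HF Hp). intros N. exists N. split; [lia|].
    replace (iterate h N p) with p; [lra|]. induction N; [reflexivity|]. simpl. rewrite <- IHN. auto. }
  destruct (classic (h a = a)) as [Haa|Haa].
  - (* In the logarithmic coordinate at [a], [(h w - a) / (w - a)] is entire and omits [0] and [1]. *)
    assert (Hpre : forall p, p <> a -> h p <> a).
    { intros p Hp E. apply (Hesc p (Cmod a) Hh Hna HF Hp). intros N. exists (S N). split; [lia|].
      replace (iterate h (S N) p) with a; [lra|]. rewrite iterate_S_comm, E.
      induction N; [reflexivity|]. simpl. rewrite <- IHN. auto. }
    set (Q := fun zeta => ((h (a + cexp zeta)%C - a) * cexp (- zeta))%C).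
    assert (HQ : entire Q).
    { replace Q with (cauchy_kernel h a); [apply entire_cauchy_kernel, Hh|].
      apply functional_extensionality. intros zeta. unfold Q, cauchy_kernel. rewrite Haa. reflexivity. }
    assert (Hne : forall zeta, (a + cexp zeta)%C <> a).
    { intros zeta E. apply (cexp_neq_0 zeta). replace (cexp zeta) with (a + cexp zeta - a)%C by ring.
      rewrite E. ring. }
    assert (HQe : forall zeta, h (a + cexp zeta)%C = (a + Q zeta * cexp zeta)%C).
    { intros zeta. unfold Q.
      replace (a + (h (a + cexp zeta) - a) * cexp (- zeta) * cexp zeta)%C
        with (a + (h (a + cexp zeta) - a) * (cexp zeta * cexp (- zeta)))%C by ring.
      rewrite cexp_opp. ring. }
    assert (HQc : forall z w, Q z = Q w).
    { apply (picard Q 0 1 HQ); [intros E; apply RtoC_inj in E; lra|]. intros zeta. split; intros E.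
      - apply (Hpre _ (Hne zeta)). rewrite HQe, E. ring.
      - apply (Hfix _ (Hne zeta)). rewrite HQe, E. ring. }
    (* Constancy of [Q] says that h(w) - a is a fixed multiple of w - a. *)
    apply Hna. exists (Q 0%C), (a - Q 0 * a)%C. intros w.
    destruct (classic (w = a)) as [->|Hw]; [rewrite Haa; ring|].
    destruct (polar (w - a)%C) as [zeta [_ Hz]]; [intros E; apply Hw, Cminus_eq_0, E|].
    replace w with (a + cexp zeta)%C at 1 by (rewrite Hz; ring).
    rewrite HQe, (HQc zeta 0%C), Hz. ring.
  - assert (Hfix' : forall p, h p <> p).
    { intros p. destruct (classic (p = a)) as [->|Hp]; [exact Haa|apply Hfix, Hp]. }
    assert (Hper : forall p, p <> a -> h (h p) <> p).
    { intros p Hp E. apply (Hesc p (Cmod p) Hh Hna HF Hp). intros N. exists (N + N)%nat. split; [lia|].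
      replace (iterate h (N + N) p) with p; [lra|]. induction N; [reflexivity|].
      replace (S N + S N)%nat with (S (S (N + N))) by lia. simpl. rewrite <- IHN. auto. }
    (* If h(h(a)) = a, then h(a), which differs from a, would return to itself after two steps as
       well. *)
    assert (Hper' : forall p, h (h p) <> p).
    { intros p. destruct (classic (p = a)) as [->|Hp]; [|apply Hper, Hp].
      intros E. apply (Hper (h a) Haa). rewrite E. reflexivity. }
    assert (Hd : forall z, (h z - z)%C <> 0%C) by (intros z E; apply (Hfix' z), Cminus_eq_0, E).
    (* This quotient vanishes only where h(h(z)) = z and equals 1 only where h(z) is a fixed point;
       both are excluded, so Picard's theorem makes it a constant c. *)
    set (k := fun z => ((h (h z) - z) * / (h z - z))%C).
    assert (Hhz : entire (fun z => h z - z)%C) by (apply entire_minus; [exact Hh|apply entire_id]).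
    assert (Hk : entire k).
    { apply entire_mult; [|apply entire_inv; assumption].
      apply entire_minus; [apply (entire_comp h h); assumption|apply entire_id]. }
    assert (Hke : forall z, (h (h z) - z)%C = (k z * (h z - z))%C) by (intros z; unfold k; field; apply Hd).
    assert (Hkc : forall z, k z = k 0%C /\ k z <> 0%C /\ k z <> 1%C).
    { assert (Ho : forall z, k z <> 0%C /\ k z <> 1%C).
      { intros z. pose proof (Hke z) as E. split; intros E'; rewrite E' in E.
        - apply (Hper' z), Cminus_eq_0. rewrite E. ring.
        - apply (Hfix' (h z)). apply Cminus_eq_0.
          replace (h (h z) - h z)%C with (h (h z) - z - (h z - z))%C by ring. rewrite E. ring. }
      intros z. split; [|apply Ho].
      apply (picard k 0 1 Hk); [intros E; apply RtoC_inj in E; lra|exact Ho]. }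
    destruct (Hkc 0%C) as [_ [Hc0 Hc1]]. set (c := k 0%C) in *.
    (* Differentiating h(h(z)) - z = c (h(z) - z) gives an identity with nonzero right side. Read at
       z and at h(z), it shows that h' o h omits c and 0, so h' o h is constant, and then so is
       h'. *)
    assert (HD : forall z, (D h z * (D h (h z) - c) = 1 - c)%C).
    { intros z.
      assert (E1 : cderiv (fun z => h (h z) - z)%C z (D h (h z) * D h z - 1)%C).
      { apply cderiv_minus; [|apply cderiv_id]. apply (cderiv_comp h h); apply D_spec, Hh. }
      assert (E2 : cderiv (fun z => c * (h z - z))%C z (c * (D h z - 1))%C).
      { apply cderiv_scal, cderiv_minus; [apply D_spec, Hh|apply cderiv_id]. }
      replace (fun z => c * (h z - z))%C with (fun z => h (h z) - z)%C in E2.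
      - pose proof (cderiv_unique _ _ _ _ E1 E2) as E.
        replace (D h z * (D h (h z) - c))%C with (D h (h z) * D h z - 1 - c * D h z + 1)%C by ring.
        rewrite E. ring.
      - apply functional_extensionality. intros x. rewrite Hke. destruct (Hkc x) as [-> _]. reflexivity. }
    assert (H1c : (1 - c)%C <> 0%C) by (intros E; apply Hc1; symmetry; apply Cminus_eq_0, E).
    set (G := fun z => D h (h z)).
    assert (HG : entire G) by (apply (entire_comp (D h) h); [apply entire_D|]; exact Hh).
    assert (HGo : forall z, G z <> 0%C /\ G z <> c).
    { intros z. split; intros E.
      - apply H1c. rewrite <- (HD (h z)). fold (G z). rewrite E. ring.
      - apply H1c. rewrite <- (HD z). fold (G z). rewrite E. ring. }
    assert (HGc : forall z, G z = G 0%C) by (intros z; apply (picard G 0 c HG); [auto|exact HGo]).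
    assert (HGn : (G 0%C - c)%C <> 0%C) by (intros E; apply (proj2 (HGo 0%C)), Cminus_eq_0, E).
    apply Hna, (D_const_affine h ((1 - c) / (G 0%C - c))%C Hh). intros z.
    rewrite <- (HD z). fold (G z). rewrite HGc. field. exact HGn.
Qed.

(** * The conclusion for commuting functions *)

Lemma affine_is_polynomial (h : C -> C) : is_affine h -> is_polynomial h.
Proof.
  intros [a [b E]]. exists (b :: a :: nil). intros z. rewrite E.
  unfold poly_eval. simpl. unfold Cadd, Cmul, Cplus, Cmult, C0. simpl. f_equal; ring.
Qed.

Lemma Fatou_of_composition (f g : C -> C) (z : C) : entire f -> entire g ->
  ~ is_affine f -> ~ is_affine g -> (forall w, f (g w) = g (f w)) ->
  in_Fatou (fun w => f (g w)) z -> in_Fatou f z.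
Proof.
  intros Hf Hg Hfa Hga Hcom HF. set (h := fun w => f (g w)) in *.
  assert (Hh : entire h) by (apply (entire_comp f g); assumption).
  assert (Hnc : forall k : C -> C, ~ is_affine k -> ~ (forall v w, k v = k w)).
  { intros k Hk Hc. apply Hk. exists 0%C, (k 0%C). intros w. rewrite (Hc w 0%C). ring. }
  destruct (two_points_outside_Fatou h Hh (comp_not_affine f g Hf Hg Hfa Hga)) as [a [b [Hab [Ha Hb]]]].
  destruct (in_Fatou_normal_disc h z HF) as [r [Hr HN]].
  assert (Hinv : forall n u, in_Fatou h u -> in_Fatou h (iterate f n u)).
  { intros n u Hu. induction n; [exact Hu|]. simpl.
    apply (commuting_factor_preserves_Fatou f g); auto. }
  apply (normal_disc_in_Fatou f z z (r / 4)).
  - intros s. apply (montel (fun k => iterate f (s k)) a b z r); [|exact Hr|exact Hab|].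
    + intros k. apply entire_iterate, Hf.
    + intros k w Hw. pose proof (Hinv (s k) w (normal_disc_in_Fatou h z w r HN Hw)) as Hi.
      split; intros E; rewrite E in Hi; contradiction.
  - replace (z - z)%C with (RtoC 0) by ring. rewrite Cmod_0. lra.
Qed.

Theorem lemma7 (f g : Cplx -> Cplx) :
  transcendental_entire f -> transcendental_entire g ->
  (forall z, f (g z) = g (f z)) ->
  forall z, in_Fatou (fun w => f (g w)) z -> in_Fatou f z /\ in_Fatou g z.
Proof.
  intros [Hf Hfp] [Hg Hgp] Hcom z HF.
  assert (Hfa : ~ is_affine f) by (intros H; apply Hfp, affine_is_polynomial, H).
  assert (Hga : ~ is_affine g) by (intros H; apply Hgp, affine_is_polynomial, H).
  split.
  - apply (Fatou_of_composition f g); assumption.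
  (* The roles of f and g are exchanged, and commutation identifies the two compositions. *)
  - apply (Fatou_of_composition g f); try assumption; [auto|].
    replace (fun w => g (f w)) with (fun w => f (g w)) by (apply functional_extensionality; exact Hcom).
    exact HF.
Qed.
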